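(* Let $p$ be an odd prime, let $x$ denote the number of positive divisors of $p-1$, and for $n\ge 0$ let $\Omega(n)$ denote the number of Schur rings over the cyclic group $Z_{p^n}$ of order $p^n$. Then $\Omega(0)=1$, $\Omega(1)=x$, and for every integer $n\ge 1$, $$\Omega(n) = x\,\Omega(n-1) + \sum_{k=2}^n (c_{k-1}x+1)\,\Omega(n-k),$$ where $c_k=\frac{1}{k+1}\binom{2k}{k}$ is the $k$th Catalan number and the sum is taken to be empty when $n=1$.
   Context: For a finite group $G$ and a subset $C\subseteq G$, write $\overline{C}=\sum_{g\in C} g\in \mathbb{Q}[G]$. A Schur ring over $G$ is a subspace $S$ of the group algebra $\mathbb{Q}[G]$ spanned by $\overline{C_1},\dots,\overline{C_r}$, where $\{C_1,\dots,C_r\}$ is a partition of $G$ such that: (1) $C_1=\{1\}$; (2) for each $i$ there is a $j$ with $\{g^{-1}: g\in C_i\}=C_j$; (3) for all $i,j$, $\overline{C_i}\cdot\overline{C_j}=\sum_{k=1}^r\lambda_{ijk}\overline{C_k}$ for some scalars $\lambda_{ijk}$. A Schur ring is uniquely determined by its partition, so counting Schur rings over $G$ is counting such partitions of $G$. *)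

(* Defs.v *)
From mathcomp Require Import all_boot all_order all_algebra all_fingroup.
From mathcomp Require Import all_solvable all_field all_character.

Set Implicit Arguments.
Unset Strict Implicit.
Unset Printing Implicit Defensive.

Import GRing.Theory.
Local Open Scope ring_scope.

(* Q[G] is MathComp's group ring [group_ring rat G], whose elements are
   matrices of the regular representation of G; its product is [*m], and
   [gset_mx rat G C] is the sum of the elements of C. *)

Definition schur_span (gT : finGroupType) (G : {group gT})
    (P : {set {set gT}}) : {vspace 'M[rat]_#|G|} :=
  <<[seq gset_mx rat G C | C <- enum P]>>%VS.

(* The existence of the structure constants lambda_ijk is membership of the
   products in the span. *)
Definition schur_partition (gT : finGroupType) (G : {group gT})
    (P : {set {set gT}}) : bool :=
  [&& partition P G,
      [set 1%g] \in P,
      [forall C in P, (C^-1)%g \in P] &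
      [forall C in P, forall D in P,
         gset_mx rat G C *m gset_mx rat G D \in schur_span G P]].

Definition schur_ring (gT : finGroupType) (G : {group gT})
    (S : {vspace 'M[rat]_#|G|}) : Prop :=
  exists2 P : {set {set gT}}, schur_partition G P & S = schur_span G P.

Definition schur_rings (gT : finGroupType) (G : {group gT}) :
    seq {vspace 'M[rat]_#|G|} :=
  undup [seq schur_span G P | P <- enum (schur_partition G)].

Lemma schur_rings_uniq (gT : finGroupType) (G : {group gT}) :
  uniq (schur_rings G).
Proof. exact: undup_uniq. Qed.

Lemma schur_ringsP (gT : finGroupType) (G : {group gT})
    (S : {vspace 'M[rat]_#|G|}) :
  reflect (schur_ring S) (S \in schur_rings G).
Proof.
rewrite mem_undup; apply: (iffP mapP) => -[P].
  by rewrite mem_enum => hP ->; exists P.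
by move=> hP ->; exists P => //; rewrite mem_enum.
Qed.

(* [Zp m] is the cyclic group of order m for every m > 0, including the
   trivial group for m = 1. *)
Definition Omega (p n : nat) : nat := size (schur_rings (Zp_group (p ^ n))).

(* The division is exact. *)
Definition catalan (k : nat) : nat := 'C(k.*2, k) %/ k.+1.

Lemma catalanE (k : nat) : (catalan k * k.+1)%N = 'C(k.*2, k).
Proof.
apply: divnK; case: k => // k.
have e : (k.+2 * 'C(k.+1.*2, k.+2) = k.+1 * 'C(k.+1.*2, k.+1))%N.
  by rewrite mul_bin_left; congr (_ * _)%N; rewrite -addnn addnK.
have : (k.+2 %| k.+1 * 'C(k.+1.*2, k.+1))%N by rewrite -e dvdn_mulr.
by rewrite Gauss_dvdr // coprimeSn.
Qed.

(* Main.v *)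
Require Import Defs.
From mathcomp Require Import all_boot all_order all_algebra all_fingroup.
From mathcomp Require Import all_solvable all_field all_character.
From mathcomp Require Import zify ring.

(** A Schur ring over G is determined by the Boolean algebra of the subsets of G
    whose sums it contains, and such a family of sets is recognized by closure
    properties that pass to subgroups and to quotients: besides the Boolean
    operations, it is closed under taking the level sets of the functions
    [conv A B], which count the factorizations x = a b with a in A and b in B.
    The proof works with these families ([schur_sets]); [size_schur_rings]
    transports the count back to Schur rings.

    Let G be cyclic of order p ^ n, let G_i be its subgroup of order p ^ i, and
    let C be the atom, that is the minimal member of the family, of a generator.
    Let h < n be maximal such that G_h is a member of the family.  There are two
    possibilities.

    - If h + 1 < n, then modulo G_h no subgroup other than the two trivial ones
      is a member, and the theorem of Burnside and Schur ([primitive_atom]) says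
      that the quotient has a single atom besides 1.  Hence the multipliers that
      preserve C map onto the units modulo p ^ (n - h).  Since n - h > 1, one of
      them is a primitive root, so C is preserved by all units, and C is the
      whole complement of G_h ([trivial_top_atom]).

    - If h = n - 1, let G_k be the stabilizer of C under translation.  Modulo
      G_k, the set C is an orbit of a group of multipliers without p-torsion,
      hence of a subgroup of the cyclic group of order p - 1, and the same group
      of multipliers describes the rest of the quotient ([reduced_top]).  So C is
      an orbit times G_k, and above G_k the layers below the top are of the same
      kind ([orbit_top]).

    By induction on n, the family is described by a word with one letter for each
    block of layers ([schur_sets_code]); every word that satisfies the evident
    local condition occurs ([code_sets_schur]), and it occurs once
    ([code_sets_inj]).

    It remains to count words.  A letter of the second kind carries one of the x
    subgroups of the cyclic group of order p - 1, named by its index e, and the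
    number j = h - k; it requires that j = 0, or that the next letter carries the
    same e and some j' with j <= j' + 1.  Along a run of such letters the numbers
    j form a Lukasiewicz path, in which every step goes down by at most 1, until
    the first letter with j = 0.  The number of such runs of length k is the
    Catalan number c_(k - 1) ([ballot1]).  Reading a word from the top, its first
    run of length k contributes x c_(k - 1) Omega(n - k), and a block of k > 1
    layers of the first kind contributes Omega(n - k), which is the recurrence. *)

Set Implicit Arguments.
Unset Strict Implicit.
Unset Printing Implicit Defensive.

(** * Congruences modulo powers of an odd prime *)

Section Congruences.
Variable p : nat.
Hypotheses (p_pr : prime p) (p_odd : odd p).

Lemma prime_odd_gt2 : 2 < p.
Proof. exact: odd_prime_gt2. Qed.

Lemma eq_mod_dvd d e a b : d %| e -> a = b %[mod e] -> a = b %[mod d].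
Proof. by move=> de ab; rewrite -(modn_dvdm a de) ab modn_dvdm. Qed.

Lemma eq_mod_exp d a b k : a = b %[mod d] -> a ^ k = b ^ k %[mod d].
Proof. by move=> ab; rewrite -modnXm ab modnXm. Qed.

Lemma eq_mod_mulIl d c a b : coprime d c -> c * a = c * b %[mod d] -> a = b %[mod d].
Proof.
move=> co; wlog le_ba : a b / b <= a => [h|].
  by have [/h//|/ltnW/h{}h e] := leqP b a; apply/esym/h.
move/eqP; rewrite eqn_mod_dvd ?leq_mul2l ?le_ba ?orbT // -mulnBr Gauss_dvdr //.
by rewrite -eqn_mod_dvd // => /eqP.
Qed.

Lemma lift_exp i a b : 0 < i -> a = b %[mod p ^ i] -> a ^ p = b ^ p %[mod p ^ i.+1].
Proof.
move=> i_gt0; wlog le_ba : a b / b <= a => [h|] e.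
  by have [/h->//|/ltnW/h->//] := leqP b a.
apply/eqP; rewrite eqn_mod_dvd ?leq_exp2r ?prime_gt0 // subn_exp expnSr.
rewrite dvdn_mul -?eqn_mod_dvd ?e //.
rewrite /dvdn; apply/eqP; rewrite -[RHS](mod0n p).
have {}e : a = b %[mod p] by apply: eq_mod_dvd e; rewrite -{1}(expn1 p) dvdn_exp2l.
suff -> : \sum_(j < p) a ^ (p.-1 - j) * b ^ j = \sum_(j < p) b ^ p.-1 %[mod p].
  by rewrite sum_nat_const card_ord modnMr mod0n.
rewrite -modn_summ -[RHS]modn_summ; congr (_ %% _); apply: eq_bigr => j _.
rewrite -modnMml (eq_mod_exp _ e) modnMml -expnD subnK // -ltnS prednK ?prime_gt0 //.
Qed.

Lemma lift_exp_iter i a b : a = b %[mod p] -> a ^ (p ^ i) = b ^ (p ^ i) %[mod p ^ i.+1].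
Proof.
move=> e; elim: i => [|i IHi]; first by rewrite expn0 !expn1.
by rewrite expnSr !expnM; apply: lift_exp.
Qed.

(** The converse of [lift_exp] around 1, which is where p has to be odd: writing
    y ^ p - 1 = (y - 1) S, the factor S is congruent to p modulo p ^ 2. *)
Lemma drop_exp i y : y = 1 %[mod p] -> y ^ p = 1 %[mod p ^ i.+1] -> y = 1 %[mod p ^ i].
Proof.
have p_gt0 := prime_gt0 p_pr; have p_gt2 := prime_odd_gt2.
have [->|y_gt0] := posnP y.
  move=> /eqP; rewrite mod0n modn_small ?prime_gt1 //.
move=> e1 /eqP; rewrite eqn_mod_dvd ?expn_gt0 ?y_gt0 // -{1}(exp1n p) subn_exp => h.
apply/eqP; rewrite eqn_mod_dvd //.
have /dvdnP[t et] : p %| y - 1 by rewrite -eqn_mod_dvd // e1.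
have ey : y = t * p + 1 by rewrite -et subnK.
move: h; set S := \sum_(_ < _) _.
(* With y = 1 + t p, the terms of S are 1 + j t p, and the sum of the j < p is a
   multiple of p. *)
have eS : S = p %[mod p * p].
  have -> : S = \sum_(j < p) y ^ j.
    rewrite /S [RHS](reindex_inj rev_ord_inj) /=; apply: eq_bigr => j _.
    by rewrite exp1n muln1; congr (_ ^ _); lia.
  rewrite -modn_summ.
  have hj j : y ^ j = j * (t * p) + 1 %[mod p * p].
    elim: j => [|j IHj]; first by rewrite mul0n expn0.
    rewrite expnS -modnMmr IHj modnMmr ey.
    have -> : (t * p + 1) * (j * (t * p) + 1) = (j * t * t) * (p * p) + (j.+1 * (t * p) + 1) by lia.
    by rewrite modnMDl.
  rewrite (eq_bigr (fun j : 'I_p => (j * (t * p) + 1) %% (p * p))); last by move=> j _; apply: hj.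
  rewrite modn_summ big_split /= sum_nat_const card_ord muln1 -big_distrl /=.
  have -> : \sum_(j < p) j = p * p.-1./2.
    have := bin2_sum p; rewrite big_mkord => ->; rewrite bin2 -{1}(odd_double_half p) p_odd.
    have h := odd_double_half p; rewrite p_odd in h.
    have -> : p.-1 = (p./2).*2 by rewrite -[in LHS]h add1n.
    by rewrite doubleK h -doubleMr doubleK.
  have -> : p * p.-1./2 * (t * p) + p = p.-1./2 * t * (p * p) + p by lia.
  by rewrite modnMDl.
have /dvdnP[S' eS'] : p %| S.
  have : S = p %[mod p] by apply: eq_mod_dvd eS; apply: dvdn_mulr.
  by rewrite modnn => /eqP.
rewrite eS' mulnA expnSr dvdn_pmul2r // Gauss_dvdl //.
rewrite coprimeXl // prime_coprime //; apply: contraL isT => /dvdnP[s es].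
move: eS; rewrite eS' es -mulnA modnMl modn_small; first by lia.
by rewrite -{1}[p]muln1 ltn_pmul2l // prime_gt1.
Qed.

Lemma drop_exp_iter i k y : y = 1 %[mod p] ->
  y ^ (p ^ k) = 1 %[mod p ^ (k + i)] -> y = 1 %[mod p ^ i].
Proof.
move=> e1; elim: k => [|k IHk]; first by rewrite expn0 expn1.
rewrite addSn expnSr expnM => /drop_exp h; apply: IHk; apply: h.
by have := eq_mod_exp (p ^ k) e1; rewrite exp1n.
Qed.

Lemma eq_mod_gcd d y a b : 0 < a ->
  y ^ a = 1 %[mod d] -> y ^ b = 1 %[mod d] -> y ^ gcdn a b = 1 %[mod d].
Proof.
move=> a_gt0 ea eb; case: (egcdnP b a_gt0) => u v e _.
have := eq_mod_exp u ea; rewrite -expnM mulnC e exp1n => <-.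
rewrite expnD mulnC -[in RHS]modnMmr [v * b]mulnC expnM (eq_mod_exp v eb) exp1n.
by rewrite modnMmr muln1.
Qed.

(** Elements of order dividing p - 1 are determined by their residues modulo p,
    because raising to the power p ^ i both fixes them and forgets everything
    but that residue. *)
Lemma eq_mod_root i a b : 0 < i -> a ^ p.-1 = 1 %[mod p ^ i] -> b ^ p.-1 = 1 %[mod p ^ i] ->
  a = b %[mod p] -> a = b %[mod p ^ i].
Proof.
move=> i_gt0 ea eb e.
have h c : c ^ p.-1 = 1 %[mod p ^ i] -> c ^ (p ^ i) = c %[mod p ^ i].
  move=> ec; have /dvdnP[k ek] : p.-1 %| p ^ i - 1 by rewrite subn1 dvdn_pred_predX.
  have -> : c ^ (p ^ i) = c ^ (p.-1 * k).+1.
    congr (_ ^ _); rewrite mulnC -ek -addn1 subnK // expn_gt0 prime_gt0 //.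
  by rewrite expnS expnM -modnMmr (eq_mod_exp _ ec) exp1n modnMmr muln1.
rewrite -(h a) // -(h b) //.
by apply: eq_mod_dvd (lift_exp_iter i e); apply: dvdn_exp2l.
Qed.

(** A nontrivial element of a finite p-group has a power of order p; by
    [drop_exp] the powers of order p are close to 1. *)
Lemma mod_last_root i y : 0 < i -> y = 1 %[mod p] -> y <> 1 %[mod p ^ i] ->
  exists k, y ^ k = 1 %[mod p ^ i.-1] /\ y ^ k <> 1 %[mod p ^ i].
Proof.
case: i => // i _ e1 ne1.
have hP : exists k, y ^ (p ^ k) == 1 %[mod p ^ i.+1].
  by exists i; apply/eqP; have := lift_exp_iter i e1; rewrite exp1n.
case: (ex_minnP hP) => -[|k] /eqP ek mink; first by case: ne1; rewrite -ek expn0 expn1.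
exists (p ^ k); split; last by move/eqP/mink; rewrite ltnn.
apply: drop_exp; last by rewrite -expnM -expnSr.
by have := eq_mod_exp (p ^ k) e1; rewrite exp1n.
Qed.

Lemma exists_primitive_root : exists r,
  [/\ forall k, (r ^ k == 1 %[mod p]) = (p.-1 %| k),
      coprime p r &
      forall m, coprime p m -> exists s, m = r ^ s %[mod p]].
Proof.
have cU : cyclic [set: {unit 'F_p}] := field_unit_group_cyclic _.
have [u defU] := cyclicP cU.
have ou : #[u]%g = p.-1 by rewrite orderE -defU card_finField_unit card_Fp.
pose r : nat := val (val u).
have er (k : nat) : (r ^ k)%:R%R = val (u ^+ k)%g :> 'F_p.
  by rewrite GRing.natrX FinRing.val_unitX; congr (_ ^+ _)%R; apply: natr_Zp.
have eqF (a b : nat) : (a == b %[mod p]) = (a%:R == b%:R :> 'F_p)%R.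
  by rewrite -(inj_eq val_inj) /= !val_Fp_nat.
have rX k : (r ^ k == 1 %[mod p]) = (p.-1 %| k).
  by rewrite eqF er -(inj_eq val_inj) /= -ou order_dvdn -(inj_eq val_inj).
have p1_gt0 : 0 < p.-1 by rewrite -subn1 subn_gt0 prime_gt1.
exists r; split=> [//||m co].
  rewrite prime_coprime //; apply/negP=> pr; have := rX p.-1; rewrite dvdnn.
  by rewrite (eqP (dvdn_exp p1_gt0 pr)) modn_small ?prime_gt1.
have Um : (m%:R : 'F_p)%R \is a GRing.unit.
  by rewrite GRing.unitfE -(GRing.dvdn_pcharf (pchar_Fp p_pr)) -prime_coprime.
have : FinRing.unit 'F_p Um \in <[u]>%g by rewrite -defU inE.
case/cycleP=> s es; exists s; apply/eqP; rewrite eqF er -es //.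
Qed.

(** The powers of t represent the subgroup of order p - 1 of the units modulo
    p ^ i, for all i <= N at once: a Teichmuller lift of a primitive root. *)
Definition teichmuller N t : Prop :=
  [/\ t ^ p.-1 = 1 %[mod p ^ N],
      forall k, (t ^ k == 1 %[mod p]) = (p.-1 %| k),
      coprime p t &
      forall m, coprime p m -> exists s, m = t ^ s %[mod p]].

Lemma exists_teichmuller N : exists t, teichmuller N t.
Proof.
have [r [rX co rG]] := exists_primitive_root.
have er : r ^ (p ^ N) = r %[mod p].
  elim: N => [|N IHN]; first by rewrite expn0 expn1.
  by rewrite expnSr expnM fermat_little.
exists (r ^ (p ^ N)); split=> [|k||m com].
- rewrite -expnM mulnC expnM; have e : r ^ p.-1 = 1 %[mod p] by apply/eqP; rewrite rX.
  apply: eq_mod_dvd (dvdn_exp2l _ (leqnSn N)) _; rewrite (lift_exp_iter N e).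
  by rewrite exp1n.
- by rewrite -rX (eq_mod_exp k er).
- by rewrite coprimeXr.
have [s ->] := rG m com; exists s; apply/esym; exact: eq_mod_exp.
Qed.

(** A lift of a primitive root modulo p ^ 2 is a primitive root modulo p ^ n, by
    descent along [drop_exp]; the number t (p + 1) is such a primitive root. *)
Lemma primitive_order n m t : 1 < n -> teichmuller n t -> m = t * p.+1 %[mod p ^ 2] ->
  forall k, m ^ k = 1 %[mod p ^ n] -> p.-1 * p ^ n.-1 %| k.
Proof.
move=> n_gt1 [et tX _ _] em k ek.
have mt : m = t %[mod p].
  have -> : t = t * p.+1 %[mod p] by rewrite mulnS addnC modnMDl.
  by apply: eq_mod_dvd em; rewrite expnS dvdn_mulr.
have eki i : 0 < i <= n -> m ^ k = 1 %[mod p ^ i].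
  by case/andP=> _ le; apply: eq_mod_dvd ek; apply: dvdn_exp2l.
(* Since m = t modulo p, the order of m is p - 1 times the order of
   y = m ^ (p - 1), which is a power of p. *)
have /dvdnP[o eo] : p.-1 %| k.
  rewrite -tX -(eq_mod_exp k mt); apply/eqP.
  by have := eki 1; rewrite expn1; apply; rewrite (ltnW n_gt1).
rewrite {}eo mulnC in ek eki *.
pose y := m ^ p.-1; rewrite expnM -/y in ek.
have y1 : y = 1 %[mod p] by rewrite /y (eq_mod_exp _ mt); apply/eqP; rewrite tX.
have y2 : y <> 1 %[mod p ^ 2].
  rewrite /y (eq_mod_exp _ em) expnMn -modnMml.
  rewrite (eq_mod_dvd (dvdn_exp2l _ n_gt1) et) modnMml mul1n => e.
  have e' : p.+1 ^ p = 1 ^ p %[mod p ^ 2].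
    by apply: lift_exp; rewrite // expn1 -addn1 modnDl.
  move: e'; rewrite exp1n -{2}(prednK (prime_gt0 p_pr)) expnS -modnMmr e modnMmr muln1.
  have lt_p : p.+1 < p ^ 2 by move: (prime_odd_gt2); clear; nia.
  rewrite !modn_small ?(leq_trans _ lt_p) // => -[p0].
  by move: p_pr; rewrite p0.
rewrite dvdn_pmul2l; last by rewrite -subn1 subn_gt0 prime_gt1.
have yP : y ^ (p ^ n.-1) = 1 %[mod p ^ n].
  by have := lift_exp_iter n.-1 y1; rewrite exp1n prednK // ltnW.
have pn_gt0 : 0 < p ^ n.-1 by rewrite expn_gt0 prime_gt0.
have := eq_mod_gcd pn_gt0 yP ek; have /dvdn_pfactor[//|a le_a ea] := dvdn_gcdl (p ^ n.-1) o.
rewrite ea => ya; have [<-|ne_a] := eqVneq a n.-1; first by rewrite -ea dvdn_gcdr.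
case: y2; have lt_an : a < n.-1 by rewrite ltn_neqAle ne_a.
have {}ya : y ^ (p ^ a) = 1 %[mod p ^ (a + (n - a))] by rewrite subnKC // (leq_trans le_a (leq_pred n)).
by apply: eq_mod_dvd (drop_exp_iter y1 ya); apply: dvdn_exp2l; rewrite ltn_subRL addn1 -ltn_predRL.
Qed.

(** The powers of m are as many as the units modulo p ^ n. *)
Lemma primitive_surj n m t u : 1 < n -> teichmuller n t -> m = t * p.+1 %[mod p ^ 2] ->
  coprime p m -> coprime p u -> exists k, u = m ^ k %[mod p ^ n].
Proof.
move=> n_gt1 hT em com cou; have ord := primitive_order n_gt1 hT em.
set q := p ^ n; have q_gt0 : 0 < q by rewrite expn_gt0 prime_gt0.
have totq : totient q = p.-1 * p ^ n.-1 by rewrite totient_pfactor // ltnW.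
pose f (k : 'I_(totient q)) : 'I_q := Ordinal (ltn_pmod (m ^ k) q_gt0).
have injf : injective f.
  have half (a b : 'I_(totient q)) : a <= b -> f a = f b -> a = b.
    move=> le_ab /(congr1 val) /=; rewrite -(subnKC le_ab) expnD -{1}[m ^ a]muln1.
    have com' : coprime q (m ^ a) by rewrite coprimeXl // coprimeXr.
    move/(eq_mod_mulIl com')/esym/ord; rewrite -totq => /dvdn_leq le; apply: val_inj => /=.
    apply/eqP; rewrite eqn_leq le_ab -subn_eq0 eqn0Ngt; apply/negP=> lt.
    by have := le lt; rewrite leqNgt (leq_ltn_trans (leq_subr _ _)).
  move=> a b e; have [le|/ltnW le] := leqP a b; first exact: half.
  by apply/esym/half.
pose U := [set i : 'I_q | coprime q i].
have cardU : #|U| = totient q.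
  rewrite totient_count_coprime big_mkord -sum1dep_card big_mkcond /=.
  by apply: eq_bigr => i _; case: coprime.
have : f @: [set: 'I_(totient q)] = U.
  apply/eqP; rewrite eqEcard card_imset // cardsT card_ord cardU leqnn andbT.
  apply/subsetP=> _ /imsetP[k _ ->]; rewrite inE /= coprime_modr.
  by rewrite coprimeXl // coprimeXr.
move/setP/(_ (Ordinal (ltn_pmod u q_gt0))); rewrite inE /= coprime_modr coprimeXl //.
by case/imsetP=> k _ /(congr1 val) /= e; exists k.
Qed.

Lemma teich_root N t i k : teichmuller N t -> i <= N -> (t ^ k) ^ p.-1 = 1 %[mod p ^ i].
Proof.
case=> tN _ _ _ le_iN; rewrite -expnM mulnC expnM.
by rewrite (eq_mod_exp k (eq_mod_dvd (dvdn_exp2l p le_iN) tN)) exp1n.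
Qed.

Lemma teich_eq N t i a b : teichmuller N t -> 0 < i <= N ->
  t ^ a = t ^ b %[mod p] -> t ^ a = t ^ b %[mod p ^ i].
Proof.
by move=> hT /andP[i_gt0 le_iN]; apply: eq_mod_root => //; apply: teich_root hT le_iN.
Qed.

Lemma teich_dvd N t e a j : teichmuller N t -> e %| p.-1 ->
  t ^ a = t ^ (e * j) %[mod p] -> e %| a.
Proof.
case=> _ tX _ _ ep h; have p_gt1 := prime_gt1 p_pr.
have : p.-1 %| a + e * j * p.-2.
  rewrite -tX expnD; apply/eqP; rewrite -modnMml h modnMml -expnD -mulnS.
  by rewrite prednK; [apply/eqP; rewrite tX dvdn_mull | rewrite -subn1 subn_gt0].
move/(dvdn_trans ep); rewrite dvdn_addl // -mulnA dvdn_mulr //.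
Qed.

End Congruences.

Local Open Scope group_scope.

(** * Families of sets with the closure properties of a Schur ring *)

Section Convolution.
Variable gT : finGroupType.
Implicit Types (A B : {set gT}) (x : gT).

(** The coefficient of x in the product of the sums of A and of B in the group
    ring. *)
Definition conv A B x := #|[set a in A | a^-1 * x \in B]|.

Lemma conv_gt0 A B x : (0 < conv A B x)%N = (x \in A * B).
Proof.
rewrite card_gt0; apply/set0Pn/mulsgP => [[a]|[a b Aa Bb ->]].
  by rewrite inE => /andP[Aa Bb]; exists a (a^-1 * x); rewrite // mulKVg.
by exists a; rewrite inE Aa mulKg.
Qed.

Lemma conv_full A B x : (conv A B x == #|A|) = (A \subset x *: B^-1).
Proof.
have sS : [set a in A | a^-1 * x \in B] \subset A.
  by apply/subsetP=> a; rewrite inE => /andP[].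
have [_ E] := subset_leqif_cards sS; rewrite {}/conv {}E eqEsubset sS /=.
apply/subsetP/subsetP=> sA a Aa; move: (sA a Aa).
  by rewrite inE Aa mem_lcoset inE invMg invgK.
by rewrite inE Aa mem_lcoset inE invMg invgK.
Qed.

End Convolution.

(** The family of the sets whose sums lie in a Schur ring; when G is cyclic,
    inversion is one of the power maps that preserve it, see [schurV]. *)
Definition schur_sets (gT : finGroupType) (G : {group gT})
    (F : {set {set gT}}) : Prop :=
  [/\ forall A, A \in F -> A \subset G,
      [set 1] \in F,
      forall A, A \in F -> G :\: A \in F,
      forall A B, A \in F -> B \in F -> A :|: B \in F &
      forall A B k, A \in F -> B \in F -> [set x in G | conv A B x == k] \in F].

Section SchurSets.
Variables (gT : finGroupType) (G : {group gT}) (F : {set {set gT}}).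
Hypothesis sF : schur_sets G F.
Implicit Types (A B : {set gT}) (x y : gT).

Lemma schur_sub A : A \in F -> A \subset G. Proof. by case: sF => h _ _ _ _; apply: h. Qed.
Lemma schur1 : [set 1] \in F. Proof. by case: sF. Qed.
Lemma schurC A : A \in F -> G :\: A \in F.
Proof. by case: sF => _ _ h _ _; apply: h. Qed.
Lemma schurU A B : A \in F -> B \in F -> A :|: B \in F.
Proof. by case: sF => _ _ _ h _; apply: h. Qed.

Lemma schurT : gval G \in F.
Proof.
by have := schurU schur1 (schurC schur1); rewrite setD1K.
Qed.

Lemma schur0 : set0 \in F.
Proof. by have := schurC schurT; rewrite setDv. Qed.

Lemma schurI A B : A \in F -> B \in F -> A :&: B \in F.
Proof.
move=> FA FB; have := schurC (schurU (schurC FA) (schurC FB)).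
congr (_ \in F); apply/setP=> x; rewrite !inE.
have := subsetP (schur_sub FA) x.
by case: (x \in A) => [->|_] //; case: (x \in G); case: (x \in B).
Qed.

Lemma schurD A B : A \in F -> B \in F -> A :\: B \in F.
Proof.
move=> FA FB; have := schurI FA (schurC FB).
by rewrite setIDA (setIidPl (schur_sub FA)).
Qed.

Lemma schur_bigcup (I : finType) (P : pred I) (A : I -> {set gT}) :
  (forall i, P i -> A i \in F) -> \bigcup_(i | P i) A i \in F.
Proof. by move=> h; elim/big_rec: _ => [|i B Pi FB]; rewrite ?schur0 // schurU ?h. Qed.

Definition same_atom x y := [forall A in F, (x \in A) == (y \in A)].

Lemma same_atomP x y :
  reflect (forall A, A \in F -> (x \in A) = (y \in A)) (same_atom x y).
Proof.
by apply: (iffP forall_inP) => h A FA; [apply/eqP/h | apply/eqP; exact: h].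
Qed.

Lemma same_atom_refl x : same_atom x x.
Proof. exact/same_atomP. Qed.

(** The locked body keeps membership rewriting from unfolding atoms. *)
Definition atom x := locked [set y in G | same_atom x y].

Lemma in_atom x y : (y \in atom x) = (y \in G) && same_atom x y.
Proof. by rewrite /atom -lock inE. Qed.

Lemma schur_atom x : atom x \in F.
Proof.
have -> : atom x = G :\: \bigcup_(A in F | true) (if x \in A then G :\: A else A).
  apply/setP=> y; rewrite in_atom !inE andbC; have [Gy|] := boolP (y \in G); last by rewrite !andbF.
  rewrite !andbT; apply/same_atomP/idP=> [sxy|].
    apply/bigcupP=> [[A /andP[FA _]]].
    by rewrite (sxy A FA); case: ifP => Ay; rewrite ?inE Ay.
  move=> /bigcupP h A FA; apply/idP/idP=> [Ax|Ay].
    by apply: contraT => nAy; case: h; exists A; rewrite ?FA // Ax inE nAy.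
  by apply: contraT => nAx; case: h; exists A; rewrite ?FA // (negPf nAx).
by rewrite schurC // schur_bigcup // => A /andP[FA _]; case: ifP => _; rewrite ?schurC.
Qed.

Lemma mem_atom x : x \in G -> x \in atom x.
Proof. by move=> Gx; rewrite in_atom Gx same_atom_refl. Qed.

Lemma atom_sub x A : A \in F -> x \in A -> atom x \subset A.
Proof.
move=> FA Ax; apply/subsetP=> y; rewrite in_atom => /andP[_ /same_atomP h].
by rewrite -h.
Qed.

Lemma atom_min x A : A \in F -> A \subset atom x -> A != set0 -> A = atom x.
Proof.
move=> FA sA /set0Pn[y Ay]; apply/eqP; rewrite eqEsubset sA /=.
have := subsetP sA y Ay; rewrite in_atom => /andP[_ /same_atomP h].
by apply: atom_sub => //; rewrite h.
Qed.

Lemma schur_stable A : A \subset G ->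
  (forall x y, x \in A -> y \in G -> same_atom x y -> y \in A) -> A \in F.
Proof.
move=> sA h; suff -> : A = \bigcup_(x in A) atom x.
  by apply: schur_bigcup => x _; apply: schur_atom.
apply/setP=> y; apply/idP/bigcupP=> [Ay|[x Ax]].
  by exists y => //; apply/mem_atom/(subsetP sA).
by rewrite in_atom => /andP[Gy]; apply: h.
Qed.

Definition schur_fun (T : eqType) (f : gT -> T) :=
  {in G &, forall x y, same_atom x y -> f x = f y}.

Lemma schur_fun_set (T : eqType) (f : gT -> T) (P : pred T) :
  schur_fun f -> [set x in G | P (f x)] \in F.
Proof.
move=> hf; apply: schur_stable => [|x y].
  by apply/subsetP=> x; rewrite inE => /andP[].
by rewrite !inE => /andP[Gx Px] Gy sxy; rewrite Gy -(hf x y).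
Qed.

(** The pointwise form of the closure under products, in terms of functions that
    are constant on atoms. *)
Lemma schur_fun_conv A B : A \in F -> B \in F -> schur_fun (conv A B).
Proof.
move=> FA FB x y Gx Gy /same_atomP sxy.
have FL : [set z in G | conv A B z == conv A B x] \in F by case: sF => _ _ _ _; apply.
by have := sxy _ FL; rewrite !inE Gx Gy eqxx => /esym/eqP.
Qed.

Lemma schurM A B : A \in F -> B \in F -> A * B \in F.
Proof.
move=> FA FB; have := schur_fun_set (fun k => 0 < k)%N (schur_fun_conv FA FB).
rewrite (_ : [set x in G | _] = A * B) //; apply/setP=> x.
rewrite inE conv_gt0 andb_idl // => xAB.
by apply: (subsetP (mul_subG (schur_sub FA) (schur_sub FB))).
Qed.

Lemma schur_gen A : A \in F -> <<A>> \in F.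
Proof.
move=> FA; have [n ->] := gen_expgs A.
elim: n => [|n IHn]; first by rewrite expg0 schur1.
by rewrite expgS schurM // schurU // schur1.
Qed.

End SchurSets.

Arguments atom_sub {gT G F x A}.
Arguments atom_min {gT G F x A}.

(** * Power maps *)

Section PowerMaps.
Import GRing.Theory.
Variables (gT : finGroupType) (g : gT) (R : finComNzRingType).
Implicit Types (A B : {set gT}) (x y : gT) (f : {poly R}).

(** The function on the cyclic group generated by g whose value at x is the
    coefficient of x in f evaluated at g in the group ring.  Polynomials give
    access to the Frobenius morphism of the group ring. *)
Definition poly_fun f x : R := (\sum_(i < size f | (g ^+ i == x)%g) f`_i)%R.

Lemma poly_fun_widen n f x : (size f <= n)%N ->
  poly_fun f x = (\sum_(i < n | (g ^+ i == x)%g) f`_i)%R.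
Proof.
move=> le_fn; rewrite /poly_fun (big_ord_widen_cond n (fun i => (g ^+ i == x)%g) (fun i => f`_i)%R) //.
rewrite [RHS](bigID (fun i : 'I_n => i < size f)%N) /= [X in (_ = _ + X)%R]big1 ?addr0 //.
by move=> i /andP[_]; rewrite -leqNgt => /(nth_default 0%R).
Qed.

Lemma poly_funD f1 f2 x : poly_fun (f1 + f2)%R x = (poly_fun f1 x + poly_fun f2 x)%R.
Proof.
pose n := maxn (size f1) (size f2).
rewrite !(@poly_fun_widen n) ?leq_maxl ?leq_maxr ?(leq_trans (size_polyD _ _)) //.
by rewrite -big_split; apply: eq_bigr => i _; rewrite coefD.
Qed.

Lemma poly_fun_sum (I : Type) (r : seq I) (P : pred I) (f : I -> {poly R}) x :
  poly_fun (\sum_(i <- r | P i) f i)%R x = (\sum_(i <- r | P i) poly_fun (f i) x)%R.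
Proof.
apply: (big_morph (fun f => poly_fun f x)) => [f1 f2|]; first exact: poly_funD.
by rewrite /poly_fun size_poly0 big_ord0.
Qed.

Lemma poly_fun_XM f x : poly_fun ('X * f)%R x = poly_fun f (g^-1 * x).
Proof.
rewrite (@poly_fun_widen (size f).+1); last first.
  have [->|nzf] := eqVneq f 0%R; first by rewrite mulr0 size_poly0.
  by rewrite mulrC size_mulX.
rewrite big_mkcond big_ord_recl /= coefXM /= if_same add0r /poly_fun big_mkcond [RHS]big_mkcond /=.
apply: eq_bigr => i _; rewrite coefXM /= expgS; congr (if _ then _ else _).
by rewrite -(inj_eq (mulgI g^-1)) mulKg.
Qed.

Lemma poly_fun_XnM k f x : poly_fun ('X^k * f)%R x = poly_fun f (g ^- k * x).
Proof.
elim: k x => [|k IHk] x; first by rewrite expr0 mul1r expg0 invg1 mul1g.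
by rewrite exprS -mulrA poly_fun_XM IHk mulgA expgS invMg.
Qed.

Lemma poly_fun1 x : poly_fun 1 x = ((x == 1)%g%:R)%R.
Proof.
rewrite /poly_fun size_poly1 big_mkcond big_ord1 expg0 coef1 eqxx (eq_sym x).
by case: (1 == x).
Qed.

Lemma poly_funXn k x : poly_fun 'X^k x = ((g ^+ k == x)%g%:R)%R.
Proof.
rewrite -['X^k%R]mulr1 poly_fun_XnM poly_fun1.
by rewrite -(inj_eq (mulgI (g ^+ k))) mulKVg mulg1 eq_sym.
Qed.

Lemma sum_cycle A (E : gT -> R) : A \subset <[g]> ->
  (\sum_(a in A) E a = \sum_(i < #[g] | (g ^+ i \in A)%g) E (g ^+ i)%g)%R.
Proof.
move=> sA; pose h (i : 'I_#[g]) := g ^+ i.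
have injh : injective h.
  move=> i j /eqP; rewrite /h eq_expg_mod_order !modn_small //.
  by move/eqP/val_inj.
have -> : A = h @: [set i : 'I_#[g] | g ^+ i \in A].
  apply/setP=> a; apply/idP/imsetP=> [Aa|[i]]; last by rewrite inE => Ai ->.
  have /cyclePmin[i lti ea] := subsetP sA a Aa.
  by exists (Ordinal lti); rewrite ?inE -?ea.
rewrite big_imset /=; last by move=> i j _ _ /injh.
apply: eq_bigl => i; rewrite inE; symmetry; apply/imsetP/idP=> [[j]|]; rewrite ?inE => Aj.
  by move/injh->.
by exists i; rewrite ?inE.
Qed.

Definition set_poly A : {poly R} := (\sum_(i < #[g] | (g ^+ i \in A)%g) 'X^i)%R.

Lemma set_polyM A f x : A \subset <[g]> ->
  poly_fun (set_poly A * f)%R x = (\sum_(a in A) poly_fun f (a^-1 * x)%g)%R.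
Proof.
move=> sA; rewrite mulr_suml poly_fun_sum sum_cycle //.
by apply: eq_bigr => i _; rewrite poly_fun_XnM.
Qed.

(** In characteristic q, the q-th power of a sum is the sum of the q-th powers. *)
Lemma set_poly_pchar q A x : A \subset <[g]> -> q \in [pchar R]%R ->
  poly_fun (set_poly A ^+ q)%R x = #|[set a in A | (a ^+ q == x)%g]|%:R%R.
Proof.
move=> sA chR; have chP : q \in [pchar {poly R}]%R by rewrite pchar_poly.
rewrite -(pFrobenius_autE chP) rmorph_sum /= poly_fun_sum.
rewrite (eq_bigr (fun i : 'I__ => ((g ^+ i) ^+ q == x)%g%:R%R)).
  rewrite -(sum_cycle (fun a => (a ^+ q == x)%g%:R%R)) // -sum1_card natr_sum.
  rewrite big_mkcond [RHS]big_mkcond; apply: eq_bigr => a _ /=; rewrite inE.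
  by case: (a \in A); case: (_ == x).
by move=> i _; rewrite pFrobenius_autE -exprM poly_funXn expgM.
Qed.

Variables (G : {group gT}) (F : {set {set gT}}).
Hypothesis sF : schur_sets G F.

(** The function E is a combination of the indicators of its level sets, so that
    its convolution with A reduces to the functions [conv A B]. *)
Lemma schur_fun_sum A (E : gT -> R) : A \in F -> schur_fun G F E ->
  schur_fun G F (fun x => (\sum_(a in A) E (a^-1 * x)%g)%R).
Proof.
move=> FA hE.
pose E' x := (\sum_(r : R) r *+ conv A [set y in G | E y == r] x)%R.
suff eE x : x \in G -> (\sum_(a in A) E (a^-1 * x)%g = E' x)%R.
  move=> x y Gx Gy sxy; rewrite !eE //; apply: eq_bigr => r _; congr (_ *+ _)%R.
  apply: (schur_fun_conv sF) => //.
  exact: (schur_fun_set sF (pred1 r)).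
move=> Gx; rewrite (partition_big (fun a => E (a^-1 * x)) predT) //=.
apply: eq_bigr => r _.
rewrite (eq_bigr (fun _ => r)) ?sumr_const; last by move=> a /andP[_ /eqP].
congr (_ *+ _)%R; apply: eq_card => a; rewrite !inE unfold_in /=.
have [Aa|//] := boolP (a \in A).
have Ga := subsetP (schur_sub sF FA) a Aa.
by rewrite groupM ?groupV.
Qed.

End PowerMaps.

Section Multipliers.
Variables (gT : finGroupType) (G : {group gT}) (F : {set {set gT}}).
Hypotheses (cG : cyclic G) (sF : schur_sets G F).
Implicit Types (A B : {set gT}) (x y : gT).

(** Modulo q, the number of q-th roots of x in A is the coefficient of x in the
    q-th power of the sum of A, and that power is constant on atoms. *)
Lemma schur_fun_power q A : prime q -> A \in F ->
  schur_fun G F (fun x => #|[set a in A | a ^+ q == x]| %% q).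
Proof.
move=> q_pr FA; have [g defG] := cyclicP cG.
have sA : A \subset <[g]> by rewrite -defG (schur_sub sF).
have hk k : schur_fun G F (poly_fun g (set_poly g 'F_q A ^+ k)%R).
  elim: k => [|k IHk] x y Gx Gy sxy.
    rewrite GRing.expr0 !poly_fun1; congr (_ %:R)%R; congr nat_of_bool.
    by have /same_atomP/(_ _ (schur1 sF)) := sxy; rewrite !inE.
  by rewrite GRing.exprS !set_polyM //; apply: (schur_fun_sum sF FA IHk).
move=> x y Gx Gy sxy; have := hk q x y Gx Gy sxy.
rewrite !(set_poly_pchar _ sA (pchar_Fp q_pr)) => /(congr1 val) /=.
by rewrite !(val_Fp_nat q_pr).
Qed.

(** For q dividing the order of G, this is the theorem of Schur and Wielandt on
    the sets of q-th powers. *)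
Lemma schur_power_set q A : prime q -> A \in F ->
  [set x in G | ~~ (q %| #|[set a in A | a ^+ q == x]|)] \in F.
Proof.
move=> q_pr FA.
exact: (schur_fun_set sF (fun k => k != 0)%N (schur_fun_power q_pr FA)).
Qed.

Definition power_set m A := [set a ^+ m | a in A].

Lemma power_inj m : coprime #|G| m -> {in G &, injective (fun x => x ^+ m)}.
Proof.
move=> co x y Gx Gy /= exy; apply: (can_in_inj (expgK co)) => //.
Qed.

(** For a prime m = q prime to the order of G, every element has one q-th root,
    and the numbers in [schur_fun_power] are 0 or 1. *)
Lemma schur_multiplier m A : coprime #|G| m -> A \in F -> power_set m A \in F.
Proof.
have [k] := ubnP m; elim: k m A => // k IHk m A; rewrite ltnS => le_mk co FA.
have [->|gt0] := posnP m.
  have -> : power_set 0 A = if A == set0 then set0 else [set 1].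
    apply/setP=> x; apply/imsetP/idP=> [[a Aa ->]|].
      by rewrite expg0; case: eqP Aa => [->|_ _]; rewrite inE.
    have [->|[a Aa]] := set_0Vmem A; first by rewrite eqxx inE.
    case: ifP => _; rewrite inE // => /eqP->; by exists a.
  by case: ifP => _; rewrite (schur0 sF, schur1 sF).
have [m_le1|m_gt1] := leqP m 1.
  have -> : m = 1%N by apply/eqP; rewrite eqn_leq m_le1.
  suff -> : power_set 1 A = A by [].
  by rewrite /power_set (eq_imset _ (@expg1 _)) imset_id.
pose q := pdiv m; have q_pr : prime q by apply: pdiv_prime.
have qm : q %| m by apply: pdiv_dvd.
pose m' := m %/ q; have dm : (m' * q)%N = m by apply: divnK.
have coq : coprime #|G| q by apply: coprime_dvdr co.
have com' : coprime #|G| m' by apply: coprime_dvdr co; rewrite -dm dvdn_mulr.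
suff Fq : power_set q A \in F.
  have -> : power_set m A = power_set m' (power_set q A).
    rewrite /power_set -imset_comp; apply: eq_imset => a /=.
    by rewrite -expgM mulnC dm.
  by apply: IHk => //; apply: leq_trans le_mk; rewrite ltn_Pdiv // prime_gt1.
have := schur_power_set q_pr FA; congr (_ \in F); apply/setP=> x; rewrite inE.
have sA := subsetP (schur_sub sF FA).
apply/andP/imsetP=> [[Gx]|[a Aa ->]].
  have [->|[a]] := set_0Vmem [set a in A | a ^+ q == x].
    by rewrite cards0 dvdn0.
  by rewrite inE => /andP[Aa /eqP <-]; exists a.
rewrite groupX ?sA //; split=> //.
suff -> : [set b in A | b ^+ q == a ^+ q] = [set a].
  by rewrite cards1 dvdn1 neq_ltn prime_gt1 ?orbT.
apply/setP=> b; rewrite !inE; apply/andP/eqP=> [[Ab /eqP e]|->]; last by rewrite eqxx.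
by apply: (power_inj coq) => //; apply: sA.
Qed.

Lemma schurV A : A \in F -> A^-1 \in F.
Proof.
move=> FA; have co : coprime #|G| (#|G|).-1 by rewrite coprimenP.
have := schur_multiplier co FA; congr (_ \in F); apply/setP=> x.
rewrite inE; have sA := subsetP (schur_sub sF FA).
have ex y : y \in G -> y ^+ (#|G|).-1 = y^-1.
  move=> Gy; apply: (mulgI y); rewrite mulgV -expgS prednK ?cardG_gt0 //.
  exact: expg_cardG.
apply/imsetP/idP=> [[a Aa ->]|Ax]; first by rewrite ex ?invgK ?sA.
by exists x^-1 => //; rewrite ex ?invgK ?sA.
Qed.

(** The power map with exponent m is an automorphism of the family, as its
    inverse is a power map too. *)
Lemma atom_power m x : coprime #|G| m -> x \in G -> power_set m (atom G F x) = atom G F (x ^+ m).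
Proof.
move=> co Gx; set B := atom G F (x ^+ m).
have Gxm : x ^+ m \in G by rewrite groupX.
have Fm := schur_multiplier co (schur_atom sF x).
have sB : B \subset power_set m (atom G F x).
  by apply: (atom_sub Fm); apply/imsetP; exists x; rewrite ?mem_atom.
pose m' := expg_invn G m.
have com' : coprime #|G| m'.
  have [m0|m_gt0] := posnP m; first by move: co; rewrite m0 /coprime gcdn0 => /eqP->; rewrite gcd1n.
  rewrite /m' /expg_invn; case: egcdnP => //= u v e _.
  suff : coprime #|G| (u * m) by rewrite coprimeMr => /andP[].
  by rewrite e [gcdn m _]gcdnC (eqnP co) /coprime gcdnMDl gcdn1.
apply/eqP; rewrite eq_sym eqEsubset sB /=; apply/subsetP=> _ /imsetP[y xy ->].
have : atom G F x \subset power_set m' B.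
  apply: (atom_sub (schur_multiplier com' (schur_atom sF _))).
  by apply/imsetP; exists (x ^+ m); rewrite ?mem_atom // (expgK co).
move/subsetP/(_ y xy)/imsetP=> [z Bz ->].
rewrite -expgM mulnC expgM (expgK co) //.
by move: Bz; rewrite in_atom => /andP[].
Qed.

Lemma atom_eq x y : y \in atom G F x -> atom G F y = atom G F x.
Proof.
rewrite in_atom => /andP[_ /same_atomP h]; apply/setP=> z; rewrite !in_atom.
congr (_ && _); apply/same_atomP/same_atomP=> h' A FA; first by rewrite h ?h'.
by rewrite -h ?h'.
Qed.

(** The multipliers that move one point of an atom inside this atom preserve the
    atom. *)
Lemma atom_mult m x y : coprime #|G| m -> x \in G -> x ^+ m \in atom G F x ->
  y \in atom G F x -> y ^+ m \in atom G F x.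
Proof.
move=> co Gx h xy; rewrite -(atom_eq h) -atom_power //.
exact: imset_f.
Qed.

End Multipliers.

(** * Schur rings and families of sets *)

Section Spans.
Import GRing.Theory.
Variables (gT : finGroupType) (G : {group gT}).
Local Notation aG := (regular_repr rat G).
Local Notation gset A := (gset_mx rat G A).
Implicit Types (A B C : {set gT}) (P F : {set {set gT}}).

Definition group_comb (f : gT -> rat) : 'M[rat]_#|G| := (\sum_(x in G) f x *: aG x)%R.

Definition group_coef (M : 'M[rat]_#|G|) (x : gT) : rat := (gring_row M 0 (gring_index G x))%R.

Lemma group_combK f x : x \in G -> group_coef (group_comb f) x = f x.
Proof.
move=> Gx; rewrite /group_coef /group_comb linear_sum summxE (bigD1 x) //= big1 => [|y /andP[Gy ne]].
  by rewrite linearZ /= mxE /gring_row rowK gring_indexK // mul1g mxE !eqxx mulr1 addr0.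
rewrite linearZ /= mxE /gring_row rowK gring_indexK // mul1g mxE eqxx /=.
rewrite (can_in_eq (gring_indexK (G := G))) // eq_sym (negPf ne) mulr0 //.
Qed.

Lemma group_combE A : A \subset G -> gset A = group_comb (fun x => (x \in A)%:R)%R.
Proof.
move=> sA; rewrite /gset_mx /group_comb big_mkcond [RHS]big_mkcond; apply: eq_bigr => x _ /=.
have [Ax|nAx] := boolP (x \in A); first by rewrite (subsetP sA) // scale1r.
by rewrite scale0r if_same.
Qed.

Lemma group_combM A B : A \subset G -> B \subset G ->
  (gset A *m gset B)%R = group_comb (fun x => (conv A B x)%:R)%R.
Proof.
move=> sA sB; rewrite /gset_mx mulmx_suml /group_comb.
transitivity (\sum_(a in A) \sum_(x in G) (a^-1 * x \in B)%g%:R *: aG x)%R.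
  apply: eq_bigr => a Aa; have Ga := subsetP sA a Aa.
  rewrite mulmx_sumr (eq_bigr (fun b => aG (a * b)%g)); last first.
    by move=> b Bb; rewrite repr_mxM // (subsetP sB).
  rewrite [RHS](eq_bigr (fun x => if (a^-1 * x)%g \in B then aG x else 0)%R); last first.
    by move=> x _; case: (_ \in B); rewrite ?scale1r ?scale0r.
  rewrite -big_mkcondr /= (reindex_inj (mulgI a^-1)) /=; apply: eq_big => x; last by rewrite mulKVg.
  rewrite andb_idl // => Bx; rewrite -(mulKVg a x) groupM // (subsetP sB) //.
rewrite exchange_big /=; apply: eq_bigr => x Gx; rewrite -scaler_suml; congr (_ *: _)%R.
rewrite /conv -sum1_card natr_sum big_mkcond [RHS]big_mkcond; apply: eq_bigr => a _ /=.
by rewrite inE; case: (a \in A); case: (_ \in B).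
Qed.

Definition block_const (T : Type) P (f : gT -> T) :=
  forall C x y, C \in P -> x \in C -> y \in C -> f x = f y.

Lemma mem_schur_span P (M : 'M[rat]_#|G|) : partition P G -> M \in schur_span G P ->
  block_const P (group_coef M) /\ M = group_comb (group_coef M).
Proof.
move=> partP; have sP C : C \in P -> C \subset G by move=> PC; rewrite -(cover_partition partP) bigcup_sup.
set X := [seq gset C | C <- enum P] => MX.
have eM : M = (\sum_(i < size X) coord (in_tuple X) i M *: X`_i)%R.
  exact: (coord_span (X := in_tuple X)).
pose f x := (\sum_(i < size X) coord (in_tuple X) i M * (x \in nth set0 (enum P) i)%:R)%R.
have ltP (i : 'I_(size X)) : i < size (enum P).
  by rewrite -[Y in _ < Y](size_map (fun C => gset C)) ltn_ord.
have nthP (i : 'I_(size X)) : nth set0 (enum P) i \in P.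
  by rewrite -mem_enum mem_nth.
have eMf : M = group_comb f.
  rewrite eM /group_comb; under [RHS]eq_bigr do rewrite scaler_suml.
  rewrite exchange_big /=; apply: eq_bigr => i _.
  rewrite (nth_map set0) //.
  rewrite group_combE ?sP ?nthP //.
  by rewrite /group_comb scaler_sumr; apply: eq_bigr => x _; rewrite scalerA.
have coefM x : x \in G -> group_coef M x = f x by move=> Gx; rewrite eMf group_combK.
split; last by rewrite {1}eMf; apply: eq_bigr => x Gx; rewrite coefM.
have tI := partition_trivIset partP.
have block C D x y : C \in P -> D \in P -> x \in C -> y \in C -> x \in D -> y \in D.
  by move=> PC PD Cx Cy Dx; rewrite -(def_pblock tI PD Dx) (def_pblock tI PC Cx).
move=> C x y PC Cx Cy; rewrite !coefM ?(subsetP (sP C PC)) //; apply: eq_bigr => i _.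
congr (_ * _%:R)%R; congr nat_of_bool.
by apply/idP/idP; apply: (block C) => //; apply: nthP.
Qed.

Lemma schur_span_comb P f : partition P G -> block_const P f -> group_comb f \in schur_span G P.
Proof.
move=> partP cf; have tI := partition_trivIset partP.
have -> : group_comb f = (\sum_(x in cover P) f x *: aG x)%R by rewrite (cover_partition partP).
rewrite big_trivIset //=.
apply: memv_suml => C PC.
have [C0|[x Cx]] := set_0Vmem C; first by case/and3P: partP => _ _; rewrite -C0 PC.
rewrite (eq_bigr (fun y => f x *: aG y)%R); last by move=> y Cy; rewrite (cf C y x).
rewrite -scaler_sumr memvZ // memv_span //.
by apply: map_f; rewrite mem_enum.
Qed.

Lemma schur_span_gset P A : partition P G -> A \subset G ->
  (gset A \in schur_span G P) <-> block_const P (fun x => x \in A).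
Proof.
move=> partP sA; split=> [/(mem_schur_span partP)[c _] C x y PC Cx Cy|c].
  have sC : C \subset G by rewrite -(cover_partition partP) bigcup_sup.
  have := c C x y PC Cx Cy; rewrite group_combE // !group_combK ?(subsetP sC) //.
  by case: (x \in A); case: (y \in A) => //= /eqP; rewrite ?oner_eq0 // eq_sym oner_eq0.
rewrite group_combE //; apply: schur_span_comb => // C x y PC Cx Cy.
by rewrite (c C x y).
Qed.

Lemma schur_spanM P U V : schur_partition G P ->
  U \in schur_span G P -> V \in schur_span G P -> (U *m V)%R \in schur_span G P.
Proof.
case/and4P=> partP _ _ /forall_inP hM; set X := [seq gset C | C <- enum P] => MU MV.
have hX i j : i < size X -> j < size X -> (X`_i *m X`_j)%R \in schur_span G P.
  rewrite size_map => lti ltj; rewrite !(nth_map set0) //.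
  by apply: (forall_inP (hM _ _)); rewrite -mem_enum mem_nth.
have -> : U = (\sum_(i < size X) coord (in_tuple X) i U *: X`_i)%R.
  exact: (coord_span (X := in_tuple X)).
rewrite mulmx_suml; apply: memv_suml => i _; rewrite -scalemxAl memvZ //.
have -> : V = (\sum_(i < size X) coord (in_tuple X) i V *: X`_i)%R.
  exact: (coord_span (X := in_tuple X)).
rewrite mulmx_sumr; apply: memv_suml => j _; rewrite -scalemxAr memvZ //.
exact: hX.
Qed.

Definition span_sets (V : {vspace 'M[rat]_#|G|}) := [set A : {set gT} | (A \subset G) && (gset A \in V)].

(** Level sets of functions that are constant on the blocks are unions of
    blocks. *)
Lemma schur_sets_of_partition P : schur_partition G P -> schur_sets G (span_sets (schur_span G P)).
Proof.
move=> sP; have /and4P[partP P1 _ _] := sP.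
have sG C : C \in P -> C \subset G by move=> PC; rewrite -(cover_partition partP) bigcup_sup.
have mem A : A \subset G -> (A \in span_sets (schur_span G P)) <-> block_const P (fun x => x \in A).
  by move=> sA; rewrite inE sA /=; apply: schur_span_gset.
split=> [A|||A B|A B k].
- by rewrite inE => /andP[].
- by rewrite inE sG // memv_span // map_f // mem_enum.
- move=> A FA; have sA : A \subset G by move: FA; rewrite inE => /andP[].
  apply/(mem _ (subsetDl _ _)) => C x y PC Cx Cy; rewrite !inE.
  by move/(mem _ sA): FA => /(_ C x y PC Cx Cy) ->; rewrite !(subsetP (sG C PC)).
- move=> FA FB; have sA : A \subset G by move: FA; rewrite inE => /andP[].
  have sB : B \subset G by move: FB; rewrite inE => /andP[].
  have sAB : A :|: B \subset G by rewrite subUset sA.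
  apply/(mem _ sAB) => C x y PC Cx Cy; rewrite !inE.
  move/(mem _ sA): FA => /(_ C x y PC Cx Cy) ->.
  by move/(mem _ sB): FB => /(_ C x y PC Cx Cy) ->.
rewrite !inE => /andP[sA VA] /andP[sB VB].
have := schur_spanM sP VA VB; rewrite group_combM // => /(mem_schur_span partP)[c _].
have sL : [set x in G | conv A B x == k] \subset G by apply/subsetP=> x; rewrite inE => /andP[].
rewrite sL /=; apply/schur_span_gset => // C x y PC Cx Cy.
have Gx := subsetP (sG C PC) x Cx; have Gy := subsetP (sG C PC) y Cy.
have := c C x y PC Cx Cy; rewrite !group_combK // !inE Gx Gy /= => /eqP.
by rewrite Num.Theory.eqr_nat => /eqP->.
Qed.

Definition sets_span F : {vspace 'M[rat]_#|G|} := <<[seq gset A | A <- enum F]>>%VS.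

Lemma span_setsK P : schur_partition G P -> sets_span (span_sets (schur_span G P)) = schur_span G P.
Proof.
move=> sP; have /and4P[partP _ _ _] := sP.
apply/eqP; rewrite eqEsubv; apply/andP; split; apply/span_subvP=> v /mapP[A]; rewrite mem_enum.
  by rewrite inE => /andP[_ VA] ->.
move=> PA ->; apply: memv_span; apply: map_f; rewrite mem_enum inE.
rewrite -{1}(cover_partition partP) bigcup_sup //=.
by apply: memv_span; apply: map_f; rewrite mem_enum.
Qed.

Section Atoms.
Variable F : {set {set gT}}.
Hypotheses (cG : cyclic G) (sF : schur_sets G F).

Definition atoms := [set atom G F x | x in G].

Lemma atoms_partition : partition atoms G.
Proof.
have memG x : x \in G -> x \in atom G F x by apply: mem_atom.
apply/and3P; split.
- rewrite eqEsubset; apply/andP; split.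
    by apply/bigcupsP=> _ /imsetP[x _ ->]; apply/(schur_sub sF)/(schur_atom sF).
  by apply/subsetP=> x Gx; apply/bigcupP; exists (atom G F x); rewrite ?memG ?imset_f.
- apply/trivIsetP=> _ _ /imsetP[x Gx ->] /imsetP[y Gy ->]; apply: contraR => /pred0Pn[z /andP[xz yz]].
  by rewrite /= in xz yz; rewrite -(atom_eq xz) (atom_eq yz).
by apply/imsetP=> [[x Gx e]]; have := memG x Gx; rewrite -e inE.
Qed.

Lemma atoms_const (T : eqType) (f : gT -> T) : schur_fun G F f -> block_const atoms f.
Proof.
move=> hf C x y /imsetP[z Gz ->]; rewrite !in_atom => /andP[Gx zx] /andP[Gy zy].
by rewrite -(hf z x) // (hf z y).
Qed.

Lemma schur_fun_mem A : A \in F -> schur_fun G F (fun x => x \in A).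
Proof. by move=> FA x y _ _ /same_atomP; apply. Qed.

(** Closure under inversion comes from [schurV], and the products of atoms have
    coefficients given by [conv], which are constant on atoms. *)
Lemma atoms_schur : schur_partition G atoms.
Proof.
apply/and4P; split; first exact: atoms_partition.
- apply/imsetP; exists 1 => //; apply/eqP; rewrite eqEsubset sub1set mem_atom //.
  by apply: atom_sub; rewrite ?(schur1 sF) ?inE.
- apply/forall_inP=> _ /imsetP[x Gx ->]; apply/imsetP; exists x^-1; rewrite ?groupV //.
  have half y : y \in G -> (atom G F y)^-1 \subset atom G F y^-1.
    move=> Gy; rewrite -[atom G F y^-1]invgK invSg; apply: atom_sub.
      by apply: (schurV cG sF); apply: schur_atom.
    by rewrite inE mem_atom ?groupV.
  apply/eqP; rewrite eqEsubset half //=.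
  by rewrite -invSg invgK -{2}[x]invgK half ?groupV.
apply/forall_inP=> _ /imsetP[x Gx ->]; apply/forall_inP=> _ /imsetP[y Gy ->].
have FA z := schur_atom sF z; rewrite group_combM ?(schur_sub sF) //.
apply: schur_span_comb; first exact: atoms_partition.
move=> C a b PC Ca Cb; congr (_%:R)%R.
exact: (atoms_const (schur_fun_conv sF (FA x) (FA y)) PC Ca Cb).
Qed.

Lemma sets_span_atoms : sets_span F = schur_span G atoms.
Proof.
apply/eqP; rewrite eqEsubv; apply/andP; split; apply/span_subvP=> v /mapP[A]; rewrite mem_enum.
  move=> FA ->; apply/schur_span_gset; [exact: atoms_partition | exact: (schur_sub sF) |].
  exact/atoms_const/schur_fun_mem.
case/imsetP=> x Gx -> ->; apply: memv_span; apply: map_f.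
by rewrite mem_enum schur_atom.
Qed.

Lemma sets_spanK : span_sets (sets_span F) = F.
Proof.
apply/setP=> A; rewrite inE sets_span_atoms; apply/andP/idP=> [[sA]|FA].
  move/(schur_span_gset atoms_partition sA) => cA.
  apply: (schur_stable sF) => // x y Ax Gy sxy; have Gx := subsetP sA x Ax.
  rewrite -(cA (atom G F x) x y) ?imset_f ?mem_atom //.
  by rewrite in_atom Gy.
split; first exact: (schur_sub sF).
apply/schur_span_gset; [exact: atoms_partition | exact: (schur_sub sF) |].
exact/atoms_const/schur_fun_mem.
Qed.

End Atoms.

(** The maps [span_sets] and [sets_span] are inverse bijections between Schur
    rings and families, so a Schur ring is counted once although it is defined
    from a partition. *)
Lemma size_schur_rings (I : eqType) (r : seq I) (phi : I -> {set {set gT}}) :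
    cyclic G -> uniq r -> {in r &, injective phi} ->
    {in r, forall i, schur_sets G (phi i)} ->
    (forall F, schur_sets G F -> exists2 i, i \in r & F = phi i) ->
  size (schur_rings G) = size r.
Proof.
move=> cG Ur injphi sphi phiP; rewrite -(size_map (fun i => sets_span (phi i))).
apply/perm_size/uniq_perm; first exact: schur_rings_uniq.
  rewrite map_inj_in_uniq // => i j ri rj e; apply: injphi => //.
  by rewrite -(sets_spanK (sphi i ri)) e sets_spanK //; apply: sphi.
move=> V; apply/schur_ringsP/mapP=> [[P sP ->]|[i ri ->]].
  have [i ri ei] := phiP _ (schur_sets_of_partition sP).
  by exists i => //; rewrite -ei span_setsK.
by exists (atoms (phi i)); [apply: atoms_schur; last exact: sphi | apply: sets_span_atoms; exact: sphi].
Qed.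

End Spans.

(** * Levels in cyclic p-groups *)

(** The order of an element x of a p-group is p ^ lev x; in a cyclic p-group G,
    the subgroup of order p ^ i is ['Ohm_i(G)], the set of elements of level at
    most i. *)
Definition lev (p : nat) (gT : finGroupType) (x : gT) := logn p #[x].

Definition cyclic_pgroup (p n : nat) (gT : finGroupType) (G : {group gT}) : Prop :=
  [/\ prime p, cyclic G & #|G| = (p ^ n)%N].

Section Levels.
Variables (p : nat) (gT : finGroupType) (G : {group gT}) (n : nat).
Hypothesis hG : cyclic_pgroup p n G.
Let p_pr : prime p. Proof. by case: hG. Qed.
Let cG : cyclic G. Proof. by case: hG. Qed.
Let oG : #|G| = (p ^ n)%N. Proof. by case: hG. Qed.
Implicit Types x y : gT.
Local Notation lev := (lev p).

Lemma pG : p.-group G.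
Proof. by rewrite /pgroup oG pnatX pnat_id. Qed.

Lemma order_lev x : x \in G -> #[x] = (p ^ lev x)%N.
Proof. by move=> Gx; rewrite /lev -p_part part_pnat_id //; exact: mem_p_elt pG Gx. Qed.

Lemma lev_le x : x \in G -> lev x <= n.
Proof.
move=> Gx; rewrite -(dvdn_Pexp2l _ _ (prime_gt1 p_pr)) -order_lev // -oG.
exact: order_dvdG.
Qed.

Lemma lev_expg i x : x \in G -> (x ^+ (p ^ i) == 1) = (lev x <= i).
Proof. by move=> Gx; rewrite -order_dvdn order_lev // dvdn_Pexp2l ?prime_gt1. Qed.

Lemma mem_Ohm i x : (x \in 'Ohm_i(G)) = (x \in G) && (lev x <= i).
Proof.
rewrite (OhmEabelian pG) ?(abelianS (Ohm_sub i G)) ?cyclic_abelian // !inE.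
by case: (boolP (x \in G)) => // Gx; rewrite lev_expg.
Qed.

Lemma mem_OhmG i x : x \in G -> (x \in 'Ohm_i(G)) = (lev x <= i).
Proof. by move=> Gx; rewrite mem_Ohm Gx. Qed.

Lemma Ohm_full i : n <= i -> 'Ohm_i(G) = G.
Proof.
move=> le_ni; apply/setP=> x; rewrite mem_Ohm andb_idr // => Gx.
exact: leq_trans (lev_le Gx) le_ni.
Qed.

Lemma Ohm_subset i j : i <= j -> 'Ohm_i(G) \subset 'Ohm_j(G).
Proof.
move=> le_ij; apply/subsetP=> x; rewrite !mem_Ohm => /andP[-> /=] le_xi.
exact: leq_trans le_ij.
Qed.

Lemma eq_expg_lev x a b : x \in G -> (x ^+ a == x ^+ b) = (a == b %[mod p ^ lev x]).
Proof. by move=> Gx; rewrite eq_expg_mod_order order_lev. Qed.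

Lemma lev_eq0 x : x \in G -> (lev x == 0) = (x == 1).
Proof. by move=> Gx; rewrite -leqn0 -lev_expg // expn0 expg1. Qed.

Lemma lev1 : lev (1 : gT) = 0%N.
Proof. by rewrite /lev order1 logn1. Qed.

Lemma cyclic_mulgC x y : x \in G -> y \in G -> x * y = y * x.
Proof. by move=> Gx Gy; apply: (centsP (cyclic_abelian cG)). Qed.

Lemma levMr x z : x \in G -> z \in G -> lev z < lev x -> lev (x * z) = lev x.
Proof.
move=> Gx Gz lt_zx; apply/eqP; rewrite eqn_leq; apply/andP; split.
  by rewrite -mem_OhmG ?groupM // mem_OhmG ?(ltnW lt_zx).
have [Gxz] := groupM Gx Gz; rewrite leqNgt; apply/negP=> lt.
have : x * z \in 'Ohm_(lev x).-1(G) by rewrite mem_OhmG //; lia.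
rewrite groupMr ?mem_OhmG //; lia.
Qed.

Lemma lev_expg_coprime x m : x \in G -> coprime p m -> lev (x ^+ m) = lev x.
Proof.
move=> Gx co; rewrite /lev orderXgcd order_lev //.
by rewrite (eqP (coprimeXl _ co)) divn1.
Qed.

Lemma lev_expgp x : x \in G -> lev (x ^+ p) = (lev x).-1.
Proof.
move=> Gx; apply/eqP; rewrite eqn_leq; apply/andP; split.
  rewrite -lev_expg ?groupX // -expgM -expnS lev_expg //; lia.
by rewrite -subn1 leq_subLR -lev_expg // expnD expn1 expgM lev_expg ?groupX.
Qed.

(** Elements of a cyclic p-group are powers of each other according to their
    levels, and the exponent is a unit when the levels agree. *)
Lemma lev_generator x y : x \in G -> y \in G -> lev y <= lev x ->
  exists2 m, y = x ^+ m & (lev y = lev x -> 0 < lev x -> coprime p m).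
Proof.
move=> Gx Gy le_yx.
have : y \in <[x]>.
  have : <[y]> \subset <[x]>; last by rewrite cycle_subG.
  rewrite -(cardSg_cyclic cG) ?cycle_subG //.
  by rewrite -!orderE !order_lev // dvdn_exp2l.
case/cycleP=> m ey; exists m => // e gt0.
rewrite prime_coprime //; apply: contraL isT => /dvdnP[k ek].
have : lev y <= (lev x).-1.
  have xl : x ^+ (p ^ lev x) = 1 by apply/eqP; rewrite lev_expg.
  by rewrite -lev_expg // ey -expgM ek -mulnA -expnS prednK // mulnC expgM xl expg1n.
by rewrite e; case: (lev x) gt0 => // l _; rewrite ltnn.
Qed.

Lemma subgroup_Ohm (H : {group gT}) : H \subset G ->
  exists k, [/\ k <= n, H :=: 'Ohm_k(G) & #|H| = (p ^ k)%N].
Proof.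
move=> sHG; have := cardSg sHG; rewrite oG => /(dvdn_pfactor _ _ p_pr)[k le_kn oH].
exists k; split=> //; apply/eqP; rewrite eqEsubset; apply/andP; split.
  apply/subsetP=> x Hx; have Gx := subsetP sHG x Hx.
  by rewrite mem_OhmG // -(dvdn_Pexp2l _ _ (prime_gt1 p_pr)) -order_lev // -oH order_dvdG.
apply/subsetP=> x; rewrite mem_Ohm => /andP[Gx le_xk].
rewrite -cycle_subG -(cardSg_cyclic cG) ?cycle_subG // -orderE order_lev // oH.
exact: dvdn_exp2l.
Qed.

Lemma exists_generator : exists2 g, G :=: <[g]> & lev g = n.
Proof.
have [g defG] := cyclicP cG.
by exists g; rewrite // /lev orderE -defG oG pfactorK.
Qed.

Lemma card_Ohm k : k <= n -> #|'Ohm_k(G)| = (p ^ k)%N.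
Proof.
move=> le_kn; have [g defG lg] := exists_generator.
have Gg : g \in G by rewrite defG cycle_id.
have oh : #[g ^+ (p ^ (n - k))] = (p ^ k)%N.
  rewrite orderXdiv order_lev ?lg ?dvdn_exp2l ?leq_subr //.
  by rewrite -expnB ?prime_gt0 ?leq_subr // subKn.
have [|j [le_jn ej oj]] := @subgroup_Ohm <[g ^+ (p ^ (n - k))]>%G; first by rewrite cycle_subG groupX.
have /eqP := oj; rewrite /= -orderE oh eqn_exp2l ?prime_gt1 // => /eqP ->.
by rewrite -ej.
Qed.

Lemma Ohm_0 : 'Ohm_0(G) = [set 1].
Proof.
apply/setP=> x; rewrite mem_Ohm leqn0 inE.
by have [Gx|nGx] := boolP (x \in G); [rewrite lev_eq0 | apply/esym; apply: contraNF nGx => /eqP->].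
Qed.

Lemma Ohm_cyclic_pgroup k : k <= n -> cyclic_pgroup p k 'Ohm_k(G).
Proof.
by move=> le_kn; split; rewrite ?card_Ohm //; apply: cyclicS (Ohm_sub k G) cG.
Qed.

End Levels.

Lemma Ohm_Ohm p n (gT : finGroupType) (G : {group gT}) i k :
  cyclic_pgroup p n G -> i <= k <= n -> 'Ohm_i('Ohm_k(G)) = 'Ohm_i(G).
Proof.
move=> hG /andP[le_ik le_kn]; apply/setP=> x.
rewrite (mem_Ohm (Ohm_cyclic_pgroup hG le_kn)) !(mem_Ohm hG) -andbA; congr (_ && _).
by rewrite andb_idl // => /leq_trans; apply.
Qed.

(** * Restriction to a subgroup and quotients *)

Section Restriction.
Variables (gT : finGroupType) (G H : {group gT}) (F : {set {set gT}}).
Hypotheses (sF : schur_sets G F) (sHG : H \subset G) (FH : gval H \in F).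

Definition restrict_sets (D : {set gT}) := [set A in F | A \subset D].

Lemma schur_restrict : schur_sets H (restrict_sets H).
Proof.
split=> [A|||A B|A B k]; rewrite ?inE.
- by case/andP.
- by rewrite (schur1 sF) sub1G.
- by move=> A; rewrite !inE subsetDl andbT => /andP[FA _]; apply: (schurD sF).
- by rewrite subUset => /andP[FA ->] /andP[FB ->]; rewrite (schurU sF).
move=> /andP[FA _] /andP[FB _]; apply/andP; split; last first.
  by apply/subsetP=> x; rewrite inE => /andP[].
have := schurI sF FH (schur_fun_set sF (pred1 k) (schur_fun_conv sF FA FB)).
congr (_ \in F); apply/setP=> x; rewrite !inE.
by have [/(subsetP sHG)->|] := boolP (x \in H).
Qed.

End Restriction.

Section Quotient.
Variables (gT : finGroupType) (G K : {group gT}) (F : {set {set gT}}).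
Hypotheses (nKG : K <| G) (sF : schur_sets G F) (FK : gval K \in F).
Implicit Types A B : {set coset_of K}.

Definition coset_pre A := [set x in G | coset K x \in A].

Definition quotient_sets := [set A : {set coset_of K} | (A \subset G / K) && (coset_pre A \in F)].

Lemma coset_preT : coset_pre (G / K) = G.
Proof.
apply/setP=> x; rewrite inE andb_idr // => Gx.
exact: mem_quotient.
Qed.

Lemma coset_pre1 : coset_pre 1 = K.
Proof.
apply/setP=> x; rewrite !inE; apply/andP/idP=> [[Gx /eqP]|Kx].
  move/coset_idr; apply; exact: (subsetP (normal_norm nKG)).
by rewrite (subsetP (normal_sub nKG)) ?coset_id.
Qed.

Lemma coset_preD A B : coset_pre (A :\: B) = coset_pre A :\: coset_pre B.
Proof. by apply/setP=> x; rewrite !inE; case: (x \in G); rewrite ?andbF. Qed.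

Lemma coset_preU A B : coset_pre (A :|: B) = coset_pre A :|: coset_pre B.
Proof. by apply/setP=> x; rewrite !inE; case: (x \in G). Qed.

Lemma card_coset_pre A : A \subset G / K -> #|coset_pre A| = (#|K| * #|A|)%N.
Proof.
move=> sA; rewrite -sum1_card (partition_big (coset K) (mem A)) /=; last first.
  by move=> x; rewrite inE => /andP[].
rewrite -[#|A|]sum1_card big_distrr /=; apply: eq_bigr => c Ac.
have [x Nx Gx ec] := morphimP (subsetP sA c Ac).
rewrite muln1 -(card_rcoset K x) -sum1_card; apply: eq_bigl => y.
rewrite inE; apply/andP/idP=> [[/andP[Gy _] /eqP e]|].
  by apply/rcoset_kercosetP; rewrite ?e ?ec // (subsetP (normal_norm nKG)).
move=> Ky; have Gy : y \in G.
  by case/rcosetP: Ky => k Kk ->; rewrite groupM // (subsetP (normal_sub nKG)).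
have e : coset K y = c by rewrite ec; apply/rcoset_kercosetP; rewrite ?(subsetP (normal_norm nKG)).
by rewrite Gy e Ac eqxx.
Qed.

(** Factorizations in the quotient lift in as many ways as there are elements
    in K. *)
Lemma conv_coset_pre A B x : A \subset G / K -> x \in G ->
  conv (coset_pre A) (coset_pre B) x = (#|K| * conv A B (coset K x))%N.
Proof.
move=> sA Gx; rewrite /conv -card_coset_pre; last first.
  by apply/subsetP=> c; rewrite inE => /andP[/(subsetP sA)].
apply: eq_card => a; rewrite !inE; have [Ga|//] := boolP (a \in G).
rewrite groupM ?groupV //=; have nG := subsetP (normal_norm nKG).
by rewrite morphM ?morphV ?groupV ?nG.
Qed.

Lemma schur_quotient : schur_sets (G / K) quotient_sets.
Proof.
split=> [A|||A B|A B k]; rewrite ?inE.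
- by case/andP.
- by rewrite coset_pre1 FK sub1G.
- move=> A; rewrite !inE subsetDl /= coset_preD coset_preT => /andP[_].
  exact: (schurC sF).
- by rewrite subUset coset_preU => /andP[-> FA] /andP[-> FB]; rewrite (schurU sF).
move=> /andP[sA FA] /andP[sB FB]; apply/andP; split.
  by apply/subsetP=> x; rewrite inE => /andP[].
have := schur_fun_set sF (pred1 (#|K| * k)%N) (schur_fun_conv sF FA FB).
congr (_ \in F); apply/setP=> x; rewrite !inE.
have [Gx|//] := boolP (x \in G); rewrite mem_quotient //=.
by rewrite conv_coset_pre // eqn_pmul2l.
Qed.

End Quotient.

(** Such a set is a union of cosets of K. *)
Lemma dvdn_card_stable (gT : finGroupType) (G K : {group gT}) (A : {set gT}) :
  K <| G -> A \subset G -> (forall a z, a \in A -> z \in K -> a * z \in A) ->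
  #|K| %| #|A|.
Proof.
move=> nKG sAG stA; suff -> : A = coset_pre G (A / K).
  by rewrite card_coset_pre ?dvdn_mulr // quotientS.
have nG := subsetP (normal_norm nKG).
apply/setP=> x; rewrite inE; apply/idP/andP=> [Ax|[Gx /morphimP[a Na Aa]]].
  have Gx := subsetP sAG x Ax; split=> //.
  exact: mem_morphim (nG x Gx) Ax.
move/rcoset_kercosetP; rewrite norm_rlcoset // => h.
by have /lcosetP[z Kz ->] := h (nG x Gx) Na; apply: stA.
Qed.

(** * The theorem of Burnside and Schur *)

Section Radical.
Variables (gT : finGroupType) (G : {group gT}) (F : {set {set gT}}).
Hypotheses (cG : cyclic G) (sF : schur_sets G F).
Implicit Types (A B : {set gT}) (x y : gT).

Definition rad A := 'C_G[A | 'Rs].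
Canonical rad_group A := [group of rad A].

Lemma mem_rad A x : x \in G -> (x \in rad A) = (A :* x == A).
Proof.
move=> Gx; rewrite inE Gx /=; apply/astab1P/eqP => /=; rewrite ?rcosetE //.
Qed.

Lemma rad_stable A x a : x \in rad A -> a \in A -> a * x \in A.
Proof.
move=> rx Aa; have Gx : x \in G by case/setIP: rx.
by move: rx; rewrite mem_rad // => /eqP <-; rewrite mem_rcoset mulgK.
Qed.

Lemma radP A x : x \in G -> (forall a, a \in A -> a * x \in A) -> x \in rad A.
Proof.
move=> Gx st; rewrite mem_rad // eqEcard card_rcoset leqnn andbT.
by apply/subsetP=> y /rcosetP[a Aa ->]; apply: st.
Qed.

(** An element x stabilizes A exactly when all elements a of A satisfy
    x^-1 a \in A, that is when [conv A A^-1 x] takes its largest possible value. *)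
Lemma schur_rad A : A \in F -> rad A \in F.
Proof.
move=> FA; have := schur_fun_set sF (pred1 #|A|) (schur_fun_conv sF FA (schurV cG sF FA)).
congr (_ \in F); apply/setP=> x; rewrite inE.
have [Gx|] := boolP (x \in G); last by move=> nGx; rewrite [RHS]inE (negPf nGx).
rewrite mem_rad //= conv_full invgK.
have -> : x *: A = A :* x.
  apply/setP=> y; apply/lcosetP/rcosetP=> [] [a Aa ->]; exists a => //; last first.
    by apply: (centsP (cyclic_abelian cG)) => //; exact: (subsetP (schur_sub sF FA)).
  by apply: (centsP (cyclic_abelian cG)) => //; exact: (subsetP (schur_sub sF FA)).
by rewrite [RHS]eq_sym eqEcard card_rcoset leqnn andbT.
Qed.

End Radical.

Section BurnsideSchur.
Variables (p : nat) (gT : finGroupType) (G : {group gT}) (n : nat) (F : {set {set gT}}).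
Hypotheses (hG : cyclic_pgroup p n G) (n_gt1 : 1 < n).
Let p_pr : prime p. Proof. by case: hG. Qed.
Let cG : cyclic G. Proof. by case: hG. Qed.
Let oG : #|G| = (p ^ n)%N. Proof. by case: hG. Qed.
Hypotheses (sF : schur_sets G F).
Hypothesis primF : forall i, 0 < i < n -> 'Ohm_i(G) \notin F.
Implicit Types x y : gT.
Local Notation lev := (lev p).

Lemma primitive_subgroup (H : {group gT}) : gval H \in F -> H :=: 1 \/ H :=: G.
Proof.
move=> FH; have [k [le_kn eH oH]] := subgroup_Ohm hG (schur_sub sF FH).
have [k0|k_gt0] := posnP k; first by left; apply/eqP; rewrite trivg_card1 oH k0.
have [kn|ne_kn] := eqVneq k n; first by right; apply/eqP; rewrite eqEcard (schur_sub sF FH) oH oG kn leqnn.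
by have := @primF k; rewrite k_gt0 ltn_neqAle ne_kn le_kn -eH FH => /(_ isT).
Qed.

Lemma primitive_small A : A \in F -> A \subset 'Ohm_n.-1(G) -> A \subset [1].
Proof.
move=> FA sA; have [e|e] := primitive_subgroup (schur_gen sF FA).
  by rewrite -e subset_gen.
have : G \subset 'Ohm_n.-1(G) by rewrite -{1}e gen_subG.
move/subset_leq_card; rewrite oG (card_Ohm hG) ?leq_pred //.
by rewrite leq_exp2l ?prime_gt1 // -ltnS prednK ?ltnn // ltnW.
Qed.

Lemma primitive_stable A : A \in F ->
  (forall a z, a \in A -> z \in 'Ohm_1(G) -> a * z \in A) -> A = set0 \/ A = G.
Proof.
move=> FA st; have [e|e] := primitive_subgroup (schur_rad cG sF FA).
  have : 'Ohm_1(G) \subset [1].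
    rewrite -e; apply/subsetP=> z Pz; apply: radP => [|a Aa]; last exact: st.
    exact: (subsetP (Ohm_sub 1 G)).
  move/subset_leq_card; rewrite (card_Ohm hG (ltnW n_gt1)) expn1.
  by rewrite [X in _ <= X]cards1 leqNgt prime_gt1.
have [->|[a Aa]] := set_0Vmem A; [by left | right].
apply/eqP; rewrite eqEsubset (schur_sub sF FA); apply/subsetP=> x Gx.
have Ga := subsetP (schur_sub sF FA) a Aa.
rewrite -(mulKVg a x); apply: (@rad_stable _ G) Aa.
by rewrite (e : rad G A = G) groupM ?groupV.
Qed.

Variable g : gT.
Hypotheses (Gg : g \in G) (lg : lev g = n).
Local Notation C := (atom G F g).
Local Notation P := 'Ohm_1(G).

Let g_neq1 : g != 1.
Proof. by apply: contraL n_gt1 => /eqP g1; rewrite -lg g1 lev1. Qed.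

Let C1 : 1 \notin C.
Proof.
rewrite in_atom group1 /=; apply/negP=> /same_atomP/(_ _ (schur1 sF)).
by rewrite !inE eqxx (negPf g_neq1).
Qed.

Let sCG : {subset C <= G}. Proof. exact/subsetP/(schur_sub sF)/schur_atom. Qed.

Let PG z : z \in P -> z \in G. Proof. exact/subsetP/Ohm_sub. Qed.

Let memP z : z \in G -> (z \in P) = (lev z <= 1).
Proof. exact: (mem_OhmG hG). Qed.

(** Let D be the set of the x such that the number of p-th roots of x in C is
    prime to p.  It is a member of the family that lies in a proper subgroup, so
    it is trivial.  The p-th roots of c ^ p form the coset c P, and when
    c ^ p differs from 1 the number of those that lie in C is a positive multiple
    of p. *)
Lemma primitive_coset c z : c \in C -> c \notin P -> z \in P -> c * z \in C.
Proof.
move=> Cc nPc Pz; have Gc := sCG Cc.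
pose S := [set a in C | a ^+ p == c ^+ p].
have FD := schur_power_set cG sF p_pr (schur_atom sF g).
have := primitive_small FD.
set D := [set x in G | _] => sD.
have {}sD : D \subset [1].
  apply: sD; apply/subsetP=> x; rewrite inE => /andP[Gx].
  have [->|[a]] := set_0Vmem [set a in C | a ^+ p == x]; first by rewrite cards0 dvdn0.
  rewrite inE => /andP[Ca /eqP <-] _; have Ga := sCG Ca.
  rewrite (mem_OhmG hG) ?groupX // (lev_expgp hG) //.
  by rewrite -!subn1 leq_sub2r // (lev_le hG).
have cp : c ^+ p \notin D.
  apply: contra nPc => /(subsetP sD); rewrite inE => cp1.
  by rewrite memP // -(lev_expg hG) // expn1.
have pS : p %| #|S|.
  by move: cp; rewrite inE groupX //= negbK.
have sS : S \subset c *: P.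
  apply/subsetP=> a; rewrite inE => /andP[Ca /eqP e]; have Ga := sCG Ca.
  rewrite mem_lcoset memP ?groupM ?groupV // -(lev_expg hG) ?groupM ?groupV //.
  rewrite expn1 expgMn; last by apply: (cyclic_mulgC hG); rewrite ?groupV.
  by rewrite expgVn e mulVg.
have oP : #|c *: P| = p by rewrite card_lcoset (card_Ohm hG) ?expn1 // ltnW.
have S_gt0 : 0 < #|S| by apply/card_gt0P; exists c; rewrite inE Cc eqxx.
have eS : S = c *: P.
  by apply/eqP; rewrite eqEcard sS oP dvdn_leq.
have : c * z \in S by rewrite eS mem_lcoset mulKg.
by rewrite inE => /andP[].
Qed.

Let nPG : P <| G. Proof. exact: Ohm_normal. Qed.
Let oP : #|P| = p. Proof. by rewrite (card_Ohm hG) ?expn1 // ltnW. Qed.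
Let gP : g \notin P. Proof. by rewrite memP // lg -ltnNge. Qed.
Let Cg : g \in C. Proof. exact: mem_atom. Qed.

Let mulPl z a : z \in P -> a \in G -> (z * a \in P) = (a \in P).
Proof. by move=> Pz Ga; rewrite groupMl. Qed.

(* Outside P, the atom C and its complement U are unions of cosets of P.  What
   remains to be found is the trace Y of C on P; its complement in P is Z. *)
Let coset_l z a : z \in P -> a \in G -> a \notin P -> (z * a \in C) = (a \in C).
Proof.
have half y b : y \in P -> b \in C -> b \notin P -> y * b \in C.
  move=> Py Cb nPb; rewrite (cyclic_mulgC hG (PG Py) (sCG Cb)).
  exact: primitive_coset.
move=> Pz Ga nPa; apply/idP/idP=> [Cza|Ca]; last exact: half.
by rewrite -(mulKg z a); apply: half; rewrite ?groupV ?mulPl.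
Qed.

Let U := G :\: C.
Let Z := P :\: C.
Let Y := P :&: C.

Let conv_U x : conv U C^-1 x = #|[set a in U | x^-1 * a \in C]|.
Proof. by apply: eq_card => a; rewrite !inE invMg invgK. Qed.

(* The number of pairs (u, c) in U x C with u c^-1 = y is computed in two ways,
   at a point y of Y and, modulo p, at the generator g. *)
Let conv_y y : y \in Y -> conv U C^-1 y = #|[set a in Z | y^-1 * a \in Y]|.
Proof.
case/setIP=> Py Cy; rewrite conv_U; apply: eq_card => a; rewrite [LHS]in_set [RHS]in_set !(in_setD _ _ a) in_setI.
have [Ga|nGa] := boolP (a \in G); last first.
  by rewrite (contraNF (@PG a) nGa) /= !andbF.
rewrite mulPl ?groupV //; have [Pa|nPa] := boolP (a \in P); first by rewrite !andbT.
by rewrite coset_l ?groupV //= !andbF andbT; case: (a \in C).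
Qed.

Let conv_g : conv U C^-1 g = (g^-1 \in C) * #|Z| %[mod p].
Proof.
rewrite conv_U -(cardsID P) -modnDmr.
set S := _ :\: P; have : #|P| %| #|S|.
  apply: (dvdn_card_stable nPG) => [|a z].
    by apply/subsetP=> a; rewrite !inE => /and3P[_ /andP[_ ->]].
  rewrite !inE => /and3P[nPa /andP[nCa Ga] Cga] Pz; have Gz := PG Pz.
  rewrite groupMr // nPa groupM //= andbT.
  rewrite (cyclic_mulgC hG Ga Gz) coset_l // nCa /=.
  rewrite (cyclic_mulgC hG Gz Ga) mulgA; apply: primitive_coset => //.
  apply: contra nCa => Pga; rewrite -(mulKVg g a); exact: primitive_coset.
rewrite oP => /eqP ->; rewrite addn0; congr (_ %% _).
have eZ a : a \in P -> (g^-1 * a \in C) = (g^-1 \in C).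
  move=> Pa; rewrite (cyclic_mulgC hG (groupVr Gg) (PG Pa)) coset_l ?groupV //.
have [Cg'|nCg'] := boolP (g^-1 \in C).
  rewrite mul1n; apply: eq_card => a; rewrite !inE.
  have [Pa|] := boolP (a \in P); last by rewrite !andbF.
  by rewrite eZ // Cg' (PG Pa) !andbT.
rewrite mul0n; apply/eqP; rewrite cards_eq0; apply/eqP/setP=> a; rewrite !inE.
have [Pa|] := boolP (a \in P); last by rewrite !andbF.
by rewrite eZ // (negPf nCg') !andbF.
Qed.

(** The values of [conv U C^-1] at y in Y and at g agree since both points lie in
    C.  At y it is the size of the part of Z sent into Y by y^-1; at g it is 0 or
    the size of Z, up to a multiple of p.  As Z has less than p elements, either
    y^-1 sends Z into Y, or it sends Z into Z.  The latter would put y in Z, so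
    y^-1 z \in Y for all y in Y and z in Z.  This makes Z a proper subgroup of P,
    so that Z = 1, and then the union of 1 and C is a union of cosets of P,
    hence all of G. *)
Lemma primitive_atom : C = G :\ 1.
Proof.
have st1 : Y = P :\ 1 -> C = G :\ 1.
  move=> eY; have FC1 := schurU sF (schur1 sF) (schur_atom sF g).
  have [a z|e|e] := primitive_stable FC1.
  - move=> C1a Pz; have [Pa|nPa] := boolP (a \in P).
      rewrite !inE; have [//|/= ne1] := eqVneq (a * z) 1.
      have : a * z \in Y by rewrite eY !inE ne1 groupM.
      by case/setIP.
    move: C1a; rewrite !inE => /orP[/eqP a1|]; first by case/negP: nPa; rewrite a1 group1.
    by move=> Ca; rewrite (primitive_coset Ca nPa Pz) orbT.
  - by have := in_set0 (1 : gT); rewrite -e !inE eqxx.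
  apply/setP=> x; have : (x \in G) = (x \in 1 |: C) by rewrite -e.
  rewrite !in_setU1 in_setD1 => ->.
  by have [->|] := eqVneq x 1; rewrite ?(negPf C1).
have Z1 : 1 \in Z by rewrite inE C1 group1.
(* If Y is empty, C itself is a union of cosets of P, hence equal to G. *)
have [Y0|[y Yy]] := set_0Vmem Y.
  have [a z Ca Pz|e|e] := primitive_stable (schur_atom sF g).
  - apply: primitive_coset => //; apply/negP=> Pa.
    by have := in_set0 a; rewrite -Y0 inE Pa Ca.
  - by move: Cg; rewrite e inE.
  by case/negP: C1; rewrite e.
have Z_lt : #|Z| < p.
  rewrite -oP; apply: proper_card; rewrite properE subsetDl /=.
  by case/setIP: Yy => Py Cy; apply/subsetPn; exists y; rewrite // inE Cy.
have keyY y' z : y' \in Y -> z \in Z -> y'^-1 * z \in Y.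
  move=> Yy' Zz; have [Py' Cy'] := setIP Yy'.
  have eC : conv U C^-1 y' = conv U C^-1 g.
    apply: (schur_fun_conv sF) => //; rewrite ?PG //.
    - exact: schurC (schur_atom sF g).
    - by apply: (schurV cG sF); exact: schur_atom.
    by move: Cy'; rewrite in_atom => /andP[_ /same_atomP h]; apply/same_atomP=> A /h->.
  have := conv_g; rewrite -eC conv_y //; set S := [set a in Z | _].
  have sSZ : S \subset Z by apply/subsetP=> a; rewrite inE => /andP[].
  have leS := subset_leq_card sSZ.
  rewrite !modn_small ?(leq_ltn_trans leS) //; last by case: (_ \in C); rewrite ?mul1n ?mul0n ?prime_gt0.
  have [_|_] := boolP (g^-1 \in C).
    rewrite mul1n => eS; have : z \in S; last by rewrite inE => /andP[].
    by have/eqP-> : S == Z; rewrite ?eqEcard ?sSZ ?eS //=.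
  (* Here y'^-1 preserves Z; its powers send 1 to y'. *)
  rewrite mul0n => /eqP; rewrite cards_eq0 => /eqP S0.
  have nS a : a \in Z -> y'^-1 * a \in Z.
    move=> Za; have Pa : a \in P by case/setDP: Za.
    have := in_set0 a; rewrite -S0 inE Za /= => /negbT.
    by rewrite !in_setD !in_setI groupM ?groupV //= andbT.
  have nSk k : y'^-1 ^+ k \in Z by elim: k => [|k IHk]; rewrite ?expg0 // expgS nS.
    by have := nSk #[y'^-1].-1; rewrite -invg_expg invgK inE Cy'.
apply: st1.
have gZ : group_set Z.
  apply/group_setP; split=> // a b Za Zb.
  have [Pa _] := setDP Za; have [Pb nCb] := setDP Zb.
  rewrite inE groupM // andbT; apply/negP=> Cab.
  have := keyY (a * b) a; rewrite in_setI groupM // Cab => /(_ isT Za).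
  rewrite invMg mulgKV => Yb; have := keyY b^-1 1 Yb Z1.
  by rewrite invgK mulg1 in_setI (negPf nCb) andbF.
have Ztriv : Z = [set 1].
  have := cardSg (_ : Group gZ \subset P); rewrite /= subsetDl oP => /(_ isT).
  case/primeP: p_pr => _ h /h /orP[] /eqP eZ; last by move: Z_lt; rewrite eZ ltnn.
  by apply/eqP; rewrite eq_sym eqEcard eZ sub1set Z1 cards1.
apply/setP=> x; have : (x \in Z) = (x == 1) by rewrite Ztriv inE.
rewrite !inE => <-.
by case: (x \in P); case: (x \in C).
Qed.

End BurnsideSchur.

(** * A top block made of several layers *)

Section QuotientLevels.
Variables (p n k : nat) (gT : finGroupType) (G : {group gT}).
Hypotheses (hG : cyclic_pgroup p n G) (le_kn : k <= n).
Let K := 'Ohm_k(G).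
Let p_pr : prime p. Proof. by case: hG. Qed.
Let nKG : K <| G. Proof. exact: Ohm_normal. Qed.
Let nG : {subset G <= 'N(K)}. Proof. exact/subsetP/normal_norm. Qed.

Lemma quotient_cyclic_pgroup : cyclic_pgroup p (n - k) (G / K).
Proof.
case: (hG) => _ cG oG; split=> //; first exact: quotient_cyclic.
rewrite card_quotient ?normal_norm // -divgS ?normal_sub // oG (card_Ohm hG) //.
by rewrite expnB ?prime_gt0.
Qed.

Lemma lev_coset x : x \in G -> lev p (coset K x) = lev p x - k.
Proof.
move=> Gx; have GKx : coset K x \in G / K by apply: mem_quotient.
suff h i : (lev p (coset K x) <= i) = (lev p x - k <= i).
  by apply/eqP; rewrite eqn_leq h leqnn -h leqnn.
have -> : (lev p x - k <= i) = (x ^+ (p ^ i) \in K).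
  rewrite (mem_OhmG hG) ?groupX // -(lev_expg hG k) ?groupX //.
  by rewrite -expgM -expnD (lev_expg hG) // leq_subLR addnC.
rewrite -(lev_expg quotient_cyclic_pgroup) // -morphX ?nG //=.
apply/eqP/idP=> [|Kx]; last exact: coset_id.
by apply: coset_idr; rewrite nG ?groupX.
Qed.

Lemma coset_pre_Ohm i : coset_pre G 'Ohm_i(G / K) = 'Ohm_(i + k)(G).
Proof.
apply/setP=> x; rewrite inE [in RHS](mem_Ohm hG).
have [Gx|//] := boolP (x \in G).
rewrite (mem_OhmG quotient_cyclic_pgroup) ?mem_quotient //=.
by rewrite lev_coset // leq_subLR addnC.
Qed.

End QuotientLevels.

Section TrivialTop.
Variables (p n h : nat) (gT : finGroupType) (G : {group gT}) (F : {set {set gT}}).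
Hypotheses (hG : cyclic_pgroup p n G) (p_odd : odd p) (lt_hn : h.+1 < n).
Hypotheses (sF : schur_sets G F) (FH : 'Ohm_h(G) \in F).
Hypothesis gapF : forall i, h < i < n -> 'Ohm_i(G) \notin F.
Let H := 'Ohm_h(G).
Let p_pr : prime p. Proof. by case: hG. Qed.
Let cG : cyclic G. Proof. by case: hG. Qed.
Let nHG : H <| G. Proof. exact: Ohm_normal. Qed.
Let nG : {subset G <= 'N(H)}. Proof. exact/subsetP/normal_norm. Qed.
Let le_hn : h <= n. Proof. by rewrite ltnW // ltnW. Qed.

Variable g : gT.
Hypotheses (Gg : g \in G) (lg : lev p g = n).
Let C := atom G F g.

Let sCG : {subset C <= G}. Proof. exact/subsetP/(schur_sub sF)/schur_atom. Qed.

(* By the theorem of Burnside and Schur in G / H, the atom C meets all cosets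
   of H outside H. *)
Let CH x : x \in G -> x \notin H -> exists2 c, c \in C & coset H c = coset H x.
Proof.
move=> Gx nHx; pose A := coset H @: C.
have hq := quotient_cyclic_pgroup hG le_hn.
have sQ := schur_quotient nHG sF FH.
have sAG : A \subset G / H.
  by apply/subsetP=> _ /imsetP[c Cc ->]; apply: mem_quotient; apply: sCG.
have QA : A \in quotient_sets G H F.
  rewrite inE sAG /=; have := schurM sF (schur_atom sF g) FH.
  congr (_ \in F); apply/setP=> y; rewrite inE.
  apply/mulsgP/andP=> [[c z Cc Hz ->]|[Gy /imsetP[c Cc e]]].
    have Gz := subsetP (normal_sub nHG) z Hz; have Gc := sCG Cc; rewrite groupM //; split=> //.
    apply/imsetP; exists c => //; rewrite morphM ?nG //.
    by rewrite [coset_morphism _ z]coset_id // mulg1.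
  have /rcoset_kercosetP : coset H y = coset H c by [].
  rewrite norm_rlcoset ?(nG (sCG Cc)) // => hr.
  by have /lcosetP[z Kz ->] := hr (nG Gy) isT; exists c z.
have lq : lev p (coset H g) = n - h by rewrite (lev_coset hG le_hn) ?lg.
have primQ i : 0 < i < n - h -> 'Ohm_i(G / H) \notin quotient_sets G H F.
  case/andP=> i_gt0 lt_i; rewrite inE Ohm_sub /= (coset_pre_Ohm hG le_hn) //.
  by apply: gapF; rewrite -{1}[h]add0n ltn_add2r i_gt0 addnC -ltn_subRL.
have GHg : coset H g \in G / H by apply: mem_quotient.
have := primitive_atom hq _ sQ primQ GHg lq.
rewrite ltn_subRL addn1 => /(_ lt_hn) eA.
have : atom (G / H) (quotient_sets G H F) (coset H g) \subset A.
  by apply: atom_sub QA _; apply: imset_f; apply: mem_atom.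
rewrite eA => /subsetP/(_ (coset H x)).
rewrite in_setD1 mem_quotient // andbT => /(_ _)/imsetP[].
  by apply: contra nHx => /eqP; apply: coset_idr; rewrite nG.
by move=> c Cc e; exists c.
Qed.

Let C_H c : c \in C -> c \notin H.
Proof.
rewrite in_atom => /andP[_ /same_atomP/(_ _ FH) <-].
by rewrite (mem_OhmG hG) // lg -ltnNge ltnW.
Qed.

Let C_mult m c : coprime p m -> g ^+ m \in C -> c \in C -> c ^+ m \in C.
Proof.
move=> com Cgm Cc; have co : coprime #|G| m by case: hG => _ _ ->; rewrite coprimeXl.
exact: (atom_mult cG sF).
Qed.

(** The element c of C in the coset of the power of g with exponent
    m = t (p + 1) is g ^+ m0 with m0 = m modulo p ^ 2, because H has index at
    least p ^ 2 in G.  So C is stable under the primitive root m0, hence under all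
    units, and C contains with an element all elements of the same level. *)
Lemma trivial_top_atom : C = G :\: H.
Proof.
have [t hT] := exists_teichmuller p_pr n; have [_ _ cot _] := hT.
have p_gt0 := prime_gt0 p_pr.
pose m := (t * p.+1)%N.
have com : coprime p m by rewrite coprimeMr cot coprimenS.
have Ggm : g ^+ m \in G by rewrite groupX.
have [|c Cc e] := CH Ggm.
  by rewrite (mem_OhmG hG) // (lev_expg_coprime hG) // lg -ltnNge ltnW.
have Gc := sCG Cc.
have /rcoset_kercosetP := e; rewrite norm_rlcoset ?nG // => /(_ isT isT).
case/lcosetP=> z Hz ec.
have Gz : z \in G by apply: (subsetP (normal_sub nHG)).
have Gg2 : g ^+ (p ^ 2) \in G by rewrite groupX.
have lg2 : lev p (g ^+ (p ^ 2)) = n.-2.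
  by rewrite expnS expn1 expgM !(lev_expgp hG) ?groupX // lg.
have [|s ez _] := lev_generator hG Gg2 Gz.
  rewrite lg2; move: Hz; rewrite (mem_OhmG hG) // => /leq_trans; apply.
  by move: lt_hn; case: (n) => [|[|k]].
pose m0 := (m + p ^ 2 * s)%N.
have em0 : (m0 = t * p.+1 %[mod p ^ 2])%N by rewrite /m0 addnC [(p ^ 2 * s)%N]mulnC modnMDl.
have com0 : coprime p m0.
  have : coprime (p ^ 2) m0; last by rewrite coprime_pexpl.
  by rewrite -coprime_modr em0 coprime_modr coprimeXl.
have Cgm0 : g ^+ m0 \in C by rewrite /m0 expgD expgM -ez -ec.
have stC k x : x \in C -> x ^+ (m0 ^ k) \in C.
  move=> Cx; elim: k => [|k IHk]; first by rewrite expn0 expg1.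
  by rewrite expnSr expgM C_mult.
have n_gt1 : 1 < n by apply: leq_ltn_trans lt_hn.
apply/setP=> x; rewrite in_setD; apply/idP/andP=> [Cx|[nHx Gx]]; first by rewrite C_H ?sCG.
have [d Cd ed] := CH Gx nHx; have Gd := sCG Cd.
have ld : lev p d = lev p x.
  have := lev_coset hG le_hn Gd; rewrite ed (lev_coset hG le_hn) //.
  have := C_H Cd; move: nHx; rewrite !(mem_OhmG hG) // -!ltnNge => /ltnW hx /ltnW hd.
  by move/(congr1 (addn h)); rewrite !subnKC.
have [|u ex cou] := lev_generator hG Gd Gx; first by rewrite ld.
have {}cou : coprime p u.
  by apply: cou; rewrite ld //; move: nHx; rewrite (mem_OhmG hG) // -ltnNge; case: lev.
have [k ek] := primitive_surj p_pr p_odd n_gt1 hT em0 com0 cou.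
suff -> : x = d ^+ (m0 ^ k) by apply: stC.
rewrite ex; apply/eqP; rewrite (eq_expg_lev hG) //; apply/eqP.
by apply: eq_mod_dvd ek; apply: dvdn_exp2l; apply: lev_le hG _ Gd.
Qed.

End TrivialTop.

(** * A top layer that is a single orbit *)

Definition power_stable (gT : finGroupType) (m : nat) (A : {set gT}) :=
  forall a, a \in A -> a ^+ m \in A.

Lemma power_stableX (gT : finGroupType) m k (A : {set gT}) :
  power_stable m A -> power_stable (m ^ k) A.
Proof.
move=> st a Aa; elim: k => [|k IHk]; first by rewrite expn0 expg1.
by rewrite expnSr expgM st.
Qed.

Section ReducedTop.
Variables (p N t : nat) (gT : finGroupType).
Hypotheses (p_odd : odd p) (hT : teichmuller p N t).

Section Generator.
Variables (n : nat) (G : {group gT}) (F : {set {set gT}}) (g : gT).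
Hypotheses (hG : cyclic_pgroup p n G) (n_gt0 : 0 < n) (le_nN : n <= N).
Hypotheses (sF : schur_sets G F) (FH : 'Ohm_n.-1(G) \in F).
Hypotheses (Gg : g \in G) (lg : lev p g = n).
Let C := atom G F g.
Let P := 'Ohm_1(G).
Hypothesis red : ~ (forall c z, c \in C -> z \in P -> c * z \in C).

Let p_pr : prime p. Proof. by case: hG. Qed.
Let cG : cyclic G. Proof. by case: hG. Qed.
Let sCG : {subset C <= G}. Proof. exact/subsetP/(schur_sub sF)/schur_atom. Qed.
Let coG m : coprime p m -> coprime #|G| m.
Proof. by case: hG => _ _ -> com; rewrite coprimeXl. Qed.

Lemma top_lev c : c \in C -> lev p c = n.
Proof.
move=> Cc; have Gc := sCG Cc; apply/eqP; rewrite eqn_leq (lev_le hG) //=.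
move: Cc; rewrite in_atom => /andP[_ /same_atomP/(_ _ FH)].
rewrite !(mem_OhmG hG) // lg leqNgt => e; apply: contraT; rewrite -ltnNge => lt.
have : lev p c <= n.-1 by rewrite -ltnS prednK.
by rewrite -e prednK // leqnn.
Qed.

Lemma top_coprime m : g ^+ m \in C -> coprime p m.
Proof.
move=> /top_lev lgm; have := lg; rewrite -lgm.
rewrite prime_coprime // => e; apply/negP=> /dvdnP[k ek].
have : lev p (g ^+ m) <= n.-1.
  rewrite ek expgM (lev_expgp hG) ?groupX // -!subn1 leq_sub2r //.
  by rewrite (lev_le hG) ?groupX.
by rewrite lgm -ltnS prednK // ltnn.
Qed.

Lemma top_stable m : g ^+ m \in C -> power_stable m C.
Proof.
by move=> Cgm c; apply: atom_mult => //; apply/coG/top_coprime.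
Qed.

(** Otherwise a multiplier u that is congruent to 1 modulo p ^ (n - 1), but not
    modulo p ^ n, preserves C.  It multiplies every element c of C by an element
    w of order p, and iterating it spreads c over its coset of P, which the
    hypothesis [red] excludes. *)
Lemma top_root m : g ^+ m \in C -> m ^ p.-1 = 1 %[mod p ^ n].
Proof.
move=> Cgm; have com := top_coprime Cgm.
have [tN tX cot tG] := hT.
apply/eqP/negPn/negP=> /eqP ne1.
have y1 : m ^ p.-1 = 1 %[mod p].
  by rewrite -totient_prime // Euler_exp_totient // coprime_sym.
have [k [ek nek]] := mod_last_root p_pr p_odd n_gt0 y1 ne1.
have st : power_stable ((m ^ p.-1) ^ k) C.
  by rewrite -expnM; apply/power_stableX/top_stable.
case: red => c z Cc Pz.
set u := ((m ^ p.-1) ^ k)%N in ek nek st; have Gc := sCG Cc.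
have u_gt0 : 0 < u.
  have m_gt0 : 0 < m.
    rewrite lt0n; apply: contraTneq com => ->.
    by rewrite /coprime gcdn0 neq_ltn prime_gt1 ?orbT.
  by rewrite !expn_gt0 m_gt0.
have /dvdnP[s es] : p ^ n.-1 %| u - 1 by rewrite -eqn_mod_dvd //; apply/eqP.
have eu : u = (1 + s * p ^ n.-1)%N by rewrite -es subnKC.
have n_gt1 : 1 < n.
  rewrite ltn_neqAle n_gt0 andbT; apply/eqP=> n1; case: nek.
  by rewrite -n1 expn1 (eq_mod_exp k y1) exp1n.
pose w := c ^+ (s * p ^ n.-1).
have Gw : w \in G by rewrite groupX.
have lw : lev p w <= 1.
  rewrite -(lev_expg hG) // -expgM -mulnA -expnD addn1 prednK // mulnC expgM.
  by have /eqP-> : c ^+ (p ^ n) == 1; rewrite ?expg1n // (lev_expg hG) // (lev_le hG).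
have w1 : w != 1.
  apply/eqP=> w1; case: nek; apply/eqP.
  have := eq_expg_lev hG u 1 Gc; rewrite (top_lev Cc) => <-.
  by rewrite eu expgD -/w w1 mulg1.
have lw1 : lev p w = 1%N.
  by apply/eqP; rewrite eqn_leq lw lt0n (lev_eq0 hG).
have wj j : c * w ^+ j \in C.
  elim: j => [|j IHj]; first by rewrite expg0 mulg1.
  have := st _ IHj; rewrite eu expgD expg1 [X in _ * X]expgMn; last first.
    by apply: (cyclic_mulgC hG) => //; rewrite groupX.
  rewrite -/w -[(w ^+ j) ^+ _]expgM mulnA [(_ * p ^ _)%N]mulnC expgM.
  have /eqP-> : w ^+ (p ^ n.-1) == 1 by rewrite (lev_expg hG) // lw1 -ltnS prednK.
  by rewrite expg1n mulg1 -mulgA -expgSr.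
have Gz : z \in G by apply: (subsetP (Ohm_sub 1 G)).
have [|j -> _] := lev_generator hG Gw Gz; last exact: wj.
by rewrite lw1 -(mem_OhmG hG).
Qed.

Lemma top_teich m : g ^+ m \in C -> exists s, g ^+ m = g ^+ (t ^ s).
Proof.
move=> Cgm; have [tN tX cot tG] := hT; have [s es] := tG m (top_coprime Cgm).
exists s; apply/eqP; rewrite (eq_expg_lev hG) // lg; apply/eqP.
apply: eq_mod_root => //; first exact: top_root.
exact: teich_root hT le_nN.
Qed.

(** The multipliers that preserve C are powers of t by [top_root]; the exponents
    form a subgroup of the integers modulo p - 1, generated by its least positive
    element. *)
Lemma top_orbit :
  exists2 e, e %| p.-1 & forall c, c \in C <-> exists j, c = g ^+ (t ^ (e * j)).
Proof.
have [tN tX cot tG] := hT; have p1_gt0 : 0 < p.-1 by rewrite -subn1 subn_gt0 prime_gt1.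
pose S s := g ^+ (t ^ s) \in C.
have Cg : g \in C by apply: mem_atom.
have gmod a b : a = b %[mod p.-1] -> g ^+ (t ^ a) = g ^+ (t ^ b).
  move=> eab; apply/eqP; rewrite (eq_expg_lev hG) // lg.
  rewrite (divn_eq a p.-1) (divn_eq b p.-1) !expnD eab ![(_ * p.-1)%N]mulnC !expnM.
  have tn : t ^ p.-1 = 1 %[mod p ^ n] := eq_mod_dvd (dvdn_exp2l p le_nN) tN.
  by rewrite -modnMml -[X in _ == X]modnMml !(eq_mod_exp _ tn) !exp1n.
have SD a b : S a -> S b -> S (a + b)%N.
  by move=> Sa Sb; rewrite /S expnD expgM; exact: (top_stable Sb Sa).
have SM a k : S a -> S (a * k)%N.
  move=> Sa; elim: k => [|k IHk]; first by rewrite muln0 /S expn0 expg1.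
  by rewrite mulnS SD.
have Sp : S p.-1 by rewrite /S (gmod _ 0%N) ?expn0 ?expg1 // modnn mod0n.
have exS : exists s, (0 < s) && S s by exists p.-1; rewrite p1_gt0.
case: (ex_minnP exS) => e /andP[e_gt0 Se] mine.
(* Subtracting e amounts to adding e (p - 2), modulo p - 1. *)
have Sdvd s : S s -> e %| s.
  move=> Ss; have Sr : S (s %% e).
    have : S (s + e * (s %/ e * p.-2))%N by apply: SD => //; apply: SM.
    rewrite /S (gmod _ (s %% e)) //.
    rewrite {1}(divn_eq s e) addnAC [(e * _)%N]mulnA [(e * _)%N]mulnC -mulnS prednK //.
    by rewrite modnMDl.
  apply: contraT; rewrite /dvdn -lt0n => r_gt0; have := mine (s %% e).
  by rewrite r_gt0 Sr leqNgt ltn_pmod // => /(_ isT).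
exists e; first exact: Sdvd.
move=> c; split=> [Cc|[j ->]]; last exact: SM.
have Gc := sCG Cc; have [|m ec _] := lev_generator hG Gg Gc; first by rewrite lg top_lev.
have [s es] : exists s, g ^+ m = g ^+ (t ^ s) by apply: top_teich; rewrite -ec.
have /Sdvd/dvdnP[q eq] : S s by rewrite /S -es -ec.
by exists q; rewrite ec es eq mulnC.
Qed.

Lemma same_atom_top e x y : (forall c, c \in C <-> exists j, c = g ^+ (t ^ (e * j))) ->
  x \in G -> lev p x = n -> y \in atom G F x <-> exists j, y = x ^+ (t ^ (e * j)).
Proof.
move=> hC Gx lx; have [|u ex cou] := lev_generator hG Gg Gx; first by rewrite lx lg.
have {}cou : coprime p u by apply: cou; rewrite ?lx ?lg.
rewrite ex -(atom_power cG sF (coG cou) Gg); split=> [/imsetP[c /hC[j ->] ->]|[j ->]].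
  by exists j; rewrite -!expgM mulnC.
apply/imsetP; exists (g ^+ (t ^ (e * j))); first by apply/hC; exists j.
by rewrite -!expgM [(u * _)%N]mulnC.
Qed.

End Generator.

Lemma teich_inj n (G : {group gT}) x a b : cyclic_pgroup p n G -> x \in G -> 0 < lev p x ->
  x ^+ (t ^ a) = x ^+ (t ^ b) -> t ^ a = t ^ b %[mod p].
Proof.
move=> hG Gx lx /eqP; rewrite (eq_expg_lev hG) // => /eqP; apply: eq_mod_dvd.
by rewrite -{1}(expn1 p) dvdn_exp2l.
Qed.

Lemma teich_pow n (G : {group gT}) x a b : cyclic_pgroup p n G -> n <= N -> x \in G ->
  t ^ a = t ^ b %[mod p] -> x ^+ (t ^ a) = x ^+ (t ^ b).
Proof.
move=> hG le_nN Gx e; apply/eqP; rewrite (eq_expg_lev hG) //; apply/eqP.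
have [-> | lx] := posnP (lev p x); first by rewrite expn0 !modn1.
have [p_pr _ _] := hG; apply: teich_eq hT _ e => //.
by rewrite lx (leq_trans (lev_le hG Gx)).
Qed.

(** By induction on n.  By [top_orbit], the p-th powers of C form an orbit D0 of
    the same group of multipliers in the next layer, and D0 is a member of the
    family by [schur_power_set], because the p-th power map is injective on C.  So
    the induction hypothesis applies below; it yields an exponent e', and it
    remains to see that e' = e.  As D0 is a member, e divides e'.  Conversely the
    product of C with the atom of g ^+ p contains g ^+ (1 + p), hence also
    (g ^+ (t ^ e)) ^+ (1 + p); comparing exponents modulo p and then modulo
    p ^ (n + 1) shows that t ^ e is a power of t ^ e'. *)
Lemma reduced_top n (G : {group gT}) (F : {set {set gT}}) g :
    cyclic_pgroup p n G -> 0 < n <= N -> schur_sets G F -> 'Ohm_n.-1(G) \in F ->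
    g \in G -> lev p g = n ->
    ~ (forall c z, c \in atom G F g -> z \in 'Ohm_1(G) -> c * z \in atom G F g) ->
  exists2 e, e %| p.-1 &
    (forall c, c \in atom G F g <-> exists j, c = g ^+ (t ^ (e * j))) /\
    (forall A : {set gT}, A \subset G -> A \in F <-> power_stable (t ^ e) A).
Proof.
elim: n G F g => // n IHn G F g hG /= lt_nN sF FH Gg lg red.
have [p_pr cG oG] := hG.
have [tN tX cot tG] := hT.
have [e ep hC] := top_orbit hG (ltn0Sn n) lt_nN sF FH Gg lg red.
have hA := fun x y => @same_atom_top _ _ _ _ hG (ltn0Sn n) sF Gg lg e x y hC.
have sCG : {subset atom G F g <= G} by apply/subsetP/(schur_sub sF)/(schur_atom sF).
pose H := 'Ohm_n(G)%G; pose FH' := restrict_sets F H.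
have sH : schur_sets H FH' by apply: schur_restrict sF (Ohm_sub n G) FH.
have hH : cyclic_pgroup p n H := Ohm_cyclic_pgroup hG (leqnSn n).
have topG x : x \in G -> x \notin H -> lev p x = n.+1.
  move=> Gx; rewrite (mem_OhmG hG) // -ltnNge => lt; apply/eqP.
  by rewrite eqn_leq (lev_le hG).
exists e => //; split=> // A sA.
suff hF (B : {set gT}) : B \subset H -> B \in F <-> power_stable (t ^ e) B.
  split=> [FA a Aa|stA].
    have Ga := subsetP sA a Aa; have [Ha|nHa] := boolP (a \in H).
      have : A :&: H \in F by apply: (schurI sF FA FH).
      have := hF (A :&: H) (subsetIr _ _).
      by case=> h _ /h/(_ a); rewrite !in_setI Aa Ha => /(_ isT)/andP[].
    have : a ^+ (t ^ e) \in atom G F a.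
      by apply/hA; rewrite ?topG //; exists 1%N; rewrite muln1.
    by apply/subsetP/(atom_sub FA Aa).
  apply: (schur_stable sF) => // x y Ax Gy sxy; have Gx := subsetP sA x Ax.
  have [Hx|nHx] := boolP (x \in H).
    have FAH : A :&: H \in F.
      apply/hF; first exact: subsetIr.
      by move=> a /setIP[Aa Ha]; rewrite in_setI stA ?groupX.
    have := same_atomP _ _ _ sxy _ FAH; rewrite !in_setI Ax Hx => /esym/andP[] //.
  have : y \in atom G F x by rewrite in_atom Gy.
  case/(hA _ _ Gx (topG _ Gx nHx)) => j ->.
  by rewrite expnM; apply: power_stableX.
case: (posnP n) => [n0|n_gt0].
  move=> sB; have B1 b : b \in B -> b = 1.
    move/(subsetP sB) => Hb; have := Hb; rewrite (mem_Ohm hG) n0 leqn0 => /andP[Gb].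
    by rewrite (lev_eq0 hG) // => /eqP.
  split=> [_ b Bb|_]; first by have b1 := B1 b Bb; rewrite b1 expg1n -b1.
  have [->|[b Bb]] := set_0Vmem B; first exact: (schur0 sF).
  suff -> : B = [set 1] by apply: (schur1 sF).
  by apply/setP=> x; rewrite inE; apply/idP/eqP=> [/B1//|->]; rewrite -(B1 b Bb).
have le_nN := ltnW lt_nN.
have [gp egp] : exists x, x = g ^+ p by exists (g ^+ p).
pose C := atom G F g; pose D0 := power_set p C.
have Cg : g \in C by apply: mem_atom.
have Ggp : gp \in G by rewrite egp groupX.
have lgp : lev p gp = n by rewrite egp (lev_expgp hG) // lg.
have Hgp : gp \in H by rewrite (mem_OhmG hG) ?lgp.
have gpX a : gp ^+ a = (g ^+ a) ^+ p by rewrite egp -!expgM mulnC.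
have hD0 y : y \in D0 <-> exists j, y = gp ^+ (t ^ (e * j)).
  split=> [/imsetP[c /hC[j ->] ->]|[j ->]]; first by exists j; rewrite gpX.
  by apply/imsetP; exists (g ^+ (t ^ (e * j))); rewrite ?gpX //; apply/hC; exists j.
have FD0 : D0 \in F.
  have := schur_power_set cG sF p_pr (schur_atom sF g); congr (_ \in F); apply/setP=> x.
  rewrite inE; apply/andP/idP=> [[Gx]|D0x].
    have [->|[c]] := set_0Vmem [set c in C | c ^+ p == x]; first by rewrite cards0 dvdn0.
    by rewrite inE => /andP[Cc /eqP <-] _; apply: imset_f.
  have [c Cc ex] := imsetP D0x; rewrite ex groupX ?sCG //; split=> //.
  suff -> : [set a in C | a ^+ p == c ^+ p] = [set c].
    by rewrite cards1 dvdn1 neq_ltn prime_gt1 ?orbT.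
  apply/setP=> a; rewrite !inE; apply/andP/eqP=> [[]|->]; last by rewrite eqxx.
  move/hC=> [i ->]; case/hC: Cc => [j ->]; rewrite -!gpX => /eqP /(teich_inj hG Ggp).
  by rewrite lgp => /(_ n_gt0)/(teich_pow hG lt_nN Gg).
have sD0 : D0 \subset H.
  by apply/subsetP=> y /hD0[j ->]; rewrite groupX.
have FH'E D : (D \in FH') = (D \in F) && (D \subset H) by rewrite inE.
have FD0' : D0 \in FH' by rewrite FH'E FD0.
(* The elements of the top layer L of H are distributed among the images of D0
   under units, so L is a member. *)
have FH1 : 'Ohm_n.-1(H) \in FH'.
  rewrite FH'E Ohm_sub andbT (Ohm_Ohm hG) ?leq_pred ?leqnSn //.
  pose L := [set x in H | lev p x == n].
  have -> : 'Ohm_n.-1(G) = H :\: L.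
    apply/setP=> x; rewrite in_setD in_set [x \in H](mem_Ohm hG) (mem_Ohm hG).
    have [Gx|_] := boolP (x \in G); rewrite ?andbF //=.
    by rewrite -ltnS prednK // ltn_neqAle; case: leqP; rewrite ?andbF ?andbT.
  apply: (schurD sF FH); apply: (schur_stable sF) => [|x y].
    apply/subsetP=> x; rewrite inE => /andP[Hx _]; exact: (subsetP (Ohm_sub n G)).
  rewrite inE => /andP[Hx /eqP lx] Gy sxy; have Gx := subsetP (Ohm_sub n G) x Hx.
  have [|u ex cou] := lev_generator hG Ggp Gx; first by rewrite lgp lx.
  have {}cou : coprime p u by apply: cou; rewrite ?lgp ?lx.
  have coG : coprime #|G| u by rewrite oG coprimeXl.
  have : y \in power_set u D0.
    have Fu := schur_multiplier cG sF coG FD0.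
    have xu : x \in power_set u D0.
      by rewrite ex; apply: imset_f; apply/hD0; exists 0%N; rewrite muln0 expn0 expg1.
    by rewrite -(same_atomP _ _ _ sxy _ Fu).
  case/imsetP=> _ /hD0[j ->] ey.
  have Hy : y \in H by rewrite ey; do 2 apply: groupX.
  by rewrite inE Hy ey /= !(lev_expg_coprime hG) ?groupX ?lgp ?coprimeXr /=.
have Hgp' := mem_atom FH' Hgp.
have sD : atom H FH' gp \subset D0.
  by apply: (atom_sub FD0'); apply/hD0; exists 0%N; rewrite muln0 expn0 expg1.
(* If the atom of gp were stable under the subgroup of order p, it would contain
   1 when n = 1, and two elements of D0 that agree after a p-th power
   otherwise. *)
have red' : ~ (forall c z, c \in atom H FH' gp -> z \in 'Ohm_1(H) -> c * z \in atom H FH' gp).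
  move=> st; have [n1|n_ne1] := eqVneq n 1%N.
    have := st gp gp^-1 Hgp'; rewrite (mem_OhmG hH) ?groupV // mulgV => h.
    have {h} : 1 \in atom H FH' gp.
      by apply: h; rewrite /lev orderV; have := lgp; rewrite /lev n1 => ->.
    rewrite in_atom => /andP[_ /same_atomP/(_ _ (schur1 sH))].
    by rewrite !inE eqxx => /eqP gp1; move: n_gt0; rewrite -lgp gp1 lev1.
  have n_gt1 : 1 < n by rewrite ltn_neqAle eq_sym n_ne1.
  pose z := g ^+ (p ^ n).
  have Gz : z \in G by rewrite groupX.
  have z1 : z != 1 by rewrite (lev_expg hG) // lg ltnn.
  have zp : z ^+ p = 1 by apply/eqP; rewrite -expgM -expnSr (lev_expg hG) // lg.
  have Hz : z \in 'Ohm_1(H).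
    by rewrite (Ohm_Ohm hG) ?n_gt0 ?leqnSn // (mem_OhmG hG) // -(lev_expg hG) // expn1 zp.
  have /(subsetP sD)/hD0[j ej] := st gp z Hgp' Hz.
  have : (gp ^+ p) ^+ (t ^ 0) = (gp ^+ p) ^+ (t ^ (e * j)).
    rewrite expn0 expg1 -[RHS]expgM [(p * _)%N]mulnC expgM -ej expgMn ?zp ?mulg1 //.
    exact: (cyclic_mulgC hG).
  move/(teich_inj hG (groupX p Ggp)); rewrite (lev_expgp hG) // lgp.
  rewrite -ltnS prednK // => /(_ n_gt1)/(teich_pow hG lt_nN Ggp).
  by rewrite -ej expn0 expg1 -{1}[gp]mulg1 => /mulgI z1'; rewrite -z1' eqxx in z1.
have [|e' ep' [hC' hB]] := IHn H FH' gp hH _ sH FH1 Hgp lgp red'; first by rewrite n_gt0.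
suff -> : e = e'.
  by move=> sB; rewrite -hB // FH'E sB andbT.
apply/eqP; rewrite eqn_dvd; apply/andP; split.
  have /(hB _ sD0)/(_ gp) := FD0'.
  have D0gp : gp \in D0 by apply/hD0; exists 0%N; rewrite muln0 expn0 expg1.
  move=> /(_ D0gp)/hD0[j /(teich_inj hG Ggp)]; rewrite lgp => /(_ n_gt0).
  exact: teich_dvd hT ep.
have FS : C * atom H FH' gp \in F.
  apply: (schurM sF (schur_atom sF g)).
  by have := schur_atom sH gp; rewrite FH'E => /andP[].
pose x := (g ^+ (t ^ e)) ^+ (1 + p).
have co1p : coprime #|G| (1 + p) by rewrite oG coprimeXl // add1n coprimenS.
have : x \in C * atom H FH' gp.
  have Cx : x \in atom G F (g ^+ (1 + p)).
    rewrite -(atom_power cG sF co1p Gg); apply: imset_f; apply/hC.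
    by exists 1%N; rewrite muln1.
  apply: (subsetP (atom_sub FS _)) Cx.
  by apply/mulsgP; exists g gp; rewrite // expgD expg1 egp.
case/mulsgP=> c s /hC[j ->] /hC'[j' ->].
rewrite /x expgD expg1 -gpX => ex.
have et : t ^ e = t ^ (e * j) %[mod p].
  move: ex; rewrite egp -!expgM -!expgD => /eqP; rewrite (eq_expg_lev hG) // lg => /eqP.
  have pn : p %| p ^ n.+1 by rewrite expnS dvdn_mulr.
  move/(eq_mod_dvd pn).
  by rewrite -modnDmr modnMr addn0 -[RHS]modnDmr modnMr addn0.
move: ex; rewrite (teich_pow hG lt_nN Gg et) => /mulgI /(teich_inj hG Ggp).
by rewrite lgp => /(_ n_gt0); apply: teich_dvd hT ep'.
Qed.

End ReducedTop.

(** * Words and the families that they describe *)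

(** Letters are read from the top layer downwards.  The letter (0, b) is a block
    of b + 2 layers that form a single atom.  A letter (e, j) with e > 0 is one
    layer above the subgroup of order p ^ h, where h is the height of the rest of
    the word: its atoms are the products of the orbits of the powers of t ^ e with
    the subgroup of order p ^ (h - j). *)
Definition code := seq (nat * nat).

Fixpoint height (w : code) : nat :=
  match w with
  | [::] => 0
  | (0, b) :: w' => height w' + b.+2
  | (_.+1, _) :: w' => (height w').+1
  end.

(** The letter (e, j) can be put on top of w when the layers of w above level
    [height w - j] consist of orbits for the same e times subgroups of order at
    most p ^ (height w - j).  By induction this is a condition on the first
    letter of w only. *)
Definition supports (e j : nat) (w : code) : bool :=
  (j == 0%N) || (if w is (e', j') :: _ then (e' == e) && (j <= j'.+1) else false).

Fixpoint valid (p : nat) (w : code) : bool :=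
  match w with
  | [::] => true
  | (e, j) :: w' => [&& valid p w', (e == 0%N) || (e %| p.-1) & (e == 0%N) || supports e j w']
  end.

Lemma supports_le p e j w : valid p w -> supports e.+1 j w -> j <= height w.
Proof.
elim: w j => [|[[|e'] j'] w IHw] j; rewrite /supports; case: eqVneq => [->|nz] //=.
move=> /and3P[vw _ sw] /andP[/eqP[ee] le_j]; rewrite ee in sw.
by apply: (leq_trans le_j); rewrite ltnS IHw.
Qed.

Section CodeInv.
Variables (p t : nat) (gT : finGroupType) (G : {group gT}).
Local Notation lev := (lev p).

Definition const_between (T : eqType) (i k : nat) (f : gT -> T) :=
  [forall x in G, forall y in G,
     (i < lev x <= k) && (i < lev y <= k) ==> (f x == f y)].

Definition power_inv (T : eqType) (e i k : nat) (f : gT -> T) :=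
  [forall x in G, (i < lev x <= k) ==> (f (x ^+ (t ^ e)) == f x)].

Definition shift_inv (T : eqType) (l i k : nat) (f : gT -> T) :=
  [forall x in G, forall z in G, (i < lev x <= k) && (lev z <= l) ==> (f (x * z) == f x)].

(** The functions on G that are constant on the atoms described by w; functions,
    rather than sets, so that it applies to [conv A B] as well. *)
Fixpoint code_inv (T : eqType) (w : code) (f : gT -> T) : bool :=
  match w with
  | [::] => true
  | (0, b) :: w' => code_inv w' f && const_between (height w') (height w) f
  | (e, j) :: w' =>
      [&& code_inv w' f, power_inv e (height w') (height w) f &
          shift_inv (height w' - j) (height w') (height w) f]
  end.

Definition code_sets w := [set A : {set gT} | (A \subset G) && code_inv w (fun x => x \in A)].

Lemma const_betweenP (T : eqType) i k (f : gT -> T) :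
  reflect {in G &, forall x y, i < lev x <= k -> i < lev y <= k -> f x = f y}
          (const_between i k f).
Proof.
apply: (iffP forall_inP) => [h x y Gx Gy lx ly|h x Gx].
  by have /forall_inP/(_ y Gy)/implyP := h x Gx; rewrite lx ly => /(_ isT)/eqP.
by apply/forall_inP=> y Gy; apply/implyP=> /andP[lx ly]; apply/eqP/h.
Qed.

Lemma power_invP (T : eqType) e i k (f : gT -> T) :
  reflect {in G, forall x, i < lev x <= k -> f (x ^+ (t ^ e)) = f x} (power_inv e i k f).
Proof.
apply: (iffP forall_inP) => h x Gx; first by move=> lx; have /implyP/(_ lx)/eqP := h x Gx.
by apply/implyP=> lx; apply/eqP/h.
Qed.

Lemma shift_invP (T : eqType) l i k (f : gT -> T) :
  reflect {in G &, forall x z, i < lev x <= k -> lev z <= l -> f (x * z) = f x}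
          (shift_inv l i k f).
Proof.
apply: (iffP forall_inP) => [h x z Gx Gz lx lz|h x Gx].
  by have /forall_inP/(_ z Gz)/implyP := h x Gx; rewrite lx lz => /(_ isT)/eqP.
by apply/forall_inP=> z Gz; apply/implyP=> /andP[lx lz]; apply/eqP/h.
Qed.

Lemma height_cons u w : height w < height (u :: w).
Proof. by case: u => [[|e] j] /=; rewrite ?ltnS // addnS ltnS leq_addr. Qed.

Lemma code_inv_const (T : eqType) w (c : T) : code_inv w (fun _ => c).
Proof.
elim: w => // -[[|e] j] w IHw /=; rewrite IHw /=; first by apply/const_betweenP.
by apply/andP; split; [apply/power_invP | apply/shift_invP].
Qed.

End CodeInv.

Section ConvLemmas.
Variable gT : finGroupType.
Implicit Types (A B D G : {set gT}) (x z : gT).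

Lemma conv_split A B D x :
  conv A B x = (conv (A :&: D) B x + conv (A :\: D) B x)%N.
Proof.
rewrite /conv -(cardsID D); congr (_ + _)%N; apply: eq_card => a; rewrite !inE;
  by case: (a \in A); case: (a \in D); rewrite ?andbF ?andbT.
Qed.

Lemma conv_shift A B z x : (forall b, (b * z \in B) = (b \in B)) ->
  conv A B (x * z) = conv A B x.
Proof. by move=> Bz; apply: eq_card => a; rewrite !inE mulgA Bz. Qed.

Lemma conv0 A B x : x \notin A * B -> conv A B x = 0%N.
Proof. by rewrite -conv_gt0 lt0n negbK => /eqP. Qed.

Lemma conv_const A B x : (forall a, a \in A -> (a^-1 * x \in B) = (x \in B)) ->
  conv A B x = ((x \in B) * #|A|)%N.
Proof.
move=> AB; rewrite /conv; have [xB|nxB] := boolP (x \in B).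
  rewrite mul1n; apply: eq_card => a; rewrite !inE andb_idr // => Aa.
  by rewrite AB.
rewrite mul0n; apply/eqP; rewrite cards_eq0; apply/eqP/setP=> a; rewrite !inE.
by apply/negbTE/negP=> /andP[Aa]; rewrite AB // (negPf nxB).
Qed.

Variable K : {group gT}.
Hypothesis cK : abelian K.

Let mulKC x y : x \in K -> y \in K -> x * y = y * x.
Proof. by move=> Kx Ky; apply: (centsP cK). Qed.

Lemma convC A B x : A \subset K -> B \subset K -> x \in K -> conv A B x = conv B A x.
Proof.
move=> sA sB Kx; rewrite /conv -(card_imset _ (inj_comp (mulIg x) invg_inj)).
have inv_div a : a \in K -> (a^-1 * x)^-1 * x = a.
  by move=> Ka; rewrite invMg invgK -mulgA mulKC ?groupMr ?groupV // mulgK.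
apply: eq_card => b; rewrite [RHS]inE; apply/imsetP/andP=> [[a]|[Bb Ab]].
  rewrite inE => /andP[Aa Ba] ->; split=> //=.
  by rewrite inv_div // (subsetP sA).
by exists (b^-1 * x); rewrite ?inE ?Ab /= inv_div // (subsetP sB).
Qed.

Lemma conv_power A B m x : A \subset K -> x \in K -> coprime #|K| m ->
  (forall a, a \in K -> (a ^+ m \in A) = (a \in A)) ->
  (forall a, a \in K -> (a ^+ m \in B) = (a \in B)) ->
  conv A B (x ^+ m) = conv A B x.
Proof.
move=> sA Kx co mA mB; rewrite /conv -[RHS](card_in_imset (f := fun b => b ^+ m)).
  apply: eq_card => a; rewrite inE; apply/andP/imsetP=> [[Aa Ba]|[b]].
    have Ka := subsetP sA a Aa.
    have ea : a = (a ^+ expg_invn K m) ^+ m by rewrite -expgM mulnC expgM (expgK co).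
    exists (a ^+ expg_invn K m) => //; rewrite inE -mA ?groupX // -ea Aa /=.
    rewrite -mB ?groupM ?groupV ?groupX // expgMn; last by apply: (centsP cK); rewrite ?groupV ?groupX.
    by rewrite expgVn -ea.
  rewrite inE => /andP[Ab Bb] ->; have Kb := subsetP sA b Ab.
  rewrite mA // Ab -expgVn -expgMn; last by apply: (centsP cK); rewrite ?groupV.
  by rewrite mB ?groupM ?groupV.
move=> a b; rewrite !inE => /andP[Aa _] /andP[Ab _].
by apply: power_inj co _ _ _ _; apply: (subsetP sA).
Qed.

End ConvLemmas.

Section CodeSchur.
Variables (p N t n : nat) (gT : finGroupType) (G : {group gT}).
Hypotheses (hG : cyclic_pgroup p n G) (hT : teichmuller p N t).
Local Notation lev := (lev p).
Local Notation code_inv := (code_inv p t G).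
Let p_pr : prime p. Proof. by case: hG. Qed.
Let cot : coprime p t. Proof. by case: hT. Qed.

Lemma lev_teich e x : x \in G -> lev (x ^+ (t ^ e)) = lev x.
Proof. by move=> Gx; rewrite (lev_expg_coprime hG) ?coprimeXr. Qed.

(** Every pointwise operation preserves invariance, as invariance is equality of
    values at certain points. *)
Lemma code_inv2 (T1 T2 T : eqType) (op : T1 -> T2 -> T) w f1 f2 f :
  {in G, forall x, lev x <= height w -> f x = op (f1 x) (f2 x)} ->
  code_inv w f1 -> code_inv w f2 -> code_inv w f.
Proof.
elim: w => // u w IHw ef; have lt_w := height_cons u w.
have IH : code_inv w f1 -> code_inv w f2 -> code_inv w f.
  by apply: IHw => x Gx lx; apply: ef => //; apply: leq_trans lx (ltnW lt_w).
case: u lt_w ef => [[|e] j] lt_w ef /=.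
  move=> /andP[i1 /const_betweenP c1] /andP[i2 /const_betweenP c2].
  rewrite IH //=; apply/const_betweenP=> x y Gx Gy lx ly.
  by rewrite !ef ?(c1 x y) ?(c2 x y) //; [case/andP: ly | case/andP: lx].
move=> /and3P[i1 /power_invP r1 /shift_invP s1] /and3P[i2 /power_invP r2 /shift_invP s2].
rewrite IH //=; apply/andP; split.
  apply/power_invP=> x Gx lx; rewrite !ef ?r1 ?r2 ?groupX ?lev_teich //; by case/andP: lx.
apply/shift_invP=> x z Gx Gz lx lz.
have lxz : lev (x * z) = lev x.
  apply: (levMr hG) => //; case/andP: lx => lx _; apply: leq_ltn_trans lx.
  exact: leq_trans lz (leq_subr _ _).
by rewrite !ef ?(s1 x z) ?(s2 x z) ?groupM ?lxz //; case/andP: lx.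
Qed.

Lemma code_inv_eq (T : eqType) w (f f' : gT -> T) :
  {in G, forall x, lev x <= height w -> f x = f' x} -> code_inv w f' -> code_inv w f.
Proof. by move=> e i; apply: (code_inv2 (op := fun a _ => a) e i i). Qed.

(** Above level [height w - j], the atoms of w are orbits times small subgroups;
    below it, invariance under the subgroup makes f constant. *)
Lemma supports_inv (T : eqType) e j w (f : gT -> T) : supports e.+1 j w -> valid p w ->
  {in G, forall x, lev x <= height w -> f (x ^+ (t ^ e.+1)) = f x} ->
  {in G &, forall x z, lev x <= height w -> lev z <= height w - j -> f (x * z) = f x} ->
  code_inv w f.
Proof.
elim: w j => // u w IHw j.
have [->|nz_j] := eqVneq j 0%N.
  move=> _ _ _; rewrite subn0 => hs.
  apply: (code_inv_eq (f' := fun=> f 1)); last exact: code_inv_const.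
  by move=> x Gx lx; rewrite -[x in LHS]mul1g hs ?lev1.
case: u => [[|e'] j']; rewrite /supports (negPf nz_j) //=.
move=> /andP[/eqP-> le_jj'] /and3P[vw _ sw] hr hs.
have le_h : height w - j' <= (height w).+1 - j.
  have := supports_le vw sw; move: le_jj'; clear; lia.
have lel x : lev x <= height w - j' -> lev x <= (height w).+1 - j.
  by move=> /leq_trans; apply.
rewrite (IHw j') //=.
- apply/andP; split; first by apply/power_invP=> x Gx /andP[_ lx]; apply: hr.
  by apply/shift_invP=> x z Gx Gz /andP[_ lx] lz; apply: hs; rewrite ?lel.
- by move=> x Gx lx; apply: hr; rewrite // ltnW.
by move=> x z Gx Gz lx lz; apply: hs; rewrite ?lel // ltnW.
Qed.

Lemma supports_power (T : eqType) e j w (f : gT -> T) : supports e.+1 j w -> valid p w ->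
  code_inv w f ->
  {in G, forall x, height w - j < lev x <= height w -> f (x ^+ (t ^ e.+1)) = f x}.
Proof.
elim: w j => [|u w IHw] j; first by move=> _ _ _ x _; rewrite sub0n leqNgt andNb.
have [->|nz_j] := eqVneq j 0%N.
  by move=> _ _ _ x _; rewrite subn0 leqNgt andNb.
case: u => [[|e'] j']; rewrite /supports (negPf nz_j) //=.
move=> /andP[/eqP[->] le_jj'] /and3P[vw _ sw] /and3P[iw /power_invP rw _] x Gx lx.
have [le_x|lt_x] := leqP (lev x) (height w); last first.
  by apply: rw; rewrite // lt_x; case/andP: lx.
apply: (IHw j') => //; rewrite le_x andbT; case/andP: lx => lx _.
by apply: leq_ltn_trans lx; move: (supports_le vw sw) le_jj'; clear; lia.
Qed.

Lemma code_inv_top (T : eqType) u w (f : gT -> T) c : code_inv w f ->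
  {in G, forall x, height w < lev x <= height (u :: w) -> f x = c} -> code_inv (u :: w) f.
Proof.
case: u => [[|e] j] /= -> fc /=.
  by apply/const_betweenP=> x y Gx Gy lx ly; rewrite !fc.
apply/andP; split.
  by apply/power_invP=> x Gx lx; rewrite !fc ?groupX ?lev_teich.
apply/shift_invP=> x z Gx Gz lx lz.
have lxz : lev (x * z) = lev x.
  apply: (levMr hG) => //; case/andP: lx => lx _; apply: leq_ltn_trans lx.
  exact: leq_trans lz (leq_subr _ _).
by rewrite !fc ?groupM ?lxz.
Qed.

Lemma code_inv_orbit (T : eqType) e j w (f : gT -> T) : code_inv w f ->
  {in G, forall x, f (x ^+ (t ^ e.+1)) = f x} ->
  {in G & 'Ohm_(height w - j)(G), forall x z, f (x * z) = f x} ->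
  code_inv ((e.+1, j) :: w) f.
Proof.
move=> /= -> hr hs /=; apply/andP; split.
  by apply/power_invP=> x Gx _; apply: hr.
by apply/shift_invP=> x z Gx Gz _ lz; apply: hs; rewrite ?(mem_OhmG hG).
Qed.

Let cG : abelian G. Proof. by apply: cyclic_abelian; case: hG. Qed.
Let coG e : coprime #|G| (t ^ e).
Proof. by case: hG => _ _ ->; rewrite coprimeXl ?coprimeXr. Qed.

Lemma code_inv_lower (A : {set gT}) w : code_inv w (fun x => x \in A) ->
  code_inv w (fun x => x \in A :&: 'Ohm_(height w)(G)).
Proof. by apply: code_inv_eq => x Gx lx; rewrite inE (mem_OhmG hG) // lx andbT. Qed.

(** Split A and B into their parts below the top block and inside it.  Products
    of lower parts are handled by induction and vanish on the top.  For a block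
    that is a single atom, the other counts are explicit.  In an orbit layer, a
    product with one factor in the top vanishes below; for two factors in the top,
    it is invariant under the operations that define this layer, which is enough
    below by [supports_inv]. *)
Lemma code_inv_conv w (A B : {set gT}) : valid p w ->
  A \subset 'Ohm_(height w)(G) -> B \subset 'Ohm_(height w)(G) ->
  code_inv w (fun x => x \in A) -> code_inv w (fun x => x \in B) ->
  code_inv w (conv A B).
Proof.
elim: w A B => // u w IHw A B vuw sA sB iA iB.
have vw : valid p w by case: u vuw {sA sB iA iB} => e j /andP[].
have inv_w (D : {set gT}) : code_inv (u :: w) (fun x => x \in D) -> code_inv w (fun x => x \in D).
  by case: (u) => [[|e] j] /= => [/andP[]|/and3P[]].
pose H := 'Ohm_(height w)(G); pose Q := 'Ohm_(height (u :: w))(G).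
have sHG : H \subset G := Ohm_sub _ _.
have sQG : Q \subset G := Ohm_sub _ _.
have sHQ : H \subset Q by apply: (Ohm_subset hG); apply/ltnW/height_cons.
have sAG := subset_trans sA sQG; have sBG := subset_trans sB sQG.
have sI (D : {set gT}) : D \subset G -> D :&: H \subset G by move=> sD; rewrite subIset ?sD.
have sD (D : {set gT}) : D \subset G -> D :\: H \subset G by apply/subset_trans/subsetDl.
have top x : x \in G -> height w < lev x -> x \notin H by move=> Gx; rewrite (mem_OhmG hG) // -ltnNge.
have IH := IHw _ _ vw (subsetIr _ _) (subsetIr _ _)
  (code_inv_lower (inv_w _ iA)) (code_inv_lower (inv_w _ iB)).
have i00 : code_inv (u :: w) (conv (A :&: H) (B :&: H)).
  apply: code_inv_top IH _ => x Gx /andP[lx _].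
  apply: conv0; apply: contra (top x Gx lx); apply: subsetP.
  by apply: mul_subG; apply: subsetIr.
have sum4 : {in G, forall x, conv A B x =
    ((conv (A :&: H) (B :&: H) x + conv (B :\: H) (A :&: H) x) +
     (conv (B :&: H) (A :\: H) x + conv (A :\: H) (B :\: H) x))%N}.
  move=> x Gx; rewrite (conv_split A B H) (convC cG) ?sI // (conv_split B _ H).
  rewrite [conv (A :\: H) B x](convC cG) ?sD // (conv_split B (A :\: H) H).
  by rewrite (convC cG (sI _ sBG)) ?sI // [conv (B :\: H) (A :\: H) x](convC cG) ?sD.
suff main (A' B' : {set gT}) : A' \subset Q -> B' \subset Q ->
    code_inv (u :: w) (fun x => x \in A') -> code_inv (u :: w) (fun x => x \in B') ->
    code_inv (u :: w) (conv (A' :&: H) (B' :\: H)) /\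
    code_inv (u :: w) (conv (A' :\: H) (B' :\: H)).
  have [i01 i11] := main A B sA sB iA iB; have [i10 _] := main B A sB sA iB iA.
  apply: (code_inv2 (op := addn)) (fun x Gx _ => sum4 x Gx) _ _.
    apply: (code_inv2 (op := addn)) (fun x Gx _ => erefl _) i00 _.
    by apply: code_inv_eq i01 => x Gx _; rewrite (convC cG) ?sI ?sD.
  by apply: (code_inv2 (op := addn)) (fun x Gx _ => erefl _) i10 i11.
move=> {iA iB sA sB IH i00 sum4 sAG sBG A B IHw inv_w}; move: A' B' => A B sA sB iA iB.
have sAG := subset_trans sA sQG; have sBG := subset_trans sB sQG.
have lowQH x : x \in G -> lev x <= height w -> x \in H by move=> Gx; rewrite (mem_OhmG hG).
have QH_shift a x : a \in H -> (a^-1 * x \in Q :\: H) = (x \in Q :\: H).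
  by move=> Ha; rewrite !in_setD !groupMl ?groupV // (subsetP sHQ).
move: vuw iA iB sHQ sQG QH_shift sA sB; rewrite {}/Q.
case: u => [[|e] j] vuw iA iB; set Q := 'Ohm_(height (_ :: w))(G) => sHQ sQG QH_shift sA sB.
  (* The part of a set above H is empty or the whole block. *)
  have split_top (D : {set gT}) : D \subset Q -> code_inv ((0, j) :: w) (fun x => x \in D) ->
      D :\: H = set0 \/ D :\: H = Q :\: H.
    move=> sDQ /= /andP[_ /const_betweenP cD].
    have [->|[d]] := set_0Vmem (D :\: H); [by left | rewrite inE => /andP[nHd Dd]; right].
    apply/eqP; rewrite eqEsubset setSD //=; apply/subsetP=> x; rewrite !in_setD => /andP[nHx Qx].
    have Gx := subsetP sQG x Qx; have Gd := subsetP sQG d (subsetP sDQ d Dd).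
    rewrite nHx (cD x d) //.
      by move: nHx Qx; rewrite !(mem_OhmG hG) // -ltnNge => -> ->.
    by move: nHd (subsetP sDQ d Dd); rewrite !(mem_OhmG hG) // -ltnNge => -> ->.
  have i0 (D : {set gT}) : code_inv ((0, j) :: w) (conv D set0).
    apply: (code_inv_eq (f' := fun=> 0%N)); last exact: code_inv_const.
    by move=> x _ _; apply: conv0; apply/negP=> /mulsgP[a b _]; rewrite inE.
  have ltopQ x : x \in G -> height w < lev x <= height w + j.+2 -> x \in Q :\: H.
    by move=> Gx /andP[lx lx']; rewrite in_setD !(mem_OhmG hG) // -ltnNge lx.
  split.
    have [->|->] := split_top B sB iB; first exact: i0.
    have cE x : conv (A :&: H) (Q :\: H) x = ((x \in Q :\: H) * #|A :&: H|)%N.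
      by apply: conv_const => a /setIP[_ Ha]; apply: QH_shift.
    apply: (@code_inv_top _ _ _ _ #|A :&: H|) => [|x Gx lx]; last by rewrite cE ltopQ ?mul1n.
    apply: (code_inv_eq (f' := fun=> 0%N)); last exact: code_inv_const.
    by move=> x Gx lx; rewrite cE in_setD lowQH.
  have [->|eA] := split_top A sA iA; have [eB|->] := split_top B sB iB;
    rewrite ?eB ?eA; try exact: i0.
    apply: (code_inv_eq (f' := fun=> 0%N)); last exact: code_inv_const.
    by move=> x _ _; apply: conv0; apply/negP=> /mulsgP[a b]; rewrite inE.
  apply: (@code_inv_top _ _ _ _ (#|Q| - (#|H| + #|H|))%N) => [|x Gx lx].
    apply: (code_inv_eq (f' := fun=> #|Q :\: H|)); last exact: code_inv_const.
    move=> x Gx lx; have Hx := lowQH x Gx lx; apply: eq_card => a; rewrite inE.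
    rewrite andb_idr // !in_setD => /andP[nHa Qa].
    by rewrite !groupMr ?groupV ?nHa // (subsetP sHQ).
  have /setDP[Qx nHx] := ltopQ x Gx lx.
  have -> : conv (Q :\: H) (Q :\: H) x = #|Q :\: (H :|: x *: H)|.
    apply: eq_card => a; rewrite !inE mem_lcoset; have [Qa|] := boolP (a \in Q); last by rewrite !andbF.
    have Qax : a^-1 * x \in Q by rewrite groupM ?groupV.
    by rewrite Qax !andbT negb_or -[_ * a \in H]groupV invMg invgK.
  have sU : H :|: x *: H \subset Q.
    by rewrite subUset sHQ; apply/subsetP=> _ /lcosetP[h Hh ->]; rewrite groupM // (subsetP sHQ).
  rewrite cardsDS // cardsU card_lcoset (_ : H :&: x *: H = set0) ?cards0 ?subn0 //.
  apply/setP=> a; rewrite !inE; apply/negbTE/negP=> /andP[Ha /lcosetP[h Hh e]].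
  by case/negP: nHx; rewrite -(mulgK h x) -e groupM ?groupV.
pose K := 'Ohm_(height w - j)(G); pose m := (t ^ e.+1)%N.
have sKG : K \subset G := Ohm_sub _ _.
have sKH : K \subset H by apply: (Ohm_subset hG); apply: leq_subr.
have /and3P[_ _ sw] : [&& valid p w, e.+1 %| p.-1 & supports e.+1 j w] := vuw.
have lev_top x : x \in Q -> x \notin H -> x \in G /\ height w < lev x <= (height w).+1.
  move=> Qx nHx; have Gx := subsetP sQG x Qx; split=> //; move: Qx nHx.
  by rewrite !(mem_OhmG hG) // -ltnNge => -> ->.
have powH a : a \in G -> (a ^+ m \in H) = (a \in H).
  by move=> Ga; rewrite !(mem_OhmG hG) ?groupX ?lev_teich.
have pow_top (D : {set gT}) : D \subset Q -> code_inv ((e.+1, j) :: w) (fun x => x \in D) ->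
    forall a, a \in G -> (a ^+ m \in D :\: H) = (a \in D :\: H).
  move=> sDQ /= /and3P[_ /power_invP r _] a Ga; rewrite !in_setD powH //.
  have [//|nHa /=] := boolP (a \in H).
  have [Qa|nQa] := boolP (a \in Q); first by apply: r => //; have [] := lev_top a Qa nHa.
  have nQam : a ^+ m \notin Q by move: nQa; rewrite !(mem_OhmG hG) ?groupX ?lev_teich.
  by rewrite !(contraNF (subsetP sDQ _)).
have shift_top (D : {set gT}) : D \subset Q -> code_inv ((e.+1, j) :: w) (fun x => x \in D) ->
    forall z a, z \in K -> (a * z \in D :\: H) = (a \in D :\: H).
  move=> sDQ /= /and3P[_ _ /shift_invP s] z a Kz; rewrite !in_setD.
  have Gz := subsetP sKG z Kz; have Hz := subsetP sKH z Kz.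
  rewrite groupMr //; have [//|nHa /=] := boolP (a \in H).
  have [Qa|nQa] := boolP (a \in Q).
    have [Ga la] := lev_top a Qa nHa; apply: s => //.
    by move: Kz; rewrite (mem_OhmG hG).
  have nQaz : a * z \notin Q by rewrite (groupMr _ (subsetP sHQ z Hz)).
  by rewrite !(contraNF (subsetP sDQ _)).
have rA := pow_top A sA iA; have rB := pow_top B sB iB.
have zA := shift_top A sA iA; have zB := shift_top B sB iB.
have conv_top_H (D : {set gT}) : D \subset H -> {in G, forall x, lev x <= height w -> conv D (B :\: H) x = 0%N}.
  move=> sDH x Gx lx; apply: conv0; apply/negP=> /mulsgP[a b Da]; rewrite in_setD => /andP[nHb _] ex.
  by case/negP: nHb; rewrite -(groupMl _ (subsetP sDH a Da)) -ex lowQH.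
split; last first.
  have r11 : {in G, forall x, conv (A :\: H) (B :\: H) (x ^+ m) = conv (A :\: H) (B :\: H) x}.
    by move=> x Gx; apply: (conv_power cG (sD _ sAG) Gx (coG _) rA rB).
  have s11 z x : z \in K -> conv (A :\: H) (B :\: H) (x * z) = conv (A :\: H) (B :\: H) x.
    by move=> Kz; apply: conv_shift => b; apply: zB.
  apply: code_inv_orbit => [|//|x z Gx]; last exact: s11.
  apply: (supports_inv sw vw) => [x Gx _|x z Gx Gz _ lz]; first exact: r11.
  by apply: s11; rewrite (mem_OhmG hG).
have convE x : conv (A :&: H) (B :\: H) x =
    (conv (A :&: H :&: K) (B :\: H) x + conv (A :&: H :\: K) (B :\: H) x)%N.
  exact: conv_split.
(* A lower factor splits along K: the translations by K preserve the top part of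
   B, and off K the factor is stable under the multipliers of the top layer. *)
have cE x : x \in G -> conv (A :&: H :&: K) (B :\: H) x = ((x \in B :\: H) * #|A :&: H :&: K|)%N.
  move=> Gx; apply: conv_const => a /setIP[_ Ka]; have Ga := subsetP sKG a Ka.
  by rewrite (centsP cG _ (groupVr Ga) _ Gx) zB ?groupV.
have iAw : code_inv w (fun x => x \in A) by case/and3P: iA.
apply: (code_inv2 (op := addn) (fun x _ _ => convE x)).
- apply: (code_inv_orbit) => [|x Gx|x z Gx Kz].
  + apply: (code_inv_eq (f' := fun=> 0%N)); last exact: code_inv_const.
    by apply: conv_top_H; rewrite -setIA (subset_trans (subsetIr _ _) (subsetIl _ _)).
  + by rewrite !cE ?groupX // rB.
  + by have Gz := subsetP sKG z Kz; rewrite (cE _ Gx) (cE _ (groupM Gx Gz)) zB.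
- apply: (code_inv_orbit) => [|x Gx|x z Gx Kz].
  + apply: (code_inv_eq (f' := fun=> 0%N)); last exact: code_inv_const.
    by apply: conv_top_H; rewrite (subset_trans (subsetDl _ _) (subsetIr _ _)).
  + have sAHK : A :&: H :\: K \subset G by rewrite (subset_trans (subsetDl _ _)) ?sI.
    apply: (conv_power cG sAHK Gx (coG _)) => // a Ga; rewrite !in_setD !in_setI powH //.
    have -> : (a ^+ m \in K) = (a \in K) by rewrite !(mem_OhmG hG) ?groupX ?lev_teich.
    have [//|nKa /=] := boolP (a \in K).
    have [Ha|_] := boolP (a \in H); last by rewrite !andbF.
    rewrite !andbT; apply: (supports_power sw vw iAw) => //.
    by move: nKa Ha; rewrite !(mem_OhmG hG) // -ltnNge => -> ->.
  by apply: conv_shift => b; apply: zB.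
Qed.

Lemma code_sets_schur w : valid p w -> height w = n -> schur_sets G (code_sets p t G w).
Proof.
move=> vw hw; have eG : 'Ohm_(height w)(G) = G by rewrite (Ohm_full hG) ?hw.
split=> [A|||A B|A B k]; rewrite ?inE.
- by case/andP.
- rewrite sub1G /=; elim: (w) => // u w' IHw; apply: code_inv_top IHw _.
  move=> x Gx /andP[lx _]; apply/negbTE; rewrite inE.
  by apply: contraL lx => /eqP->; rewrite lev1.
- move=> A; rewrite !inE subsetDl /= => /andP[_ iA].
  apply: (code_inv2 (op := fun b _ => ~~ b) _ iA iA) => x Gx _.
  by rewrite in_setD Gx andbT.
- rewrite subUset => /andP[-> iA] /andP[-> iB] /=.
  by apply: (code_inv2 (op := orb) _ iA iB) => x _ _; rewrite in_setU.
move=> /andP[sA iA] /andP[sB iB]; apply/andP; split.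
  by apply/subsetP=> x; rewrite inE => /andP[].
rewrite -eG in sA sB; have iAB := code_inv_conv vw sA sB iA iB.
by apply: (code_inv2 (op := fun c _ => c == k) _ iAB iAB) => x Gx _; rewrite inE Gx.
Qed.

End CodeSchur.

(** Invariance for w only involves the elements of level at most [height w]. *)
Lemma code_inv_Ohm p t n (gT : finGroupType) (G : {group gT}) (T : eqType) w k (f : gT -> T) :
    cyclic_pgroup p n G -> height w <= k <= n ->
  code_inv p t G w f = code_inv p t 'Ohm_k(G) w f.
Proof.
move=> hG /andP[le_wk le_kn]; have sHG := subsetP (Ohm_sub k G).
have memH x : x \in G -> lev p x <= k -> x \in 'Ohm_k(G) by move=> Gx; rewrite (mem_OhmG hG).
elim: w le_wk => // u w IHw le_wk; have lt_w := height_cons u w.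
have {}IHw := IHw (leq_trans (ltnW lt_w) le_wk).
have lek i (x : gT) : i < lev p x <= height (u :: w) -> lev p x <= k.
  by case/andP=> _ /leq_trans; apply.
case: u lt_w le_wk lek => [[|e] j] /= lt_w le_wk lek; rewrite IHw; congr (_ && _).
  apply/const_betweenP/const_betweenP=> h x y Gx Gy lx ly; apply: h => //;
    first [exact: sHG | exact: (memH _ Gx (lek _ _ lx)) | exact: (memH _ Gy (lek _ _ ly))].
congr (_ && _).
  apply/power_invP/power_invP=> h x Gx lx; apply: h => //;
    first [exact: sHG | exact: (memH _ Gx (lek _ _ lx))].
have lek' (z : gT) : lev p z <= height w - j -> lev p z <= k.
  by move/leq_trans; apply; apply: leq_trans (leq_subr _ _) (ltnW le_wk).
apply/shift_invP/shift_invP=> h x z Gx Gz lx lz; apply: h => //;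
  first [exact: sHG | exact: (memH _ Gx (lek _ _ lx)) | exact: (memH _ Gz (lek' _ lz))].
Qed.

(** * Orbits times subgroups *)

Section OrbitCosets.
Variables (p N t n : nat) (gT : finGroupType) (G : {group gT}).
Hypothesis hG : cyclic_pgroup p n G.
Hypotheses (hT : teichmuller p N t) (le_nN : n <= N).
Local Notation lev := (lev p).
Let p_pr : prime p. Proof. by case: hG. Qed.
Let p1_gt0 : 0 < p.-1. Proof. by rewrite -subn1 subn_gt0 prime_gt1. Qed.
Let cot : coprime p t. Proof. by case: hT. Qed.

Lemma exists_lev i : i <= n -> exists2 x, x \in G & lev x = i.
Proof.
move=> le_in; have [g defG lg] := exists_generator hG.
have Gg : g \in G by rewrite defG cycle_id.
rewrite -(subKn le_in); elim: (n - i) => [|k [x Gx lx]]; first by exists g; rewrite ?subn0.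
by exists (x ^+ p); rewrite ?groupX // (lev_expgp hG) // lx subnS.
Qed.

(** The power map with exponent t ^ e has finite order. *)
Lemma teich_inv e y : y \in G -> (y ^+ (t ^ e)) ^+ ((t ^ e) ^ p.-2) = y.
Proof.
move=> Gy; rewrite -expgM -expnS prednK // -expnM -[RHS]expg1 -(expn0 t).
apply: (teich_pow hT hG le_nN Gy); apply/eqP.
by case: hT => _ tX _ _; rewrite expn0 tX dvdn_mull.
Qed.

Definition orbit_coset e l x :=
  [set y in G | [exists i : 'I_p.-1, (x ^+ (t ^ (e * i)))^-1 * y \in 'Ohm_l(G)]].

Lemma orbit_cosetP e l x y : x \in G ->
  reflect (y \in G /\ exists i, (x ^+ (t ^ (e * i)))^-1 * y \in 'Ohm_l(G))
          (y \in orbit_coset e l x).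
Proof.
move=> Gx; rewrite inE; apply: (iffP andP) => [[Gy /existsP[i hi]]|[Gy [i hi]]]; split=> //.
  by exists i.
apply/existsP; exists (Ordinal (ltn_pmod i p1_gt0)) => /=.
suff <- : x ^+ (t ^ (e * i)) = x ^+ (t ^ (e * (i %% p.-1))) by [].
apply: (teich_pow hT hG le_nN Gx).
rewrite {1}(divn_eq i p.-1) mulnDr expnD mulnA [(_ * p.-1)%N]mulnC expnM.
have tp : t ^ p.-1 = 1 %[mod p] by apply/eqP; case: hT => _ -> _ _.
by rewrite -modnMml (eq_mod_exp _ tp) exp1n modnMml mul1n.
Qed.

Lemma mem_orbit_coset e l x : x \in G -> x \in orbit_coset e l x.
Proof.
move=> Gx; apply/(orbit_cosetP _ _ _ Gx); split=> //; exists 0%N.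
by rewrite muln0 expn0 expg1 mulVg group1.
Qed.

Lemma orbit_coset_power e l x y : x \in G -> y \in orbit_coset e l x ->
  y ^+ (t ^ e) \in orbit_coset e l x.
Proof.
move=> Gx /(orbit_cosetP _ _ _ Gx)[Gy [i hi]]; apply/(orbit_cosetP _ _ _ Gx).
rewrite groupX //; split=> //; exists i.+1; rewrite mulnS addnC expnD expgM.
rewrite -expgVn -expgMn ?groupX //.
by apply: (cyclic_mulgC hG) => //; rewrite groupV groupX.
Qed.

Lemma orbit_coset_shift e l x y z : x \in G -> z \in 'Ohm_l(G) ->
  (y * z \in orbit_coset e l x) = (y \in orbit_coset e l x).
Proof.
move=> Gx Kz; have Gz := subsetP (Ohm_sub l G) z Kz.
apply/(orbit_cosetP _ _ _ Gx)/(orbit_cosetP _ _ _ Gx).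
  by rewrite groupMr // => -[Gy [i]]; rewrite mulgA groupMr // => hi; split=> //; exists i.
by case=> [Gy [i hi]]; rewrite groupMr //; split=> //; exists i; rewrite mulgA groupMr.
Qed.

Lemma lev_orbit_coset e l x y : x \in G -> l < lev x -> y \in orbit_coset e l x ->
  lev y = lev x.
Proof.
move=> Gx lt_lx /(orbit_cosetP _ _ _ Gx)[Gy [i hi]].
have Gxi : x ^+ (t ^ (e * i)) \in G by rewrite groupX.
have lxi : lev (x ^+ (t ^ (e * i))) = lev x by apply: (lev_teich hG hT).
rewrite -lxi -(mulKVg (x ^+ (t ^ (e * i))) y); apply: (levMr hG) => //.
  by rewrite groupM ?groupV.
by move: hi; rewrite lxi (mem_Ohm hG) => /andP[_ /leq_ltn_trans]; apply.
Qed.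

(** Raise to the power p ^ l: this kills the subgroup and keeps x nontrivial. *)
Lemma power_coset l x a b : x \in G -> l < lev x ->
  (x ^+ a)^-1 * x ^+ b \in 'Ohm_l(G) -> a = b %[mod p].
Proof.
move=> Gx lt_lx; rewrite (mem_Ohm hG) => /andP[Gab].
rewrite -(lev_expg hG) // expgMn; last by apply: (cyclic_mulgC hG); rewrite ?groupV groupX.
rewrite expgVn -eq_mulVg1 -!expgM ![(_ * p ^ l)%N]mulnC !expgM => /eqP/eqP.
rewrite (eq_expg_lev hG) ?groupX // => /eqP; apply: eq_mod_dvd.
have -> : lev (x ^+ (p ^ l)) = (lev x - l)%N.
  elim: l {lt_lx} => [|l IHl]; first by rewrite expn0 expg1 subn0.
  by rewrite expnSr expgM (lev_expgp hG) ?groupX // IHl subnS.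
by rewrite -{1}(expn1 p) dvdn_exp2l // subn_gt0.
Qed.

(** The set [orbit_coset e l x] determines e and l: this lemma and the next one
    are used in both directions to compare two descriptions of the same atom. *)
Lemma orbit_coset_dvd e e' l x : e %| p.-1 -> x \in G -> l < lev x ->
  x ^+ (t ^ e') \in orbit_coset e l x -> e %| e'.
Proof.
move=> ep Gx lt_lx /(orbit_cosetP _ _ _ Gx)[_ [i hi]].
have /esym := power_coset Gx lt_lx hi.
exact: (teich_dvd p_pr hT ep).
Qed.

(** If x z is a product of x ^+ (t ^ (e * i)) with an element of the small
    subgroup, then t ^ (e * i) is 1 modulo p, hence fixes x, and z lies in the
    small subgroup. *)
Lemma orbit_coset_le e l l' x : x \in G -> l < lev x -> l' < lev x ->
  {in 'Ohm_l'(G), forall z, x * z \in orbit_coset e l x} -> l' <= l.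
Proof.
move=> Gx lt_lx lt_l'x st; rewrite leqNgt; apply/negP=> lt_ll'.
have [y Gy ly] : exists2 y, y \in G & lev y = l'.
  by apply: exists_lev; apply: leq_trans (ltnW lt_l'x) (lev_le hG Gx).
have /(orbit_cosetP _ _ _ Gx)[_ [i hi]] : x * y \in orbit_coset e l x.
  by apply: st; rewrite (mem_OhmG hG) ?ly.
have Gxi : x ^+ (t ^ (e * i)) \in G by rewrite groupX.
have : (x ^+ (t ^ (e * i)))^-1 * x ^+ (t ^ 0) \in 'Ohm_l'(G).
  have := subsetP (Ohm_subset hG (ltnW lt_ll')) _ hi.
  have Ky : y \in 'Ohm_l'(G) by rewrite (mem_OhmG hG) ?ly.
  by rewrite mulgA (groupMr _ Ky) expn0 expg1.
move/(power_coset Gx lt_l'x)/(teich_pow hT hG le_nN Gx) => e1.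
move: hi; rewrite e1 expn0 expg1 mulKg (mem_OhmG hG) // ly leqNgt lt_ll'.
by [].
Qed.

Lemma orbit_coset_code e j w l x : x \in G -> lev x = (height w).+1 ->
  height w - j <= l -> l <= height w ->
  code_inv p t G ((e.+1, j) :: w) (fun y => y \in orbit_coset e.+1 l x).
Proof.
move=> Gx lx le_l le_lw; have lt_lx : l < lev x by rewrite lx.
have i0 : code_inv p t G w (fun y => y \in orbit_coset e.+1 l x).
  apply: (code_inv_eq hG hT (f' := fun=> false)); last exact: code_inv_const.
  move=> y Gy ly; apply/negbTE; apply: contraL ly => /(lev_orbit_coset Gx lt_lx) ->.
  by rewrite lx ltnn.
rewrite /= i0 /=; apply/andP; split.
  apply/power_invP=> y Gy _; apply/idP/idP; last exact: orbit_coset_power.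
  by move=> Oy; rewrite -(teich_inv e.+1 Gy); apply: power_stableX Oy => z; apply: orbit_coset_power.
apply/shift_invP=> y z Gy Gz _ lz; apply: orbit_coset_shift => //.
by rewrite (mem_OhmG hG) // (leq_trans lz).
Qed.

End OrbitCosets.

(** * Every family is described by a word *)

Section Classification.
Variables (p N t : nat) (gT : finGroupType).
Hypotheses (p_odd : odd p) (hT : teichmuller p N t).
Local Notation lev := (lev p).

Lemma mem_code_sets n (G : {group gT}) w (A : {set gT}) :
    cyclic_pgroup p n G -> height w <= n -> A \subset G ->
  (A :&: 'Ohm_(height w)(G) \in code_sets p t 'Ohm_(height w)(G) w) =
  code_inv p t G w (fun x => x \in A).
Proof.
move=> hG le_wn sA; rewrite inE subsetIr -(code_inv_Ohm t _ hG) ?leqnn //=.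
have e : {in G, forall x, lev x <= height w -> (x \in A :&: 'Ohm_(height w)(G)) = (x \in A)}.
  by move=> x Gx lx; rewrite in_setI (mem_OhmG hG) // lx andbT.
by apply/idP/idP; apply: (code_inv_eq hG hT) => x Gx lx; rewrite e.
Qed.

(** A family whose restriction to a member subgroup is known is determined by the
    atoms outside this subgroup. *)
Lemma code_sets_cons n (G : {group gT}) F u w :
    cyclic_pgroup p n G -> n <= N -> schur_sets G F ->
    height w <= n -> 'Ohm_(height w)(G) \in F ->
    restrict_sets F 'Ohm_(height w)(G) = code_sets p t 'Ohm_(height w)(G) w ->
    (forall A : {set gT}, A \in F -> code_inv p t G w (fun x => x \in A) ->
       code_inv p t G (u :: w) (fun x => x \in A)) ->
    (forall (A : {set gT}) x y, code_inv p t G (u :: w) (fun x => x \in A) ->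
       x \in G -> y \in G -> height w < lev x -> height w < lev y ->
       same_atom F x y -> x \in A -> y \in A) ->
  F = code_sets p t G (u :: w).
Proof.
move=> hG le_nN sF le_wn FH eF top1 top2; set H := 'Ohm_(height w)(G) in FH eF.
have FHE (A : {set gT}) : A \subset G -> (A :&: H \in F) = code_inv p t G w (fun x => x \in A).
  by move=> sA; rewrite -(mem_code_sets hG) // -eF inE subsetIr andbT.
apply/setP=> A; rewrite [RHS]inE; apply/idP/andP=> [FA|[sA iA]].
  have sA := schur_sub sF FA; split=> //; apply: top1 => //.
  by rewrite -FHE // (schurI sF).
have FAH : A :&: H \in F.
  by rewrite FHE //; case: (u) iA => [[|e] j] /= => [/andP[]|/and3P[]].
apply: (schur_stable sF) => // x y Ax Gy sxy; have Gx := subsetP sA x Ax.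
have eH : (x \in H) = (y \in H) by apply: (same_atomP _ _ _ sxy).
have [Hx|nHx] := boolP (x \in H).
  have : x \in A :&: H by rewrite inE Ax.
  by rewrite (same_atomP _ _ _ sxy _ FAH) inE => /andP[].
apply: (top2 A x y iA) => //; first by move: nHx; rewrite (mem_OhmG hG) // -ltnNge.
by move: nHx; rewrite eH (mem_OhmG hG) // -ltnNge.
Qed.

Section OrbitTop.
Variables (n : nat) (G : {group gT}) (F : {set {set gT}}) (g : gT).
Hypotheses (hG : cyclic_pgroup p n.+1 G) (lt_nN : n < N) (sF : schur_sets G F).
Hypotheses (FH : 'Ohm_n(G) \in F) (Gg : g \in G) (lg : lev g = n.+1).
Let C := atom G F g.
Let p_pr : prime p. Proof. by case: hG. Qed.
Let cG : cyclic G. Proof. by case: hG. Qed.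
Let sCG : {subset C <= G}. Proof. exact/subsetP/(schur_sub sF)/schur_atom. Qed.
Let Cg : g \in C. Proof. exact: mem_atom. Qed.

(** Let K be the stabilizer of C.  The image of C in G / K is an atom with trivial
    stabilizer, so [reduced_top] describes the whole quotient family, and the
    K-invariant members are the preimages of the members of that family. *)
Lemma orbit_top : exists k e, [/\ k <= n, e %| p.-1, 'Ohm_k(G) \in F,
  forall c, c \in C <-> c \in orbit_coset p t G e k g &
  forall A : {set gT}, A \subset G -> (forall a z, a \in A -> z \in 'Ohm_k(G) -> a * z \in A) ->
    A \in F <-> power_stable (t ^ e) A].
Proof.
have C1 : 1 \notin C.
  rewrite in_atom group1 /=; apply/negP=> /same_atomP/(_ _ (schur1 sF)).
  by rewrite !inE eqxx => /eqP g1; move: lg; rewrite g1 lev1.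
have FC : C \in F := schur_atom sF g.
have [k [le_kn eK oK]] := subgroup_Ohm hG (schur_sub sF (schur_rad cG sF FC)).
have FK : 'Ohm_k(G) \in F by rewrite -eK schur_rad.
have le_kn' : k <= n.
  rewrite -ltnS ltn_neqAle le_kn andbT; apply/eqP=> ekn.
  have : g^-1 \in rad G C by rewrite [rad G C]eK ekn (Ohm_full hG) ?groupV.
  by move/rad_stable/(_ Cg); rewrite mulgV (negPf C1).
pose K := 'Ohm_k(G)%G; have nKG : K <| G := Ohm_normal _ _.
have nG : {subset G <= 'N(K)} by apply/subsetP/normal_norm.
have hq := quotient_cyclic_pgroup hG le_kn.
have sQ := schur_quotient nKG sF FK.
have GKg : coset K g \in G / K by apply: mem_quotient.
have lq : lev (coset K g) = n.+1 - k by rewrite (lev_coset hG le_kn) ?lg.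
have q_gt0 : 0 < n.+1 - k by rewrite subn_gt0.
have FHq : 'Ohm_(n.+1 - k).-1(G / K) \in quotient_sets G K F.
  rewrite inE Ohm_sub /= (coset_pre_Ohm hG le_kn) -subnS subSS subnK //.
(* K-invariant sets are the preimages of their images. *)
have preE (A : {set gT}) : A \subset G -> (forall a z, a \in A -> z \in K -> a * z \in A) ->
    coset_pre G (coset K @: A) = A.
  move=> sA stA; apply/setP=> x; rewrite inE; apply/andP/idP=> [[Gx /imsetP[a Aa e]]|Ax].
    have Ga := subsetP sA a Aa.
    have /rcoset_kercosetP := e; rewrite norm_rlcoset ?nG // => /(_ isT isT).
    by case/lcosetP=> z Kz ->; apply: stA.
  by split; [apply: (subsetP sA) | apply: imset_f].
have imS (A : {set gT}) : A \subset G -> coset K @: A \subset G / K.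
  by move=> sA; apply/subsetP=> _ /imsetP[a Aa ->]; apply/mem_quotient/(subsetP sA).
have stC a z : a \in C -> z \in K -> a * z \in C.
  by move=> Ca Kz; apply: (@rad_stable _ G) Ca; rewrite [rad G C]eK.
pose C' := atom (G / K) (quotient_sets G K F) (coset K g).
have preC : coset_pre G C' = C.
  have : C' \in quotient_sets G K F by apply: schur_atom.
  rewrite inE => /andP[_ FC']; apply: (atom_min FC').
    rewrite -/C -(preE C (schur_sub sF FC) stC).
    have sub : C' \subset coset K @: C.
      by apply: atom_sub; [rewrite inE preE // ?imS ?(schur_sub sF) | apply: imset_f].
    by apply/subsetP=> x; rewrite !inE => /andP[-> /(subsetP sub)].
  by apply/set0Pn; exists g; rewrite inE Gg mem_atom.
have memC x : x \in G -> (x \in C) = (coset K x \in C') by move=> Gx; rewrite -preC inE Gx.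
have red : ~ (forall c z, c \in C' -> z \in 'Ohm_1(G / K) -> c * z \in C').
  move=> st; have [x Gx lx] := exists_lev hG (le_kn' : k.+1 <= n.+1).
  have : x \in rad G C.
    apply: radP => // c Cc; have Gc := sCG Cc.
    rewrite memC ?groupM // morphM ?nG //; apply: st; first by rewrite -memC.
    by rewrite (mem_OhmG hq) ?mem_quotient // (lev_coset hG le_kn) // lx subSnn.
  by rewrite [rad G C]eK (mem_OhmG hG) // lx ltnn.
have [|e ep [hC hB]] := reduced_top p_odd hT hq _ sQ FHq GKg lq red.
  by rewrite q_gt0 (leq_trans (leq_subr _ _)).
exists k, e; split=> // [c|A sA stA].
  split=> [Cc|/(orbit_cosetP hG hT lt_nN _ _ _ Gg)[Gc [i hi]]].
    have Gc := sCG Cc; have := Cc; rewrite memC // => /hC[i ei].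
    apply/(orbit_cosetP hG hT lt_nN _ _ _ Gg); split=> //; exists i.
    apply: coset_idr; first by rewrite nG ?groupM ?groupV ?groupX.
    by rewrite morphM ?morphV ?groupV ?nG ?groupX //= morphX ?nG //= ei mulVg.
  rewrite memC //; apply/hC; exists i.
  rewrite -[c](mulKVg (g ^+ (t ^ (e * i)))) morphM ?nG ?groupM ?groupV ?groupX //=.
  by rewrite (coset_id hi) mulg1 morphX ?nG.
have := hB _ (imS A sA); rewrite inE preE // imS //=.
move=> [h1 h2]; split=> [/h1 st a Aa|st].
  have Ga := subsetP sA a Aa; rewrite -(preE A) // inE groupX //=.
  by rewrite morphX ?nG //; apply/st/imset_f.
apply: h2 => _ /imsetP[a Aa ->]; have Ga := subsetP sA a Aa.
by rewrite -morphX ?nG //; apply/imset_f/st.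
Qed.

End OrbitTop.
(** By induction on n, applied to the largest proper subgroup that is a member.
    The validity of the new letter comes from the last part of [orbit_top], which
    provides members above K that a letter of another kind would exclude. *)
Theorem schur_sets_code n (G : {group gT}) F :
    cyclic_pgroup p n G -> n <= N -> schur_sets G F ->
  exists w, [/\ valid p w, height w = n & F = code_sets p t G w].
Proof.
have [m] := ubnP n; elim: m n G F => // m IHm [|n] G F; rewrite ltnS => le_nm hG le_nN sF.
  exists [::]; split=> //; apply/setP=> A; rewrite inE /= andbT.
  have eG : G :=: [set 1].
    by apply/eqP; rewrite eq_sym eqEcard sub1set group1 cards1; case: hG => _ _ ->.
  apply/idP/idP=> [/(schur_sub sF)//|]; rewrite eG subset1.
  by case/orP=> /eqP ->; [apply: (schur1 sF) | apply: (schur0 sF)].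
have [p_pr cG oG] := hG.
have exh : exists h, (h <= n) && ('Ohm_h(G) \in F).
  by exists 0%N; rewrite (Ohm_0 hG) (schur1 sF).
have ubh h : (h <= n) && ('Ohm_h(G) \in F) -> h <= n by case/andP.
case: (ex_maxnP exh ubh) => h /andP[le_hn FH] maxh.
have le_hn1 : h <= n.+1 := leqW le_hn.
have hH := Ohm_cyclic_pgroup hG le_hn1.
have sH := schur_restrict sF (Ohm_sub h G) FH.
have [|w [vw hw eFH]] := IHm h _ _ (leq_ltn_trans le_hn le_nm) hH _ sH.
  by apply: leq_trans le_hn (ltnW le_nN).
subst h.
have [g defG lg] := exists_generator hG; have Gg : g \in G by rewrite defG cycle_id.
have [lt_hn|ge_hn] := ltnP (height w) n.
  have eh : height w + (n - (height w).+1).+2 = n.+1 by move: lt_hn; clear; lia.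
  exists ((0, n - (height w).+1)%N :: w); split; rewrite /= ?vw //.
  have gapF i : height w < i < n.+1 -> 'Ohm_i(G) \notin F.
    case/andP=> lt_hi lt_in; apply/negP=> Fi; have := maxh i.
    by rewrite Fi andbT -ltnS lt_in => /(_ isT); rewrite leqNgt lt_hi.
  have hA := trivial_top_atom hG p_odd (lt_hn : (height w).+1 < n.+1) sF FH gapF Gg lg.
  have samex x y : x \in G -> y \in G -> height w < lev x -> height w < lev y -> same_atom F x y.
    move=> Gx Gy lx ly.
    have mem z : z \in G -> height w < lev z -> z \in atom G F g.
      by move=> Gz lz; rewrite hA in_setD (mem_OhmG hG) // -ltnNge lz.
    have := mem y Gy ly; rewrite -(atom_eq (mem x Gx lx)).
    by rewrite in_atom => /andP[].
  apply: (code_sets_cons hG le_nN sF le_hn1 FH eFH) => [A FA iA|A x y].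
    rewrite /= iA /=; apply/const_betweenP=> x y Gx Gy /andP[lx _] /andP[ly _].
    exact: (same_atomP _ _ _ (samex x y Gx Gy lx ly)).
  move=> /= /andP[_ /const_betweenP cA] Gx Gy lx ly _ Ax.
  by rewrite -(cA x y Gx Gy) ?lx ?ly //= eh (lev_le hG).
have {ge_hn le_hn} ehn : n = height w by apply/eqP; rewrite eqn_leq ge_hn le_hn.
subst n.
have [k [e [le_k ep FK hC hStar]]] := orbit_top hG le_nN sF FH Gg lg.
have e_gt0 : 0 < e by apply: dvdn_gt0 ep; rewrite -subn1 subn_gt0 prime_gt1.
case: e e_gt0 ep hC hStar => // e _ ep hC hStar.
pose H := 'Ohm_(height w)(G); pose C := atom G F g.
have lt_kg : k < lev g by rewrite lg.
have orbF l x : x \in G -> k <= l -> l < lev x -> orbit_coset p t G e.+1 l x \in F.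
  move=> Gx le_kl lt_lx; apply/hStar.
  - by apply/subsetP=> y /(orbit_cosetP hG hT le_nN _ _ _ Gx)[].
  - move=> a z; have sKL := subsetP (Ohm_subset hG le_kl).
    by move=> Oa Kz; rewrite (orbit_coset_shift hG hT le_nN) ?sKL.
  by move=> a; apply: (orbit_coset_power hG hT le_nN).
exists ((e.+1, height w - k)%N :: w); split=> //; first last.
  have ek : height w - (height w - k) = k by rewrite subKn.
  have sKG := subsetP (Ohm_sub k G).
  have memA x y (A : {set gT}) : A \in F -> y \in atom G F x -> (y \in A) = (x \in A).
    by move=> FA; rewrite in_atom => /andP[_ /same_atomP/(_ _ FA)].
  apply: (code_sets_cons hG le_nN sF le_hn1 FH eFH) => [A FA iA|A x y].
    have topE x : x \in G -> height w < lev x <= (height w).+1 ->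
        exists2 u, x = g ^+ u & coprime p u.
      move=> Gx lx; have {}lx : lev x = lev g by apply/eqP; rewrite lg eqn_leq andbC.
      have [|u ex cou] := lev_generator hG Gg Gx; first by rewrite lx.
      by exists u => //; apply: cou; rewrite ?lx ?lg.
    have coG u : coprime p u -> coprime #|G| u by rewrite oG => cou; rewrite coprimeXl.
    rewrite /= iA /=; apply/andP; split.
      apply/power_invP=> x Gx /(topE x Gx)[u ex cou]; apply: memA => //.
      rewrite ex -(atom_power cG sF (coG u cou) Gg) -expgM mulnC expgM; apply: imset_f.
      by apply/hC; rewrite (orbit_coset_power hG hT le_nN) ?(mem_orbit_coset hG hT le_nN).
    apply/shift_invP=> x z Gx Gz /(topE x Gx)[u ex cou] lz; apply: memA => //.
    have co := coG u cou; rewrite ex -(atom_power cG sF co Gg).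
    have Kz : z \in 'Ohm_k(G) by rewrite (mem_OhmG hG) // -ek.
    rewrite -(expgK co Gz) -expgM mulnC expgM -expgMn; last first.
      by apply: (cyclic_mulgC hG) => //; rewrite groupX.
    apply: imset_f; apply/hC; rewrite (orbit_coset_shift hG hT le_nN) ?groupX //.
    exact: (mem_orbit_coset hG hT le_nN).
  move=> /= /and3P[_ /power_invP rA /shift_invP sA] Gx Gy lx _ sxy Ax.
  have top a : a \in G -> lev a = lev x -> height w < lev a <= (height w).+1.
    by move=> Ga ->; rewrite lx; apply: lev_le hG _ Gx.
  have lt_kx : k < lev x by apply: leq_ltn_trans lx.
  have : y \in orbit_coset p t G e.+1 k x.
    have Ox := mem_orbit_coset hG hT le_nN e.+1 k Gx.
    apply: (subsetP (atom_sub (G := G) (orbF k x Gx (leqnn k) lt_kx) Ox)).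
    by rewrite in_atom Gy.
  case/(orbit_cosetP hG hT le_nN _ _ _ Gx) => _ [i Kz].
  rewrite -[y](mulKVg (x ^+ (t ^ (e.+1 * i)))); have Gz := sKG _ Kz.
  have Axi j : x ^+ (t ^ (e.+1 * j)) \in A.
    elim: j => [|j IHj]; first by rewrite muln0 expn0 expg1.
    rewrite mulnS addnC expnD expgM rA ?groupX //.
    by apply: top; rewrite ?groupX // (lev_teich hG hT).
  rewrite sA ?groupX ?ek //; first by apply: top; rewrite ?groupX // (lev_teich hG hT).
  by rewrite -(mem_OhmG hG).
rewrite /= vw ep /= /supports subn_eq0.
case: leqP => //= lt_kw.
have FHE (A : {set gT}) : A \subset G -> (A :&: H \in F) = code_inv p t G w (fun x => x \in A).
  by move=> sA; rewrite -(mem_code_sets hG) // -eFH inE subsetIr andbT.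
have codeF (A : {set gT}) : A \in F -> code_inv p t G w (fun x => x \in A).
  by move=> FA; rewrite -FHE ?(schur_sub sF FA) // (schurI sF).
have [x Gx lx] := exists_lev hG le_hn1.
have lt_kx : k < lev x by rewrite lx.
case ew: w => [|[[|e'] j'] w']; first by move: lt_kw; rewrite ew.
  (* The layer of x is stable under K and under t ^ e, hence a member, whereas a
     block of at least two layers below would be a single atom. *)
  pose L := [set y in G | lev y == height w].
  have /codeF : L \in F.
    apply/hStar; first by apply/subsetP=> y; rewrite inE => /andP[].
      move=> a z; rewrite !inE => /andP[Ga /eqP la]; rewrite (mem_Ohm hG) => /andP[Gz lz].
      by rewrite groupM //= (levMr hG) ?la // (leq_ltn_trans lz).
    by move=> a; rewrite !inE => /andP[Ga /eqP la]; rewrite groupX //= (lev_teich hG hT) ?la.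
  have [y Gy ly] : exists2 y, y \in G & lev y = (height w').+1.
    by apply: (exists_lev hG); move: le_hn1; rewrite ew /=; clear; lia.
  rewrite ew /= => /andP[_ /const_betweenP/(_ x y Gx Gy)].
  rewrite !inE Gx Gy lx ly ew /= eqxx => h.
  have : (height w').+1 == height w' + j'.+2 by rewrite -h //; clear; lia.
  by clear; lia.
have [vw' ep' sw'] : [/\ valid p w', e'.+1 %| p.-1 & supports e'.+1 j' w'].
  by move: vw; rewrite ew /= => /and3P[].
have hww' : height w = (height w').+1 by rewrite ew.
pose k' := height w' - j'.
have := codeF _ (orbF k x Gx (leqnn k) lt_kx).
rewrite {1}ew /= => /and3P[_ /power_invP rO /shift_invP sO].
have Ox := mem_orbit_coset hG hT le_nN e.+1 k Gx.
have lxw : height w' < lev x <= (height w').+1 by rewrite lx hww' ltnSn.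
(* The set [orbit_coset e k x] is a member, so it is invariant for the letter
   (e', j') below. *)
have e_e' : e.+1 %| e'.+1.
  by apply: (orbit_coset_dvd hG hT le_nN ep Gx lt_kx); rewrite rO.
have le_k'k : k' <= k.
  apply: (orbit_coset_le hG hT le_nN (e := e.+1) Gx lt_kx) => [|z Kz].
    by rewrite lx hww' ltnS leq_subr.
  by rewrite sO ?(subsetP (Ohm_sub k' G) z Kz) // -(mem_OhmG hG) ?(subsetP (Ohm_sub k' G) z Kz).
(* Conversely [orbit_coset e' k x] is invariant for that letter and under K,
   hence stable under t ^ e. *)
have e'_e : e'.+1 %| e.+1.
  apply: (orbit_coset_dvd hG hT le_nN ep' Gx lt_kx).
  pose B := orbit_coset p t G e'.+1 k x.
  have sB : B \subset G by apply/subsetP=> y /(orbit_cosetP hG hT le_nN _ _ _ Gx)[].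
  have FB : B \in F.
    have <- : B :&: H = B.
      apply/setIidPl/subsetP=> y By; rewrite (mem_OhmG hG) ?(subsetP sB) //.
      by rewrite (lev_orbit_coset hG hT le_nN Gx lt_kx By) lx.
    rewrite FHE // ew; apply: (orbit_coset_code hG hT le_nN) => //; first by rewrite lx.
    by rewrite -ltnS -hww'.
  have stB a z : a \in B -> z \in 'Ohm_k(G) -> a * z \in B.
    by move=> Ba Kz; rewrite (orbit_coset_shift hG hT le_nN).
  have /(hStar B sB stB)/(_ x) := FB; apply.
  exact: (mem_orbit_coset hG hT le_nN).
rewrite eqn_dvd e'_e e_e' /=; move: (supports_le vw' sw') le_k'k lt_kw; rewrite -hww' /k' hww'.
by clear; lia.
Qed.

End Classification.

(** * Different words describe different families *)

Section Injectivity.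
Variables (p N t : nat) (gT : finGroupType).
Hypothesis hT : teichmuller p N t.
Local Notation lev := (lev p).

Section OneCode.
Variables (n : nat) (G : {group gT}) (u : nat * nat) (w : code).
Hypotheses (hG : cyclic_pgroup p n G) (le_nN : n <= N) (hw : height (u :: w) = n).
Let F := code_sets p t G (u :: w).
Let le_wn : height w <= n. Proof. by rewrite -hw ltnW ?height_cons. Qed.

Lemma code_sets_lower (A : {set gT}) : A \subset 'Ohm_(height w)(G) ->
  (A \in F) = (A \in code_sets p t 'Ohm_(height w)(G) w).
Proof.
move=> sA; have sAG := subset_trans sA (Ohm_sub _ G).
rewrite -{2}(setIidPl sA) (mem_code_sets hT hG) // inE sAG /=.
apply/idP/idP=> [|i0]; first by case: (u) => [[|e] j] /= => [/andP[]|/and3P[]].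
apply: (code_inv_top hG hT (c := false)) => // x Gx /andP[lx _].
by apply: contraTF lx => /(subsetP sA); rewrite (mem_OhmG hG) // -leqNgt.
Qed.

Lemma code_sets_Ohm : 'Ohm_(height w)(G) \in F.
Proof.
rewrite code_sets_lower // inE subxx -(code_inv_Ohm t _ hG) ?leqnn //.
apply: (code_inv_eq hG hT (f' := fun=> true)); last exact: code_inv_const.
by move=> x Gx lx; rewrite (mem_OhmG hG).
Qed.

(** With [code_sets_Ohm], this recovers the height of the tail of a word as the
    largest level below n whose subgroup is a member. *)
Lemma code_sets_gap i : height w < i < n -> 'Ohm_i(G) \notin F.
Proof.
case/andP=> lt_wi lt_in; apply/negP; rewrite inE => /andP[_].
have [x Gx lx] := exists_lev hG (ltnW lt_in); have [y Gy ly] := exists_lev hG (leqnn n).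
case: u hw => [[|e] j] /= h; last by move: lt_wi lt_in; rewrite -h; clear; lia.
case/andP=> _ /const_betweenP/(_ x y Gx Gy).
rewrite lx ly h lt_wi (ltnW lt_in) leqnn (ltn_trans lt_wi) // !(mem_OhmG hG) // lx ly leqnn.
by rewrite leqNgt lt_in => /(_ isT isT).
Qed.

End OneCode.

Lemma code_sets_orbit n (G : {group gT}) e1 j1 e2 j2 w :
    cyclic_pgroup p n G -> n <= N ->
    valid p ((e1.+1, j1) :: w) -> (height w).+1 = n ->
    code_sets p t G ((e1.+1, j1) :: w) = code_sets p t G ((e2.+1, j2) :: w) ->
  e1.+1 %| e2.+1 /\ height w - j2 <= height w - j1.
Proof.
move=> hG le_nN v1 hw eF; have [x Gx lx] := exists_lev hG (leqnn n).
have /and3P[vw ep sw] := v1; pose k := height w - j1.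
have lt_kx : k < lev x by rewrite lx -hw ltnS leq_subr.
pose O := orbit_coset p t G e1.+1 k x.
have : O \in code_sets p t G ((e1.+1, j1) :: w).
  rewrite inE; apply/andP; split.
    by apply/subsetP=> y /(orbit_cosetP hG hT le_nN _ _ _ Gx)[].
  by apply: (orbit_coset_code hG hT le_nN); rewrite ?lx ?hw ?leq_subr.
rewrite eF inE /= => /and4P[_ _ /power_invP rO /shift_invP sO].
have Ox : x \in O := mem_orbit_coset hG hT le_nN _ _ Gx.
have lxw : height w < lev x <= (height w).+1 by rewrite lx hw leqnn.
split; first by apply: (orbit_coset_dvd hG hT le_nN ep Gx lt_kx); rewrite rO.
apply: (orbit_coset_le hG hT le_nN (e := e1.+1) Gx lt_kx) => [|z Kz].
  by rewrite lx -hw ltnS leq_subr.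
have Gz := subsetP (Ohm_sub _ G) z Kz.
by rewrite sO // -(mem_OhmG hG).
Qed.

Theorem code_sets_inj n (G : {group gT}) w1 w2 :
    cyclic_pgroup p n G -> n <= N -> valid p w1 -> valid p w2 ->
    height w1 = n -> height w2 = n -> code_sets p t G w1 = code_sets p t G w2 -> w1 = w2.
Proof.
elim: w1 n G w2 => [|u1 w1 IHw] n G [|u2 w2] hG le_nN //.
- by move=> _ _ <- h; have := height_cons u2 w2; rewrite h.
- by move=> _ _ h h2; have := height_cons u1 w1; rewrite h -h2.
move=> v1 v2 h1 h2 eF.
have le_h u w u' w' : height (u :: w) = n -> height (u' :: w') = n ->
    code_sets p t G (u :: w) = code_sets p t G (u' :: w') -> height w' <= height w.
  move=> h h' e; rewrite leqNgt; apply/negP=> lt.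
  have := code_sets_gap hG h (i := height w'); rewrite lt -h' height_cons => /(_ isT).
  by rewrite e (code_sets_Ohm hG h').
have eh : height w1 = height w2.
  by apply/eqP; rewrite eqn_leq (le_h _ _ _ _ h1 h2 eF) (le_h _ _ _ _ h2 h1 (esym eF)).
have le_wn : height w1 <= n by rewrite -h1 ltnW ?height_cons.
have vw1 : valid p w1 by case: u1 v1 {h1 eF} => e j /andP[].
have vw2 : valid p w2 by case: u2 v2 {h2 eF} => e j /andP[].
have ew : w1 = w2.
  apply: (IHw _ 'Ohm_(height w1)(G)%G w2 (Ohm_cyclic_pgroup hG le_wn)) => //.
    exact: leq_trans le_nN.
  apply/setP=> A; have [sA|nsA] := boolP (A \subset 'Ohm_(height w1)(G)); last first.
    by rewrite !inE (negPf nsA).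
  by rewrite -(code_sets_lower hG h1) // eF (code_sets_lower hG h2) -?eh.
subst w2; congr (_ :: _).
case: u1 u2 v1 v2 h1 h2 eF => [[|e1] j1] [[|e2] j2] v1 v2 /= h1 h2 eF.
- by congr (_, _); move: h2; rewrite -h1 => /addnI[].
- by move: h2; rewrite -h1; clear; lia.
- by move: h2; rewrite -h1; clear; lia.
have [d12 le12] := code_sets_orbit hG le_nN v1 h1 eF.
have [d21 le21] := code_sets_orbit hG le_nN v2 h2 (esym eF).
have /and3P[_ _ s1] := v1; have /and3P[_ _ s2] := v2.
congr (_, _); first by apply/eqP; rewrite eqn_dvd d12 d21.
by move: (supports_le vw1 s1) (supports_le vw1 s2) le12 le21; clear; lia.
Qed.

End Injectivity.

Local Close Scope group_scope.

(** * Counting words *)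

Section Enumeration.
Variable p : nat.
Hypothesis p_gt1 : 1 < p.
Let D := divisors p.-1.
Let p1_gt0 : 0 < p.-1. Proof. by rewrite -subn1 subn_gt0. Qed.

Let D_gt0 e : e \in D -> 0 < e.
Proof. by rewrite -dvdn_divisors //; apply: dvdn_gt0. Qed.

Definition trivial_codes (T : seq (seq code)) n : seq code :=
  [seq (0, b) :: w | b <- iota 0 n, w <- nth [::] T b.+1].

Definition orbit_codes (s : seq code) n : seq code :=
  [seq u :: w | u <- [seq (e, j) | e <- D, j <- iota 0 n.+1],
                w <- [seq w <- s | supports u.1 u.2 w]].

(** The words of heights n, n - 1, ..., 0, since the first letter of a word may
    remove several layers. *)
Fixpoint codes_upto n : seq (seq code) :=
  if n is m.+1 then
    let T := codes_upto m in
    (trivial_codes T m ++ orbit_codes (head [::] T) m) :: T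
  else [:: [:: [::]]].

Definition codes n : seq code := head [::] (codes_upto n).

Lemma nth_codes_upto n k : k <= n -> nth [::] (codes_upto n) k = codes (n - k).
Proof.
elim: n k => [|n IHn] [|k] //= le_kn.
by rewrite subSS IHn.
Qed.

Lemma codesS n : codes n.+1 =
  [seq (0, b) :: w | b <- iota 0 n, w <- codes (n - b.+1)] ++ orbit_codes (codes n) n.
Proof.
rewrite /codes /= -/(codes n); congr (_ ++ _); rewrite /trivial_codes.
congr flatten; apply/eq_in_map => b; rewrite mem_iota add0n => /andP[_ lt_bn].
by rewrite nth_codes_upto.
Qed.

Lemma mem_orbit_codes s n w : (w \in orbit_codes s n) =
  (if w is (e, j) :: w' then [&& e \in D, j < n.+1, w' \in s & supports e j w'] else false).
Proof.
apply/allpairsPdep/idP=> [[[e j] [w' [/allpairsP[[e' j'] [De Ij [-> ->]]]]]]|].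
  rewrite mem_filter => /andP[sw sw'] ->.
  by move: Ij; rewrite mem_iota add0n => /andP[_ ltj]; apply/and4P; split.
case: w => // -[e j] w /and4P[De lt_j sw sup]; exists (e, j), w.
split=> //; last by rewrite mem_filter sup.
by apply/allpairsP; exists (e, j); split=> //; rewrite mem_iota add0n.
Qed.

Lemma mem_codes n w : (w \in codes n) = valid p w && (height w == n).
Proof.
have [m] := ubnP n; elim: m n w => // m IHm [|n] w; rewrite ltnS => le_nm.
  rewrite inE; case: w => // u w; apply/esym/negbTE; rewrite negb_and -lt0n orbC.
  by rewrite (leq_ltn_trans _ (height_cons u w)).
rewrite codesS mem_cat mem_orbit_codes.
case: w => [|[[|e] j] w] /=; rewrite ?andbF ?andbT.
- by apply/orP=> [[/allpairsPdep[b [w [_ _]]]|]].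
- have -> : 0 \in D = false by apply: contraTF isT => /D_gt0.
  rewrite /= orbF; apply/allpairsPdep/andP=> [[b [w' [Ib]]]|[vw hw]].
    move=> cw' [-> ->]; move: Ib cw'; rewrite mem_iota add0n => /andP[_ lt_b].
    rewrite IHm; last by apply: leq_trans le_nm; rewrite ltnS leq_subr.
    by case/andP=> -> /eqP->; split=> //; apply/eqP; move: lt_b; clear; lia.
  have lt_jn : j < n by move: hw; clear; lia.
  have lt_m : n - j.+1 < m by apply: leq_trans le_nm; rewrite ltnS leq_subr.
  exists j, w; split; rewrite ?mem_iota //.
  by rewrite IHm // vw; move: hw lt_jn; clear; lia.
rewrite (_ : _ \in [seq _ | _ <- _, _ <- _] = false) /=; last first.
  by apply/negbTE/allpairsPdep=> [[b [w' [_ _]]]].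
rewrite -dvdn_divisors // IHm // eqSS.
case vw: (valid p w); rewrite /= ?andbF //; case: (_ %| _) => //=.
have [sup|] := boolP (supports e.+1 j w); rewrite ?andbF // !andbT.
apply: andb_idl => /eqP <-; rewrite ltnS; exact: supports_le vw sup.
Qed.

Lemma codes_uniq n : uniq (codes n).
Proof.
have [m] := ubnP n; elim: m n => // m IHm [|n] //; rewrite ltnS => le_nm.
rewrite codesS cat_uniq; apply/and3P; split.
- apply: allpairs_uniq_dep => [|b Ib|[b w] [b' w'] _ _ [-> ->] //]; first exact: iota_uniq.
  by apply: IHm; apply: leq_trans le_nm; rewrite ltnS leq_subr.
- apply/hasPn=> w; rewrite mem_orbit_codes; case: w => // -[e j] w /and4P[/D_gt0 e_gt0 _ _ _].
  by apply/negP=> /allpairsPdep[b [w' [_ _ [e0 _ _]]]]; rewrite e0 in e_gt0.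
apply: allpairs_uniq_dep => [|[e j] _|[u w] [u' w'] _ _ [-> ->] //].
  by apply: allpairs_uniq; rewrite ?divisors_uniq ?iota_uniq // => -[a b] [a' b'] _ _ [-> ->].
by apply: filter_uniq; apply: IHm.
Qed.

Definition num_codes n := size (codes n).
(** The number of words of height n on which the letter (e, i) can be put. *)
Definition num_supp e n i := count (supports e i) (codes n).

Lemma sum_iota n (E : nat -> nat) : \sum_(j <- iota 0 n) E j = \sum_(0 <= j < n) E j.
Proof. by rewrite /index_iota subn0. Qed.

Lemma num_supp0 e n : num_supp e n 0 = num_codes n.
Proof. exact: count_predT. Qed.

Lemma num_codesS n : num_codes n.+1 =
  \sum_(0 <= b < n) num_codes (n - b.+1) + \sum_(e <- D) \sum_(0 <= j < n.+1) num_supp e n j.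
Proof.
rewrite /num_codes codesS size_cat !size_allpairs_dep !sumnE !big_map sum_iota.
congr (_ + _); rewrite big_allpairs_dep; apply: eq_bigr => e _; rewrite sum_iota.
by apply: eq_bigr => j _; rewrite size_filter.
Qed.

(** A word that supports (e, i + 1) starts with a letter (e, j) such that
    i <= j. *)
Lemma num_suppS e n i : e \in D -> i <= n.+1 ->
  num_supp e n.+1 i.+1 = \sum_(i <= j < n.+1) num_supp e n j.
Proof.
move=> De le_in; have e_gt0 := D_gt0 De.
rewrite /num_supp codesS count_cat [X in X + _](_ : _ = 0) ?add0n; last first.
  apply/eqP; rewrite -leqn0 leqNgt -has_count; apply/hasPn=> w /allpairsPdep[b [w' [_ _ ->]]].
  by rewrite /supports /= eq_sym eqn0Ngt e_gt0.
rewrite count_flatten sumnE !big_map big_allpairs_dep /=.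
rewrite (bigD1_seq e) ?divisors_uniq //= [X in _ + X]big1 ?addn0; last first.
  move=> e' ne; rewrite big1 // => j _; rewrite count_map; apply/eqP.
  rewrite -leqn0 leqNgt -has_count; apply/hasPn=> w _.
  by rewrite /supports /= (negPf ne).
rewrite (sum_iota n.+1 (fun j => count (supports e i.+1) [seq (e, j) :: w | w <- [seq w <- codes n | supports e j w]])).
rewrite (big_cat_nat (n := i)) //= [X in X + _]big_nat [X in X + _]big1 ?add0n; last first.
  move=> j /andP[_ lt_ji]; rewrite count_map; apply/eqP.
  rewrite -leqn0 leqNgt -has_count; apply/hasPn=> w _.
  by rewrite /supports /= eqxx /= -ltnNge ltnS.
rewrite !big_nat; apply: eq_bigr => j /andP[le_ij _].
rewrite count_map -[RHS]size_filter -count_predT; apply: eq_in_count => w _.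
by rewrite /supports /= eqxx ltnS le_ij.
Qed.

End Enumeration.

Section Ballot.
Import GRing.Theory.
Local Open Scope ring_scope.

(** The number of paths of l steps from i that end at 0 and do not reach 0
    before, where each step goes down by at most 1. *)
Definition ballot (l i : nat) : int :=
  if l is l'.+1 then
    if (i <= l)%N then ('C(l + l' - i, l')%:Z - 'C(l + l' - i, l)%:Z) else 0
  else (i == 0%N)%:Z.

Lemma ballot_gt l i : (l < i)%N -> ballot l i = 0.
Proof. by case: l => [|l] /=; [case: i | rewrite ltnNge => /negPf->]. Qed.

(** Pascal's rule; the boundary case i = l is a straight descent. *)
Lemma ballot_rec l i : ballot l.+1 i.+1 = ballot l i + ballot l.+1 i.+2.
Proof.
have [lt_il|lt_li|->] := ltngtP i l; last first.
- rewrite [ballot l.+1 l.+2]ballot_gt // addr0 /= leqnn.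
  have -> : (l.+1 + l - l.+1 = l)%N by rewrite addKn.
  rewrite binn bin_small // subr0; case: l => //= l.
  by rewrite leqnn addKn binn bin_small // subr0.
- by rewrite !ballot_gt // ?addr0 ltnS // ltnW.
case: l lt_il => // l lt_il.
have c1 : (i.+1 <= l.+2)%N by apply: ltnW.
have c2 : (i <= l.+1)%N by apply: ltnW.
have c3 : (i.+2 <= l.+2)%N by [].
rewrite /= c1 c2 c3.
have -> : (l.+2 + l.+1 - i.+1 = (l.+1 + l - i).+1)%N by move: lt_il; clear; lia.
have -> : (l.+2 + l.+1 - i.+2 = l.+1 + l - i)%N by move: lt_il; clear; lia.
by rewrite !binS !PoszD; ring.
Qed.

(** The first step of a path from i + 1 leads to some j >= i. *)
Lemma ballot_sum l i M : (l < M)%N -> \sum_(i <= j < M) ballot l j = ballot l.+1 i.+1.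
Proof.
move=> lt_lM; have [k] := ubnP (M - i); elim: k i => // k IHk i; rewrite ltnS => le_k.
have [le_Mi|lt_iM] := leqP M i.
  by rewrite big_geq // ballot_gt // ltnS (leq_trans lt_lM).
rewrite big_ltn // IHk ?[RHS]ballot_rec //.
by rewrite subnS -ltnS prednK ?subn_gt0 // (leq_trans _ le_k).
Qed.

Lemma ballot0 l : ballot l 0 = (l == 0%N)%:Z.
Proof.
case: l => //= l; rewrite subn0; apply/eqP; rewrite subr_eq0; apply/eqP; congr Posz.
by rewrite -[LHS]bin_sub ?leq_addl // addnK.
Qed.

Lemma ballot1 l : ballot l.+1 1 = (Defs.catalan l)%:Z.
Proof.
rewrite /= subn1 addSn /= addnn.
have h1 := catalanE l; have := mul_bin_left l.*2 l; rewrite -addnn addnK addnn => h2.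
have : ((l.+1)%:Z * ('C(l.*2, l)%:Z - 'C(l.*2, l.+1)%:Z) = (l.+1)%:Z * (Defs.catalan l)%:Z)%R.
  rewrite mulrBr -!PoszM h2 [(l.+1 * Defs.catalan l)%N]mulnC h1 mulSn PoszD.
  by rewrite addrK.
by move/mulfI; apply.
Qed.

End Ballot.

Section Counting.
Import GRing.Theory.
Variable p : nat.
Hypothesis p_gt1 : 1 < p.
Local Notation D := (divisors p.-1).
Local Notation num_codes := (num_codes p).
Local Notation num_supp := (num_supp p).

Lemma PoszE n : Posz n = (n%:R)%R. Proof. by rewrite natz. Qed.

(** Follow the numbers j down the word until the first letter that is supported
    for the trivial reason j = 0; the rest of the word, of height h, is
    arbitrary. *)
Lemma num_supp_ballot e n i : e \in D -> i <= n.+1 ->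
  ((num_supp e n i)%:Z = \sum_(0 <= h < n.+1) (num_codes h)%:Z * ballot (n - h) i)%R.
Proof.
move=> De; elim: n i => [|n IHn] [|i] le_in.
- by rewrite big_nat1 /= mulr1 num_supp0.
- by rewrite big_nat1 /= mulr0 /num_supp /supports /= addn0.
- rewrite num_supp0 big_nat_recr //= subnn ballot0 mulr1 big_nat big1 ?add0r // => h /andP[_ lt_h].
  by rewrite ballot0 subn_eq0 leqNgt lt_h mulr0.
rewrite num_suppS // [RHS]big_nat_recr //= subnn [ballot 0 _]/= mulr0 addr0.
rewrite PoszE natr_sum big_nat.
under eq_bigr => j /andP[_ lt_j].
  rewrite -PoszE IHn; last exact: ltnW.
  over.
rewrite -big_nat exchange_big /=; rewrite big_nat [RHS]big_nat; apply: eq_bigr => h /andP[_ lt_h].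
by rewrite -mulr_sumr ballot_sum ?ltnS ?leq_subr // subSn.
Qed.

(** Summing over the second component of the top letter amounts to counting the
    paths from 1. *)
Lemma num_codes_catalan n : num_codes n.+1 =
  \sum_(0 <= b < n) num_codes (n - b.+1)
    + size D * \sum_(0 <= h < n.+1) num_codes h * Defs.catalan (n - h).
Proof.
rewrite num_codesS //; congr (_ + _).
rewrite (eq_big_seq (fun=> \sum_(0 <= h < n.+1) num_codes h * Defs.catalan (n - h))); last first.
  move=> e De.
  have : ((\sum_(0 <= j < n.+1) num_supp e n j)%N%:Z =
          (\sum_(0 <= h < n.+1) num_codes h * Defs.catalan (n - h))%N%:Z)%R; last by case.
  rewrite !PoszE !natr_sum big_nat.
  under eq_bigr => j /andP[_ lt_j].
    rewrite -PoszE num_supp_ballot //; last exact: ltnW.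
    over.
  rewrite -big_nat exchange_big /=; rewrite big_nat [RHS]big_nat; apply: eq_bigr => h /andP[_ lt_h].
  by rewrite -mulr_sumr ballot_sum ?ltnS ?leq_subr // ballot1 natrM -!PoszE.
by rewrite big_const_seq count_predT iter_addn_0 mulnC.
Qed.

Lemma num_codes_rec n : 0 < n ->
  num_codes n = size D * num_codes (n - 1) +
    \sum_(2 <= k < n.+1) (Defs.catalan (k - 1) * size D + 1) * num_codes (n - k).
Proof.
case: n => // n _; rewrite num_codes_catalan subn1 /= !big_add1 /=.
have -> : \sum_(0 <= h < n.+1) num_codes h * Defs.catalan (n - h) =
          \sum_(0 <= c < n.+1) num_codes (n - c) * Defs.catalan c.
  rewrite big_nat_rev; apply: eq_big_nat => c /andP[_ lt_c].
  by rewrite add0n subSS subKn.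
rewrite big_nat_recl // subn0 [Defs.catalan 0]/= muln1 mulnDr addnCA; congr (_ + _).
rewrite big_distrr -big_split; apply: eq_bigr => b _ /=.
rewrite subn1 subSS mulnDl mul1n addnC /=; congr (_ + _).
by rewrite mulnCA mulnC; congr (_ * _); rewrite mulnC.
Qed.

End Counting.

Lemma Zp_cyclic_pgroup p n : prime p -> cyclic_pgroup p n (Zp_group (p ^ n)).
Proof.
move=> p_pr; have q_gt0 : 0 < p ^ n by rewrite expn_gt0 prime_gt0.
split=> //; last exact: card_Zp.
rewrite /= /Zp; case: ifP => _; last exact: cyclic1.
by rewrite Zp_cycle cycle_cyclic.
Qed.

Lemma Omega_num_codes p n : prime p -> odd p -> Omega p n = num_codes p n.
Proof.
move=> p_pr p_odd; have p_gt1 := prime_gt1 p_pr; have [t hT] := exists_teichmuller p_pr n.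
have hG := Zp_cyclic_pgroup n p_pr.
have codesP w : w \in codes p n -> valid p w /\ height w = n.
  by rewrite mem_codes // => /andP[vw /eqP hw].
apply: (size_schur_rings (phi := code_sets p t (Zp_group (p ^ n)))).
- by case: hG.
- exact: codes_uniq.
- move=> w1 w2 /codesP[v1 h1] /codesP[v2 h2].
  exact: (code_sets_inj hT hG (leqnn n)).
- by move=> w /codesP[vw hw]; apply: (code_sets_schur hG hT).
move=> F sF; have [w [vw hw ->]] := schur_sets_code p_odd hT hG (leqnn n) sF.
by exists w; rewrite // mem_codes // vw hw eqxx.
Qed.

Theorem theorem5p11 (p : nat) (hp : prime p) (hodd : odd p) :
  let x := size (divisors (p - 1)) in
  [/\ Omega p 0 = 1,
      Omega p 1 = x &
      forall n : nat, 1 <= n ->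
        Omega p n = x * Omega p (n - 1)
          + \sum_(2 <= k < n.+1) (catalan (k - 1) * x + 1) * Omega p (n - k)].
Proof.
move=> x; have p_gt1 := prime_gt1 hp.
have ex : x = size (divisors p.-1) by rewrite /x subn1.
have Orec n : 1 <= n -> Omega p n = x * Omega p (n - 1)
    + \sum_(2 <= k < n.+1) (catalan (k - 1) * x + 1) * Omega p (n - k).
  move=> n_gt0; rewrite !Omega_num_codes // num_codes_rec // -ex.
  by congr (_ + _); apply: eq_bigr => k _; rewrite Omega_num_codes.
have O0 : Omega p 0 = 1 by rewrite Omega_num_codes.
by split=> //; rewrite Orec // big_geq // subnn O0 muln1 addn0.
Qed.
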